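(* The set $\mathrm{JorN}_5\subset \mathbf{k}^{125}$ of five-dimensional nilpotent Jordan algebra structures over $\mathbf{k}$ is a connected affine variety with an infinite number of orbits under the action of the group $G=\mathrm{GL}_5(\mathbf{k})$. Furthermore, its irreducible components are exactly the following five: the four Zariski closures $\overline{\epsilon_1^{G}}$, $\overline{\mathcal{J}_{21}^{G}}$, $\overline{\mathcal{J}_{22}^{G}}$, $\overline{\mathcal{J}_{40}^{G}}$ of the $G$-orbits of the algebras $\epsilon_1,\mathcal{J}_{21},\mathcal{J}_{22},\mathcal{J}_{40}$, all four of which are rigid, and one more component, namely the Zariski closure $\overline{\mathcal{N}_{27}^{\#}}$ of the infinite union of orbits $\mathcal{N}_{27}^{\#}$.
   Context: $\mathbf{k}$ is an algebraically closed field of characteristic $\neq 2,3$. A Jordan algebra is a commutative $\mathbf{k}$-algebra with $((xx)y)x=(xx)(yx)$ for all $x,y$. Powers are defined by $\mathcal{J}^1=\mathcal{J}$, $\mathcal{J}^n=\mathcal{J}^{n-1}\mathcal{J}+\mathcal{J}^{n-2}\mathcal{J}^2+\cdots+\mathcal{J}\mathcal{J}^{n-1}$; $\mathcal{J}$ is nilpotent if $\mathcal{J}^n=0$ for some $n$. Fix an $n$-dimensional vector space $V$ with basis $e_1,\dots,e_n$. An algebra structure on $V$ is a point $(c_{ij}^k)\in\mathbf{k}^{n^3}$ via $e_ie_j=\sum_k c_{ij}^k e_k$. $\mathrm{JorN}_n\subset\mathbf{k}^{n^3}$ is the Zariski-closed set of structures that are nilpotent Jordan algebras. $G=\mathrm{GL}(V)$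 acts by $x\cdot_g y=g(g^{-1}x\cdot g^{-1}y)$; orbits correspond to isomorphism classes of algebras, and $\mathcal{J}^{G}$ denotes the orbit of (any structure isomorphic to) $\mathcal{J}$. Bars denote Zariski closure. An algebra $\mathcal{J}$ in $\mathrm{JorN}_n$ is called rigid if $\mathcal{J}^G$ is Zariski-open in $\mathrm{JorN}_n$. The following algebras have basis $n_1,\dots,n_5$; products not listed are zero or determined by commutativity. - $\epsilon_1$: $n_1^2=n_2$, $n_1n_2=n_3$, $n_2^2=n_1n_3=n_4$, $n_1n_4=n_2n_3=n_5$. - $\mathcal{J}_{21}$: $n_1n_2=n_3^2=n_4$, $n_3n_4=n_1^2=n_2^2=n_5$. - $\mathcal{J}_{22}$: $n_1^2=n_2$, $n_1n_2=n_3^2=n_4$, $n_2^2=n_1n_4=n_5$. - $\mathcal{J}_{40}$: $n_1n_2=n_3$, $n_2^2=n_1n_3=n_4$, $n_1^2=n_2n_3=n_5$. - $\mathcal{J}_{27}^{\varepsilon,\phi}$ ($\varepsilon,\phi\in\mathbf{k}$): $n_1^2=n_3$, $n_2^2=n_4$, $n_2n_3=n_1n_4=n_5$, $n_2n_4=\varepsilon n_5$, $n_1n_3=\phi n_5$. $\mathcal{N}_{27}^{\#}=\bigcup_{\varepsilon,\phi\in\mathbf{k},\ \varepsilon\phi\neq1}(\mathcal{J}_{27}^{\varepsilon,\phi})^{G}$. *)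

(* Defs.v *)
From HB Require Import structures.
From mathcomp Require Import all_boot all_algebra.
From mathcomp Require Import boolp classical_sets functions cardinality topology.
From mathcomp Require Import mpoly.

Set Implicit Arguments.
Unset Strict Implicit.
Unset Printing Implicit Defensive.

Import GRing.Theory.

Local Open Scope classical_set_scope.
Local Open Scope ring_scope.

(* The affine space k^I over a finite index set I.  It is an alias of
   {ffun I -> k}, so that it can carry the Zariski topology. *)
Definition affine (k : fieldType) (I : finType) : Type := {ffun I -> k}.

HB.instance Definition _ (k : fieldType) (I : finType) :=
  Choice.copy (affine k I) {ffun I -> k}.

Section Zariski.
Variables (k : fieldType) (I : finType).
Implicit Types (c : affine k I) (S : set {mpoly k[#|I|]}).

Definition acoord c (i : I) : k := (c : {ffun I -> k}) i.

(* The variable 'X_m of {mpoly k[#|I|]} is the coordinate of index enum_val m. *)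
Definition peval (p : {mpoly k[#|I|]}) c : k :=
  p.@[fun m => acoord c (enum_val m)].

Definition zeros S : set (affine k I) :=
  [set c | forall p, S p -> peval p c = 0].

Definition zariski_open : set_system (affine k I) :=
  [set U | exists S, ~` U = zeros S].

Lemma zariski_openT : zariski_open setT.
Proof.
exists [set 1]; rewrite setCT; apply/seteqP; split=> // c /(_ 1 erefl).
by rewrite /peval rmorph1 => /eqP; rewrite oner_eq0.
Qed.

Lemma zariski_openI : setI_closed zariski_open.
Proof.
move=> U V [S US] [T VT].
exists [set r | exists p q, [/\ S p, T q & r = p * q]].
rewrite setCI US VT; apply/seteqP; split=> c.
  move=> [Sc|Tc] _ [p [q [Sp Tq ->]]]; rewrite /peval rmorphM /=.
    by rewrite [X in X * _](Sc p Sp) mul0r.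
  by rewrite [X in _ * X](Tc q Tq) mulr0.
move=> STc; have [Sc|] := pselect (zeros S c); first by left.
move=> /existsNP[p /not_implyP[Sp /eqP pc]]; right=> q Tq.
have /eqP := STc (p * q) (ex_intro _ p (ex_intro _ q (And3 Sp Tq erefl))).
by rewrite /peval rmorphM /= mulf_eq0 (negPf pc) => /eqP.
Qed.

Lemma zariski_open_bigU (J : Type) (f : J -> set (affine k I)) :
  (forall j, zariski_open (f j)) -> zariski_open (\bigcup_j f j).
Proof.
move=> /choice[S fS]; exists (\bigcup_j S j).
rewrite setC_bigcup; apply/seteqP; split=> c.
  move=> fc p [j _ Sp]; have: (~` f j) c by apply: fc.
  by rewrite fS; apply.
by move=> Sc j _; rewrite fS => p Sp; apply: Sc; exists j.
Qed.

HB.instance Definition _ :=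
  isOpenTopological.Build (affine k I)
    zariski_openT zariski_openI zariski_open_bigU.

Lemma closed_zerosP (C : set (affine k I)) :
  closed C <-> exists S, C = zeros S.
Proof.
by rewrite -openC; split=> [[S]|[S CS]]; [|exists S]; rewrite setCK //; exists S.
Qed.

End Zariski.

Section Irreducibility.
Variable T : topologicalType.
Implicit Types A C D X : set T.

Definition irreducible A : Prop :=
  A !=set0 /\
  forall C D, closed C -> closed D -> A `<=` C `|` D -> A `<=` C \/ A `<=` D.

Definition irreducible_components X : set (set T) :=
  [set C | [/\ C `<=` X, irreducible C
    & forall D, D `<=` X -> irreducible D -> C `<=` D -> D = C]].

Definition open_in X A : Prop := exists2 U, open U & A = X `&` U.

End Irreducibility.

(* The structure c stands for the product e_i e_j = \sum_l c_(i, j, l) e_l on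
   V = 'cV[k]_n; the indices i, j, l start from 0. *)
Definition structures (k : fieldType) (n : nat) : topologicalType :=
  affine k ('I_n * 'I_n * 'I_n)%type.

Section Algebra.
Variables (k : fieldType) (n : nat).
Implicit Types (c d : structures k n) (x y : 'cV[k]_n).
Implicit Types (U W : {vspace 'cV[k]_n}).

Definition amul c x y : 'cV[k]_n :=
  \col_l \sum_i \sum_j x i 0 * y j 0 * acoord c (i, j, l).

Definition jordan c : Prop :=
  (forall x y, amul c x y = amul c y x) /\
  (forall x y, amul c (amul c (amul c x x) y) x
             = amul c (amul c x x) (amul c y x)).

(* The span of the products x y, x in U and y in W. *)
Definition vmul c U W : {vspace 'cV[k]_n} :=
  <<[seq amul c x y | x <- vbasis U, y <- vbasis W]>>%VS.

(* [:: J^1; ...; J^m] *)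
Fixpoint powers c (m : nat) : seq {vspace 'cV[k]_n} :=
  if m is m'.+1 then
    let s := powers c m' in
    rcons s (if m' is 0 then fullv
             else \sum_(i < m') vmul c (nth 0%VS s (m' - i.+1)) (nth 0%VS s i))%VS
  else [::].

(* J^m, for m > 0 *)
Definition power c (m : nat) : {vspace 'cV[k]_n} :=
  nth 0%VS (powers c m) m.-1.

Lemma size_powers c m : size (powers c m) = m.
Proof. by elim: m => //= m IHm; rewrite size_rcons IHm. Qed.

Lemma nth_powers c m i : (i < m)%N -> nth 0%VS (powers c m) i = power c i.+1.
Proof.
elim: m => // m IHm; rewrite ltnS leq_eqVlt => /orP[/eqP-> //|lt_im].
by rewrite /= nth_rcons size_powers lt_im IHm.
Qed.

Lemma power1 c : power c 1 = fullv.
Proof. by []. Qed.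

Lemma powerE c m : (1 < m)%N ->
  power c m = (\sum_(1 <= i < m) vmul c (power c (m - i)) (power c i))%VS.
Proof.
case: m => [|[|m]] // _.
transitivity
  (\sum_(i < m.+1) vmul c (nth 0%VS (powers c m.+1) (m.+1 - i.+1))
                          (nth 0%VS (powers c m.+1) i))%VS.
  by rewrite /power nth_rcons size_rcons size_powers ltnn eqxx.
rewrite big_add1 big_mkord; apply: eq_bigr => i _.
by rewrite nth_powers ?ltn_subrL // [in RHS]subSn ?nth_powers.
Qed.

Definition nilpotent c : Prop := exists2 m, (0 < m)%N & power c m = 0%VS.

Definition JorN : set (structures k n) := [set c | jordan c /\ nilpotent c].

(* The product x, y |-> g (g^-1 x . g^-1 y), for g in unitmx. *)
Definition gl_act (g : 'M[k]_n) c : structures k n :=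
  [ffun t : 'I_n * 'I_n * 'I_n =>
     (g *m amul c (invmx g *m delta_mx t.1.1 0) (invmx g *m delta_mx t.1.2 0))
       t.2 0].

Definition gl_orbit c : set (structures k n) :=
  [set d | exists2 g, g \in unitmx & d = gl_act g c].

Definition rigid c : Prop := JorN c /\ open_in JorN (gl_orbit c).

End Algebra.

Arguments JorN k n : clear implicits.

Section Tables.
Variable k : fieldType.
Local Open Scope nat_scope.

(* Below, indices start from 1: nn l is the l-th vector of the basis, and f i j
   is the product of the i-th and j-th ones for i <= j, the other products being
   obtained by commutativity. *)
Definition nn (l : nat) : 'cV[k]_5 := \col_(i < 5) (i.+1 == l)%:R%R.

Definition of_table (f : nat -> nat -> 'cV[k]_5) : structures k 5 :=
  [ffun t : 'I_5 * 'I_5 * 'I_5 =>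
     f (minn t.1.1 t.1.2).+1 (maxn t.1.1 t.1.2).+1 t.2 0%R].

Definition eps1 : structures k 5 := of_table (fun i j =>
  match i, j with
  | 1, 1 => nn 2
  | 1, 2 => nn 3
  | 2, 2 | 1, 3 => nn 4
  | 1, 4 | 2, 3 => nn 5
  | _, _ => 0%R
  end).

Definition J21 : structures k 5 := of_table (fun i j =>
  match i, j with
  | 1, 2 | 3, 3 => nn 4
  | 3, 4 | 1, 1 | 2, 2 => nn 5
  | _, _ => 0%R
  end).

Definition J22 : structures k 5 := of_table (fun i j =>
  match i, j with
  | 1, 1 => nn 2
  | 1, 2 | 3, 3 => nn 4
  | 2, 2 | 1, 4 => nn 5
  | _, _ => 0%R
  end).

Definition J40 : structures k 5 := of_table (fun i j =>
  match i, j with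
  | 1, 2 => nn 3
  | 2, 2 | 1, 3 => nn 4
  | 1, 1 | 2, 3 => nn 5
  | _, _ => 0%R
  end).

Definition J27 (e f : k) : structures k 5 := of_table (fun i j =>
  match i, j with
  | 1, 1 => nn 3
  | 2, 2 => nn 4
  | 2, 3 | 1, 4 => nn 5
  | 2, 4 => (e *: nn 5)%R
  | 1, 3 => (f *: nn 5)%R
  | _, _ => 0%R
  end).

Definition N27 : set (structures k 5) :=
  \bigcup_(p in [set p : k * k | (p.1 * p.2 != 1)%R]) gl_orbit (J27 p.1 p.2).

End Tables.

Arguments N27 k : clear implicits.

(* Main.v *)
From HB Require Import structures.
Require Import Defs.
From mathcomp Require Import all_boot all_algebra.
From mathcomp Require Import boolp classical_sets functions cardinality topology.
From mathcomp Require Import mpoly ring zify.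

Set Implicit Arguments.
Unset Strict Implicit.
Unset Printing Implicit Defensive.

Import GRing.Theory.

Local Open Scope classical_set_scope.
Local Open Scope ring_scope.

(* Let R_1 = J and R_(m+1) = R_m J. If some power x(x(x(xx))) is not zero, then the powers of
   x form a basis and J is isomorphic to eps1. Otherwise dim R_2 <= 3, and a basis adapted to
   the flag of the R_m puts J into one of four families fam1, ..., fam4, according to the
   dimensions of the R_m; each family is an affine space of structures consisting of
   nilpotent Jordan algebras.

   A covariant, that is, a polynomial function of the structure, of vectors and of
   functionals invariant under GL, defines an open union of orbits. Covariants isolate in
   fam1, fam3 and fam4 the generic algebra, isomorphic to J21, J40 and J22: these orbits are
   open, and their closures contain the whole family, since an open subset of JorN meeting a
   line contained in JorN contains almost all points of this line. In fam2, an algebra in which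
   two independent combinations v, w of n1 and n2 have their product v w in <n5> lies on a
   line whose generic points are in N27, and every other algebra lies on a line whose
   generic points are of this kind.

   Orbits and N27 are irreducible, since any two of their points are joined by a rational
   curve, obtained from the lines g + t (h - g) of matrices. The closures are not included in
   each other, because the covariants vanish on closed sets; those of J27 are the associator
   and a resultant of binary quadratic forms. *)

(** * Polynomial functions and rational curves *)

Section Affine.
Variables (k : fieldType) (I : finType).
Implicit Types (c d : affine k I) (D : {poly k}) (f g : affine k I -> k) (A C : set (affine k I)).

(** Openness of an orbit is obtained without dimension counts: finitely many covariants, each
    nonzero somewhere, must force the normal form. Since a covariant may be evaluated at any vectors
    and functionals, no basis has to be chosen polynomially in the structure, and the witnesses of
    different covariants may be unrelated: on the reduced form of a family, each non-vanishing is a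
    condition on the parameters alone. Factorizations carry the vanishing statements. In [fam2] and
    [fam4] the associator is an alternating form in the outer arguments, times a linear form in the
    middle one, times n5; and binary forms with a common linear factor have zero resultant. For
    [N27], the argument through an open orbit is replaced by a polynomial whose non-vanishing on a
    line puts the point in [N27]. At n1, n2 the covariant [P27] of [J27 e f] takes the value e f (e
    f - 1), whence the base point (1, -1). Division by 2 comes from polarization. Division by 3
    occurs twice: in forcing the shape [fam4] by the Jordan identity, and in removing the last
    parameter of [fam4]. *)

Definition polyfun f : Prop := exists p, forall c, f c = peval p c.

Lemma polyfun_cst (a : k) : polyfun (fun=> a).
Proof. by exists a%:MP => c; rewrite /peval mevalC. Qed.

Lemma polyfun_coord (i : I) : polyfun (fun c => acoord c i).
Proof. by exists 'X_(enum_rank i) => c; rewrite /peval mevalXU enum_rankK. Qed.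

Lemma polyfunD f g : polyfun f -> polyfun g -> polyfun (fun c => f c + g c).
Proof.
by move=> [p fp] [q gq]; exists (p + q) => c; rewrite fp gq /peval mevalD.
Qed.

Lemma polyfunM f g : polyfun f -> polyfun g -> polyfun (fun c => f c * g c).
Proof.
by move=> [p fp] [q gq]; exists (p * q) => c; rewrite fp gq /peval mevalM.
Qed.

Lemma polyfunN f : polyfun f -> polyfun (fun c => - f c).
Proof.
by move=> [p fp]; exists (- p) => c; rewrite fp /peval mevalN.
Qed.

Lemma polyfunB f g : polyfun f -> polyfun g -> polyfun (fun c => f c - g c).
Proof. by move=> fP gP; apply: polyfunD => //; apply: polyfunN. Qed.

Lemma polyfunX f n : polyfun f -> polyfun (fun c => f c ^+ n).
Proof.
by move=> [p fp]; exists (p ^+ n) => c; rewrite fp /peval rmorphXn.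
Qed.

Lemma polyfun_sum (J : finType) (F : J -> affine k I -> k) :
  (forall j, polyfun (F j)) -> polyfun (fun c => \sum_j F j c).
Proof.
move=> /choice[p Fp]; exists (\sum_j p j) => c.
by rewrite /peval rmorph_sum; apply: eq_bigr => j _; rewrite Fp.
Qed.

Lemma closed_zeros J (F : J -> affine k I -> k) :
  (forall j, polyfun (F j)) -> closed [set c | forall j, F j c = 0].
Proof.
move=> /choice[p Fp]; apply/closed_zerosP; exists (range p).
apply/seteqP; split=> c /= H.
  by move=> _ [j _ <-]; rewrite -Fp H.
by move=> j; rewrite Fp H //; exists j.
Qed.

Lemma open_nonzeros J (F : J -> affine k I -> k) :
  (forall j, polyfun (F j)) -> open [set c | exists j, F j c != 0].
Proof.
move=> /closed_zeros /closed_openC; congr open; apply/seteqP; split=> c /=.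
  by move/existsNP=> [j /eqP]; exists j.
by move=> [j /eqP Fj] H; apply: Fj.
Qed.

Lemma closed_polyfun C : closed C ->
  exists2 S : set (affine k I -> k), (forall f, S f -> polyfun f) &
    C = [set c | forall f, S f -> f c = 0].
Proof.
move=> /closed_zerosP[S ->]; exists [set f | exists2 p, S p & f = peval p].
  by move=> f [p _ ->]; exists p.
apply/seteqP; split=> c H; first by move=> f [p Sp ->]; apply: H.
by move=> p Sp; apply: (H (peval p)); exists p.
Qed.

Lemma closed_sep C c : closed C -> ~ C c ->
  exists f, [/\ polyfun f, f c != 0 & forall d, C d -> f d = 0].
Proof.
move=> /closed_polyfun[S SP ->] /existsNP[f] /not_implyP[Sf /eqP fc].
by exists f; split=> // [|d]; [apply: SP|apply].
Qed.

(* A regular function on the complement in the line of the roots of D. *)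
Definition regular (D : {poly k}) (h : k -> k) : Prop :=
  exists p N, forall t, D.[t] != 0 -> h t = p.[t] / D.[t] ^+ N.

Lemma regular_horner D p : regular D (fun t => p.[t]).
Proof. by exists p, 0%N => t _; rewrite divr1. Qed.

Lemma regular_cst D (a : k) : regular D (fun=> a).
Proof. by exists a%:P, 0%N => t _; rewrite divr1 hornerC. Qed.

Lemma regularV D : regular D (fun t => D.[t]^-1).
Proof. by exists 1, 1%N => t _; rewrite hornerC div1r. Qed.

Lemma regularD D h1 h2 :
  regular D h1 -> regular D h2 -> regular D (fun t => h1 t + h2 t).
Proof.
move=> [p [N hp]] [q [M hq]]; exists (p * D ^+ M + q * D ^+ N), (N + M)%N => t dt.
rewrite hp // hq // !hornerE exprD invfM.
have dN : D.[t] ^+ N != 0 by rewrite expf_neq0.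
have dM : D.[t] ^+ M != 0 by rewrite expf_neq0.
by field; rewrite dM dN.
Qed.

Lemma regularM D h1 h2 :
  regular D h1 -> regular D h2 -> regular D (fun t => h1 t * h2 t).
Proof.
move=> [p [N hp]] [q [M hq]]; exists (p * q), (N + M)%N => t dt.
by rewrite hp // hq // hornerM exprD invfM mulrACA.
Qed.

Lemma regular_sum (J : Type) (r : seq J) D (h : J -> k -> k) :
  (forall j, regular D (h j)) -> regular D (fun t => \sum_(j <- r) h j t).
Proof.
move=> hP; elim: r => [|j r IHr].
  by have := @regular_cst D 0; congr regular; apply/funext => t; rewrite big_nil.
have := regularD (hP j) IHr; congr regular; apply/funext => t.
by rewrite big_cons.
Qed.

Lemma regular_prod (J : Type) (r : seq J) D (h : J -> k -> k) :
  (forall j, regular D (h j)) -> regular D (fun t => \prod_(j <- r) h j t).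
Proof.
move=> hP; elim: r => [|j r IHr].
  by have := @regular_cst D 1; congr regular; apply/funext => t; rewrite big_nil.
have := regularM (hP j) IHr; congr regular; apply/funext => t.
by rewrite big_cons.
Qed.

Lemma regular_polyfun f D (gam : k -> affine k I) :
  polyfun f -> (forall i, regular D (fun t => acoord (gam t) i)) ->
  regular D (fun t => f (gam t)).
Proof.
move=> [p fp] gamP.
(* Powers of coordinates become products over [iota], so that closure under sums and products
   handles every monomial. *)
have -> : (fun t => f (gam t)) = fun t => \sum_(m <- msupp p) p@_m *
    \prod_(j <- index_enum 'I_#|I|)
      \prod_(l <- iota 0 (m j)) acoord (gam t) (enum_val j).
  apply/funext => t; rewrite fp /peval mevalE; apply: eq_bigr => m _.
  congr (_ * _); apply: eq_bigr => j _.
  by rewrite big_const_seq count_predT size_iota -Monoid.iteropE.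
apply: regular_sum => m; apply: regularM; first exact: regular_cst.
by apply: regular_prod => j; apply: regular_prod => l; apply: gamP.
Qed.

Definition segment (a b : affine k I) (t : k) : affine k I :=
  [ffun i => acoord a i + t * (acoord b i - acoord a i)].

Lemma segment0 (a b : affine k I) : segment a b 0 = a.
Proof. by apply/ffunP => i; rewrite ffunE mul0r addr0. Qed.

Lemma segment1 (a b : affine k I) : segment a b 1 = b.
Proof. by apply/ffunP => i; rewrite ffunE mul1r addrC subrK. Qed.

Lemma regular_segment D (a b : affine k I) i : regular D (fun t => acoord (segment a b t) i).
Proof.
have := @regular_horner D ((acoord a i)%:P + 'X * (acoord b i - acoord a i)%:P).
congr regular; apply/funext => t.
by rewrite /acoord ffunE !hornerE.
Qed.

End Affine.

Section Curves.
Variables (k : closedFieldType) (I : finType).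
Implicit Types (a b c d : affine k I) (D p : {poly k}) (A B C : set (affine k I)).

(** A root of [p - 1] is a point where [p] takes the value 1. *)
Lemma poly_nonroot p : p != 0 -> exists t, p.[t] != 0.
Proof.
move=> p0; have [sz|sz] := leqP (size p) 1.
  move: p0; rewrite (size1_polyC sz) polyC_eq0 => p0.
  by exists 0; rewrite hornerC.
have: size (p - 1) != 1.
  by rewrite size_polyDl ?size_polyN ?size_poly1 // neq_ltn sz orbT.
move=> /closed_rootP[t]; rewrite rootE !hornerE subr_eq0 => /eqP pt.
by exists t; rewrite pt oner_neq0.
Qed.

Lemma regular_neq0 D (h : k -> k) (t0 : k) :
    regular D h -> D.[t0] != 0 -> h t0 != 0 ->
  exists2 p, p != 0 & forall t, D.[t] != 0 -> p.[t] != 0 -> h t != 0.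
Proof.
move=> [p [N hp]] Dt0 ht0; exists p => [|t Dt pt].
  by apply: contraNneq ht0 => p0; rewrite hp // p0 horner0 mul0r.
by rewrite hp // mulf_neq0 // invr_neq0 // expf_neq0.
Qed.

(** The curve is constrained only off the roots of [D]; its values at these roots are arbitrary. *)
Definition joined A a b : Prop :=
  exists D (gam : k -> affine k I),
    [/\ D.[0] != 0 /\ D.[1] != 0,
        forall i, regular D (fun t => acoord (gam t) i),
        gam 0 = a, gam 1 = b & forall t, D.[t] != 0 -> A (gam t)].

(** Polynomials separating [a] from [C1] and [b] from [C2] pull back along the curve to nonzero
    rational functions of one variable. At a common non-root the curve is in [A] but in neither
    closed set. *)
Lemma irreducible_joined A :
  A !=set0 -> (forall a b, A a -> A b -> joined A a b) -> irreducible A.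
Proof.
move=> A0 AP; split=> // C1 C2 cC1 cC2 AC.
apply: contrapT => /not_orP[/existsNP[a /not_implyP[Aa C1a]]].
move=> /existsNP[b /not_implyP[Ab C2b]].
have [f [fP fa fC]] := closed_sep cC1 C1a.
have [g [gP gb gC]] := closed_sep cC2 C2b.
have [D [gam [[D0 D1] gamP g0 g1 gA]]] := AP _ _ Aa Ab.
rewrite -g0 in fa; rewrite -g1 in gb.
have [p p0 pP] := regular_neq0 (regular_polyfun fP gamP) D0 fa.
have [q q0 qP] := regular_neq0 (regular_polyfun gP gamP) D1 gb.
have Dn0 : D != 0 by apply: contraNneq D0 => ->; rewrite horner0.
have [|t] := @poly_nonroot (D * p * q); first by rewrite !mulf_neq0.
rewrite !hornerM !mulf_eq0 !negb_or => /andP[/andP[Dt pt] qt].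
have [/fC|/gC] := AC _ (gA t Dt); apply/eqP; [exact: pP|exact: qP].
Qed.

(** A polynomial vanishing on [A] but not at [a] would be nonzero, together with [F], at some point
    of the line; but this point is in [A]. *)
Lemma closure_segment A a b F :
    polyfun F -> F b != 0 ->
    (forall t, F (segment a b t) != 0 -> A (segment a b t)) ->
  closure A a.
Proof.
move=> FP Fb FA; apply: contrapT => Aa.
have [f [fP fa fA]] := closed_sep (@closed_closure _ A) Aa.
rewrite -(segment0 a b) in fa; rewrite -(segment1 a b) in Fb.
have rP i : regular 1 (fun t => acoord (segment a b t) i).
  exact: regular_segment.
have n1 t : (1 : {poly k}).[t] != 0 by rewrite hornerC oner_neq0.
have [p p0 pP] := regular_neq0 (regular_polyfun FP rP) (n1 1) Fb.
have [q q0 qP] := regular_neq0 (regular_polyfun fP rP) (n1 0) fa.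
have [|t] := @poly_nonroot (p * q); first by rewrite mulf_neq0.
rewrite hornerM mulf_eq0 negb_or => /andP[pt qt].
have /negP := qP t (n1 t) qt; apply; apply/eqP/fA/subset_closure/FA.
exact: pP (n1 t) pt.
Qed.

(** The polynomial required by [closure_segment] is one that separates [b] from the complement of
    the open set. *)
Lemma closure_segment_open X A a b :
    open_in X A -> A b -> (forall t, X (segment a b t)) ->
  closure A a.
Proof.
move=> [U oU AU] Ab Xs.
have cU : closed (~` U) by rewrite closedC.
have Ub : ~ (~` U) b by move: Ab; rewrite AU => -[_ Ub] /(_ Ub).
have [f [fP fb fU]] := closed_sep cU Ub.
apply: (closure_segment fP fb) => t ft; rewrite AU; split=> //.
by apply: contrapT => /fU /eqP; rewrite (negPf ft).
Qed.

End Curves.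

(** * Irreducible sets and irreducible components *)

Section Topology.
Variable T : topologicalType.
Implicit Types A B C X : set T.

Lemma closure_sub A C : closed C -> A `<=` C -> closure A `<=` C.
Proof. by move=> cC AC x /(closure_subset AC); rewrite -(closure_id C).1. Qed.

Lemma irreducible_closure A : irreducible A -> irreducible (closure A).
Proof.
move=> [[a Aa] AP]; split=> [|C D cC cD AC].
  by exists a; apply: subset_closure.
have [||] := AP C D cC cD.
- by apply: subset_trans AC; apply: subset_closure.
- by left; apply: closure_sub.
- by right; apply: closure_sub.
Qed.

(** A relatively clopen subset and its complement give a cover of [A] by two closed sets. *)
Lemma irreducible_connected A : irreducible A -> connected A.
Proof.
move=> [_ AP] B [b Bb] [U oU BU] [C cC BC].
have AUC : A `<=` ~` U `|` C.
  move=> a Aa; have [Ua|Ua] := pselect (U a); last by left.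
  by right; have : B a; [rewrite BU|rewrite BC => -[]].
have cU : closed (~` U) by rewrite closedC.
have [AU|AC] := AP _ _ cU cC AUC; apply/seteqP.
  by move: Bb; rewrite BU => -[/AU].
by split=> a; [rewrite BU => -[]|rewrite BC => Aa; split=> //; apply: AC].
Qed.

(** An irreducible subset of a finite union of closed sets lies in one of them, by induction on the
    list; the absence of inclusions between the members then gives their maximality. *)
Lemma irreducible_componentsE X (s : seq (set T)) :
    (forall C, C \in s -> closed C /\ irreducible C) ->
    X = \bigcup_(C in [set C | C \in s]) C ->
    (forall C D, C \in s -> D \in s -> C `<=` D -> C = D) ->
  irreducible_components X = [set C | C \in s].
Proof.
move=> sP XE sI.
have cover D : D `<=` X -> irreducible D -> exists2 C, C \in s & D `<=` C.
  rewrite XE => DX [[x Dx] Dirr].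
  have: D `<=` \bigcup_(C in [set C | C \in s]) C by [].
  have : forall C, C \in s -> closed C by move=> C /sP[].
  elim: (s) => [|C r IHr] rP Dr; first by have [] := Dr _ Dx.
  have cr : closed (\bigcup_(C in [set C | C \in r]) C).
    elim: (r) rP => [_|E u IHu uP].
      rewrite (_ : \bigcup_(_ in _) _ = set0); first exact: closed0.
      by apply/seteqP; split=> y // [].
    rewrite (_ : \bigcup_(_ in _) _ =
        E `|` \bigcup_(C in [set C | C \in u]) C); last first.
      apply/seteqP; split=> y.
        move=> [F] /=; rewrite inE => /predU1P[->|Fu] Fy; first by left.
        by right; exists F.
      move=> [Ey|[F /= Fu Fy]]; [exists E|exists F] => //=.
        by rewrite inE eqxx.
      by rewrite inE Fu orbT.
    apply: closedU; first by apply: uP; rewrite !inE eqxx orbT.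
    by apply: IHu => F; rewrite inE => /predU1P[->|Fu]; apply: uP;
      rewrite !inE ?eqxx ?Fu ?orbT.
  have [||DC|Dr'] := Dirr C (\bigcup_(C in [set C | C \in r]) C) _ cr.
  - by apply: rP; rewrite inE eqxx.
  - move=> y /Dr[F] /=; rewrite inE => /predU1P[->|Fr] Fy; first by left.
    by right; exists F.
  - by exists C; rewrite ?inE ?eqxx.
  - have [|E Er DE] := IHr _ Dr'.
      by move=> E Er; apply: rP; rewrite inE Er orbT.
    by exists E; rewrite ?inE ?Er ?orbT.
apply/seteqP; split=> C /=.
  move=> [CX Cirr Cmax]; have [D Ds CD] := cover C CX Cirr.
  rewrite -(Cmax D) //; last by have [] := sP D Ds.
  by rewrite XE => x Dx; exists D.
move=> Cs; split; first by rewrite XE => x Cx; exists C.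
  by have [] := sP C Cs.
move=> D DX Dirr CD; have [E Es DE] := cover D DX Dirr.
apply/seteqP; split=> //; rewrite (sI C E) //.
exact: subset_trans CD DE.
Qed.

End Topology.

(** * Structures of algebras *)

Section Algebra.
Variables (k : fieldType) (n : nat).
Implicit Types (c d : structures k n) (x y z u v : 'cV[k]_n) (a : k) (g : 'M[k]_n).
Implicit Types (U V W : {vspace 'cV[k]_n}).

Lemma amulDl c x y z : amul c (x + y) z = amul c x z + amul c y z.
Proof.
apply/colP => l; rewrite !mxE -big_split; apply: eq_bigr => i _ /=.
by rewrite -big_split; apply: eq_bigr => j _ /=; rewrite mxE !mulrDl.
Qed.

Lemma amulDr c x y z : amul c x (y + z) = amul c x y + amul c x z.
Proof.
apply/colP => l; rewrite !mxE -big_split; apply: eq_bigr => i _ /=.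
rewrite -big_split; apply: eq_bigr => j _ /=.
by rewrite mxE mulrDr mulrDl.
Qed.

Lemma amulZl c a x y : amul c (a *: x) y = a *: amul c x y.
Proof.
apply/colP => l; rewrite !mxE mulr_sumr; apply: eq_bigr => i _ /=.
by rewrite mulr_sumr; apply: eq_bigr => j _ /=; rewrite mxE !mulrA.
Qed.

Lemma amulZr c a x y : amul c x (a *: y) = a *: amul c x y.
Proof.
apply/colP => l; rewrite !mxE mulr_sumr; apply: eq_bigr => i _ /=.
rewrite mulr_sumr; apply: eq_bigr => j _ /=.
by rewrite mxE !mulrA [a * _]mulrC.
Qed.

Lemma amul0l c x : amul c 0 x = 0.
Proof. by rewrite -[X in amul c X](scale0r 0) amulZl scale0r. Qed.

Lemma amul0r c x : amul c x 0 = 0.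
Proof. by rewrite -[X in amul c x X](scale0r 0) amulZr scale0r. Qed.

Lemma amulNl c x y : amul c (- x) y = - amul c x y.
Proof. by rewrite -scaleN1r amulZl scaleN1r. Qed.

Lemma amulNr c x y : amul c x (- y) = - amul c x y.
Proof. by rewrite -scaleN1r amulZr scaleN1r. Qed.

Lemma amul_suml c (J : Type) (r : seq J) (F : J -> 'cV[k]_n) y :
  amul c (\sum_(j <- r) F j) y = \sum_(j <- r) amul c (F j) y.
Proof.
exact: (big_morph (amul c ^~ y) (fun x z => amulDl c x z y) (amul0l c y)).
Qed.

Lemma amul_sumr c (J : Type) (r : seq J) (F : J -> 'cV[k]_n) y :
  amul c y (\sum_(j <- r) F j) = \sum_(j <- r) amul c y (F j).
Proof. exact: (big_morph (amul c y) (amulDr c y) (amul0r c y)). Qed.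

Lemma amul_delta c (i j l : 'I_n) :
  amul c (delta_mx i 0) (delta_mx j 0) l 0 = acoord c (i, j, l).
Proof.
rewrite mxE (bigD1 i) //= (bigD1 j) //= !mxE !eqxx !mul1r.
rewrite big1 => [|j' nj]; last by rewrite !mxE (negPf nj) mulr0 mul0r.
rewrite big1 => [|i' ni]; first by rewrite !addr0.
by rewrite big1 // => j' _; rewrite !mxE (negPf ni) !mul0r.
Qed.

Lemma amul_act g c x y : g \in unitmx ->
  amul (gl_act g c) x y = g *m amul c (invmx g *m x) (invmx g *m y).
Proof.
move=> ug.
have E z : invmx g *m z = \sum_i z i 0 *: (invmx g *m delta_mx i 0).
  rewrite {1}[z]matrix_sum_delta mulmx_sumr; apply: eq_bigr => i _.
  by rewrite big_ord1 -scalemxAr.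
rewrite (E x) (E y) amul_suml mulmx_sumr; apply/colP => l.
rewrite mxE summxE; apply: eq_bigr => i _; rewrite amul_sumr mulmx_sumr summxE.
apply: eq_bigr => j _; rewrite amulZl amulZr -!scalemxAr !mxE /acoord ffunE.
by rewrite -mulrA !mxE.
Qed.

Lemma amul_inj c d : (forall x y, amul c x y = amul d x y) -> c = d.
Proof.
move=> cd; apply/ffunP => -[[i j] l].
by have := amul_delta c i j l; rewrite cd amul_delta => /esym.
Qed.

Lemma gl_act1 c : gl_act 1%:M c = c.
Proof.
by apply: amul_inj => x y; rewrite amul_act ?unitmx1 // invmx1 !mul1mx.
Qed.

Lemma gl_actM g h c : g \in unitmx -> h \in unitmx ->
  gl_act g (gl_act h c) = gl_act (g *m h) c.
Proof.
move=> ug uh; have ugh : g *m h \in unitmx by rewrite unitmx_mul ug.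
have E : invmx (g *m h) = invmx h *m invmx g.
  apply: (can_inj (mulKmx ugh)); rewrite mulmxV // mulmxA -(mulmxA g).
  by rewrite mulmxV // mulmx1 mulmxV.
by apply: amul_inj => x y; rewrite !amul_act // E !mulmxA.
Qed.

Lemma orbit_refl c : gl_orbit c c.
Proof. by exists 1%:M; rewrite ?unitmx1 ?gl_act1. Qed.

Lemma orbit_trans c d e : gl_orbit c d -> gl_orbit d e -> gl_orbit c e.
Proof.
move=> [g ug ->] [h uh ->]; exists (h *m g); first by rewrite unitmx_mul uh.
by rewrite gl_actM.
Qed.

Lemma orbit_sym c d : gl_orbit c d -> gl_orbit d c.
Proof.
move=> [g ug ->]; exists (invmx g); first by rewrite unitmx_inv.
by rewrite gl_actM ?unitmx_inv // mulVmx // gl_act1.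
Qed.

Lemma orbit_eq c d : gl_orbit c d -> gl_orbit c = gl_orbit d.
Proof.
move=> cd; apply/seteqP; split=> e; first exact/orbit_trans/orbit_sym.
exact: orbit_trans.
Qed.

Lemma orbit_basis c d g : g \in unitmx ->
    (forall i j, amul c (col i g) (col j g) =
                 g *m amul d (delta_mx i 0) (delta_mx j 0)) ->
  gl_orbit d c.
Proof.
move=> ug H; exists g => //; apply: amul_inj => x y; rewrite amul_act //.
rewrite -{1}(mulKVmx ug x) -{1}(mulKVmx ug y).
move: (invmx g *m x) (invmx g *m y) => {}x {}y.
rewrite [x]matrix_sum_delta [y]matrix_sum_delta !mulmx_sumr !amul_suml mulmx_sumr.
apply: eq_bigr => i _; rewrite !big_ord1 -scalemxAr !amulZl -!scalemxAr.
congr (_ *: _); rewrite !amul_sumr mulmx_sumr; apply: eq_bigr => j _.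
by rewrite big_ord1 -scalemxAr !amulZr -scalemxAr -!colE H.
Qed.

Definition line c d (t : k) : structures k n :=
  @segment k ('I_n * 'I_n * 'I_n)%type c d t.

(** The action is linear in the structure. A line found at one representative can thus be moved to
    any point of the orbit. *)
Lemma line_act g c d t :
  g \in unitmx -> line (gl_act g c) (gl_act g d) t = gl_act g (line c d t).
Proof.
move=> ug; have S c' d' x y :
    amul (line c' d' t) x y = amul c' x y + t *: (amul d' x y - amul c' x y).
  apply/colP => l; rewrite !mxE -sumrB mulr_sumr -big_split; apply: eq_bigr.
  move=> i _ /=; rewrite -sumrB mulr_sumr -big_split; apply: eq_bigr => j _ /=.
  by rewrite /acoord ffunE /acoord; ring.
apply: amul_inj => x y.
by rewrite S !amul_act // S mulmxDr -scalemxAr mulmxBr.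
Qed.

Definition commutative_structure c := forall x y, amul c x y = amul c y x.

Lemma jordan_act g c : g \in unitmx -> jordan c -> jordan (gl_act g c).
Proof.
move=> ug [cC cJ]; split=> x y; rewrite !amul_act // ?mulKmx //.
  by rewrite cC.
by rewrite cJ.
Qed.

Definition polyvec (F : structures k n -> 'cV[k]_n) : Prop :=
  forall l, polyfun (fun c => F c l 0).

Lemma polyvec_cst x : polyvec (fun=> x).
Proof. by move=> l; apply: polyfun_cst. Qed.

Lemma polyvecD F G : polyvec F -> polyvec G -> polyvec (fun c => F c + G c).
Proof.
move=> FP GP l; have := polyfunD (FP l) (GP l); congr polyfun.
by apply/funext => c; rewrite mxE.
Qed.

Lemma polyvecN F : polyvec F -> polyvec (fun c => - F c).
Proof.
move=> FP l; have := polyfunN (FP l); congr polyfun.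
by apply/funext => c; rewrite mxE.
Qed.

Lemma polyvecB F G : polyvec F -> polyvec G -> polyvec (fun c => F c - G c).
Proof. by move=> FP GP; apply: polyvecD => //; apply: polyvecN. Qed.

Lemma polyvecZ f F : polyfun f -> polyvec F -> polyvec (fun c => f c *: F c).
Proof.
move=> fP FP l; have := polyfunM fP (FP l); congr polyfun.
by apply/funext => c; rewrite mxE.
Qed.

Lemma polyvec_amul F G : polyvec F -> polyvec G ->
  polyvec (fun c => amul c (F c) (G c)).
Proof.
move=> FP GP l; rewrite (_ : (fun _ => _) = fun c =>
  \sum_i \sum_j F c i 0 * G c j 0 * acoord c (i, j, l)); last first.
  by apply/funext => c; rewrite mxE.
apply: polyfun_sum => i; apply: polyfun_sum => j; apply: polyfunM.
  exact: polyfunM.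
exact: polyfun_coord.
Qed.

(* The right power R_(m+1), where R_1 = J and R_(m+1) = R_m J. In the commutative case
   J^(2^m) <= R_(m+1) <= J^(m+1), and the descending chain of the R_i suffices to test
   nilpotency and to build adapted bases. *)
Fixpoint rpower c (m : nat) : {vspace 'cV[k]_n} :=
  if m is m'.+1 then vmul c (rpower c m') fullv else fullv.

Lemma mem_vmul c U V x y : x \in U -> y \in V -> amul c x y \in vmul c U V.
Proof.
move=> xU yV; rewrite (coord_vbasis xU) (coord_vbasis yV) amul_suml.
apply: memv_suml => i _; rewrite amul_sumr; apply: memv_suml => j _.
rewrite amulZl amulZr; do 2!apply: memvZ.
by apply: memv_span; apply: allpairs_f; apply: mem_nth; rewrite size_tuple.
Qed.

Lemma vmul_sub c U V W :
  (forall x y, x \in U -> y \in V -> amul c x y \in W) -> (vmul c U V <= W)%VS.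
Proof.
move=> H; apply/span_subvP => _ /allpairsP[[x y] [xU yV ->]].
by apply: H; apply: vbasis_mem.
Qed.

Lemma vmulS c U U' V V' :
  (U <= U')%VS -> (V <= V')%VS -> (vmul c U V <= vmul c U' V')%VS.
Proof.
move=> sU sV; apply: vmul_sub => x y xU yV.
by apply: mem_vmul; [apply: (subvP sU)|apply: (subvP sV)].
Qed.

Lemma rpower_sub c m : (rpower c m.+1 <= rpower c m)%VS.
Proof.
elim: m => [|m IHm]; first exact: subvf.
by rewrite /= vmulS // subvv.
Qed.

Lemma rpower_anti c m p : (m <= p)%N -> (rpower c p <= rpower c m)%VS.
Proof.
move=> /subnK <-; elim: (p - m)%N => [|q IHq]; first exact: subvv.
by rewrite addSn; apply: subv_trans IHq; apply: rpower_sub.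
Qed.

Lemma mem_rpower c m x y : x \in rpower c m -> amul c x y \in rpower c m.+1.
Proof. by move=> xR; apply: mem_vmul (memvf _). Qed.

Lemma rpower_power c m : (rpower c m <= power c m.+1)%VS.
Proof.
elim: m => [|m IHm]; first by rewrite power1 subvv.
rewrite powerE // big_ltn //= subSS subn0 power1.
by apply: subv_trans (addvSl _ _); apply: vmulS (subvv _).
Qed.

(** In a product of J^(p-i) and J^i with p >= 2^(m+1), one of the two exponents is at least 2^m;
    commutativity puts that factor on the left. *)
Lemma power_rpower c m p : commutative_structure c ->
  (2 ^ m <= p)%N -> (power c p <= rpower c m)%VS.
Proof.
move=> cC; elim: m p => [|m IHm] p le_p; first exact: subvf.
have p1 : (1 < p)%N.
  apply: leq_trans le_p; rewrite expnS mul2n -addnn.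
  by case: (2 ^ m)%N (expn_gt0 2 m) => // q _; rewrite addnS ltnS addSn.
rewrite powerE // big_seq.
apply: (big_ind (fun U => U <= rpower c m.+1)%VS) => [|U V sU sV|i].
- exact: sub0v.
- by rewrite subv_add sU.
rewrite mem_index_iota => /andP[i0 ip]; apply: vmul_sub => x y xP yP.
have [le_i|lt_i] := leqP (2 ^ m) i.
  by rewrite cC; apply: mem_rpower; apply: subvP yP; apply: IHm.
apply: mem_rpower; apply: subvP xP; apply: IHm.
rewrite leq_subRL ?(ltnW ip) //; apply: leq_trans le_p.
by rewrite expnS mul2n -addnn leq_add2r ltnW.
Qed.

Lemma rpower_stable c m p :
  rpower c m.+1 = rpower c m -> rpower c (m + p) = rpower c m.
Proof. by move=> E; elim: p => [|p IHp]; rewrite ?addn0 // addnS /= IHp. Qed.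

(** Without a drop of dimension the chain is constant from [m] on, whereas nilpotency makes it end
    at zero. *)
Lemma rpower_lt_dim c m : nilpotent c -> rpower c m != 0%VS ->
  (\dim (rpower c m.+1) < \dim (rpower c m))%N.
Proof.
move=> [p p0 cp]; apply: contraNltn => le_d.
have E : rpower c m.+1 = rpower c m.
  by apply/eqP; rewrite eqEdim rpower_sub le_d.
have : (rpower c p <= rpower c p.-1)%VS by rewrite -{1}(prednK p0) rpower_sub.
have := rpower_power c p.-1; rewrite prednK // cp subv0 => /eqP-> .
rewrite subv0 => /eqP Rp; have := rpower_stable p E.
have : (rpower c (m + p) <= rpower c p)%VS by apply: rpower_anti; rewrite leq_addl.
by rewrite Rp subv0 => /eqP-> <-.
Qed.

Lemma nilpotent_dim c m : nilpotent c -> (\dim (rpower c m) <= n - m)%N.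
Proof.
move=> cN; elim: m => [|m IHm].
  by rewrite subn0 (leq_trans (dimvS (subvf _))) // dimvf /dim /= muln1.
have [R0|R0] := eqVneq (rpower c m) 0%VS.
  have := rpower_sub c m; rewrite R0 subv0 => /eqP->.
  by rewrite dimv0.
rewrite subnS -ltnS; apply: leq_trans (leqSpred _).
by apply: leq_trans IHm; apply: rpower_lt_dim.
Qed.

(** The dimensions decrease strictly from [n], so a fixed exponent replaces the existential one.
    This is what makes nilpotency a closed condition. *)
Lemma nilpotentP c : commutative_structure c ->
  nilpotent c <-> rpower c n = 0%VS.
Proof.
move=> cC; split=> [cN|Rn].
  apply/eqP; rewrite -dimv_eq0 -leqn0.
  by apply: leq_trans (nilpotent_dim n cN) _; rewrite subnn.
exists (2 ^ n)%N; first by rewrite expn_gt0.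
by apply/eqP; rewrite -subv0 -Rn power_rpower.
Qed.

(** The vanishing of a span becomes the vanishing of all left-nested products, which are polynomial
    in the structure. *)
Lemma rpower_eq0 c m :
  rpower c m = 0%VS <-> forall x (s : m.-tuple 'cV[k]_n), foldl (amul c) x s = 0.
Proof.
have mem x s : foldl (amul c) x s \in rpower c (size s).
  elim/last_ind: s => [|s y IHs]; first exact: memvf.
  by rewrite -cats1 foldl_cat size_cat addn1 mem_rpower.
split=> [R0 x s|H].
  by have := mem x s; rewrite size_tuple R0 memv0 => /eqP.
suff gen W p : (forall x (s : p.-tuple 'cV[k]_n), foldl (amul c) x s \in W) ->
    (rpower c p <= W)%VS.
  apply/eqP; rewrite -subv0; apply: gen => x s.
  by rewrite H mem0v.
elim: p W => [|p IHp] W HW.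
  by apply/subvP => x _; apply: (HW x [tuple]).
apply: vmul_sub => x y xR _.
pose f (z : 'cV[k]_n) := amul c z y.
have lf : linear f by move=> a u v; rewrite /f amulDl amulZl.
pose fl := GRing.isLinear.Build _ _ _ _ f lf.
pose fL : {linear 'cV[k]_n -> 'cV[k]_n} := HB.pack f fl.
have /subvP/(_ _ xR) : (rpower c p <= (linfun fL) @^-1: W)%VS.
  apply: IHp => u s; rewrite -memv_preim lfunE /=.
  by have := HW u (rcons_tuple s y); rewrite /= -cats1 foldl_cat.
by rewrite -memv_preim lfunE.
Qed.

Lemma closed_JorN : closed (JorN k n).
Proof.
have -> : JorN k n = [set c | jordan c] `&`
   [set c | forall p : 'cV[k]_n * n.-tuple 'cV[k]_n * 'I_n,
      foldl (amul c) p.1.1 p.1.2 p.2 0 = 0].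
  apply/seteqP; split=> c /= -[cJ cN]; split=> //.
    by move=> [[x s] l] /=; move: cN => /(nilpotentP cJ.1)/rpower_eq0->; rewrite mxE.
  apply/(nilpotentP cJ.1)/rpower_eq0 => x s; apply/colP => l.
  by rewrite (cN (x, s, l)) mxE.
apply: closedI; last first.
  apply: closed_zeros => -[[x s] l] /=.
  suff: forall t : seq 'cV[k]_n, polyvec (fun c => foldl (amul c) x t) by apply.
  elim/last_ind => [|t y IHt]; first exact: polyvec_cst.
  have := polyvec_amul IHt (polyvec_cst y); congr polyvec; apply/funext => c.
  by rewrite -cats1 foldl_cat.
have -> : [set c | jordan c] =
    [set c | forall p : 'cV[k]_n * 'cV[k]_n * 'I_n,
       (amul c p.1.1 p.1.2 - amul c p.1.2 p.1.1) p.2 0 = 0] `&`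
    [set c | forall p : 'cV[k]_n * 'cV[k]_n * 'I_n,
      (amul c (amul c (amul c p.1.1 p.1.1) p.1.2) p.1.1 -
       amul c (amul c p.1.1 p.1.1) (amul c p.1.2 p.1.1)) p.2 0 = 0].
  apply/seteqP; split=> c /= -[cC cJ]; split.
  - by move=> [[x y] l] /=; rewrite cC subrr mxE.
  - by move=> [[x y] l] /=; rewrite cJ subrr mxE.
  - by move=> x y; apply/eqP; rewrite -subr_eq0; apply/eqP/colP => l;
      rewrite (cC (x, y, l)) mxE.
  by move=> x y; apply/eqP; rewrite -subr_eq0; apply/eqP/colP => l;
    rewrite (cJ (x, y, l)) mxE.
have cst (x : 'cV[k]_n) := polyvec_cst x.
by apply: closedI; apply: closed_zeros => -[[x y] l];
  apply: polyvecB; repeat apply: polyvec_amul.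
Qed.

Lemma rpower_act g c m : g \in unitmx -> rpower c m = 0%VS ->
  rpower (gl_act g c) m = 0%VS.
Proof.
move=> ug /rpower_eq0 R0; apply/rpower_eq0 => x s.
suff -> : foldl (amul (gl_act g c)) x s =
    g *m foldl (amul c) (invmx g *m x) (map_tuple (mulmx (invmx g)) s).
  by rewrite R0 mulmx0.
case: s => s /= _; elim: s x => [|y s IHs] x /=; first by rewrite mulKVmx.
by rewrite IHs amul_act // mulKmx.
Qed.

Lemma JorN_act g c : g \in unitmx -> JorN k n c -> JorN k n (gl_act g c).
Proof.
move=> ug [cJ cN]; have cJ' := jordan_act ug cJ; split=> //.
by apply/(nilpotentP cJ'.1); apply: rpower_act => //; apply/(nilpotentP cJ.1).
Qed.

Lemma JorN_orbit c d : gl_orbit c d -> JorN k n c -> JorN k n d.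
Proof. by move=> [g ug ->]; apply: JorN_act. Qed.

End Algebra.

(** * Multiplication tables in dimension five *)

Section Tables.
Variable k : fieldType.
Implicit Types (c d : structures k 5) (v w x y z : 'cV[k]_5).
Implicit Types (f : nat -> nat -> 'cV[k]_5).

Definition vec (a1 a2 a3 a4 a5 : k) : 'cV[k]_5 :=
  \col_i nth 0 [:: a1; a2; a3; a4; a5] i.

Lemma vecP x : exists a1 a2 a3 a4 a5, x = vec a1 a2 a3 a4 a5.
Proof.
exists (x (inord 0) 0), (x (inord 1) 0), (x (inord 2) 0), (x (inord 3) 0).
exists (x (inord 4) 0); apply/colP => i; rewrite mxE.
by case: i => [[|[|[|[|[|//]]]]] i5] /=; congr (x _ 0);
  apply/val_inj; rewrite /= inordK.
Qed.

End Tables.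

Ltac vecs := repeat match goal with
  | x : matrix _ _ _ |- _ =>
    let a := fresh x in let b := fresh x in let c := fresh x in
    let d := fresh x in let e := fresh x in
    have [a [b [c [d [e ?]]]]] := vecP x; subst x
  end.

Section Tables.
Variable k : fieldType.
Implicit Types (c d : structures k 5) (v w x y z : 'cV[k]_5).
Implicit Types (f : nat -> nat -> 'cV[k]_5).

Lemma vec_inj (a1 a2 a3 a4 a5 b1 b2 b3 b4 b5 : k) :
    vec a1 a2 a3 a4 a5 = vec b1 b2 b3 b4 b5 ->
  [/\ a1 = b1, a2 = b2, a3 = b3, a4 = b4 & a5 = b5].
Proof.
move=> /colP E; move: (E (inord 0)) (E (inord 1)) (E (inord 2)) (E (inord 3)).
by move: (E (inord 4)); rewrite !mxE !inordK.
Qed.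

Lemma vecD (a1 a2 a3 a4 a5 b1 b2 b3 b4 b5 : k) :
  vec a1 a2 a3 a4 a5 + vec b1 b2 b3 b4 b5 =
  vec (a1 + b1) (a2 + b2) (a3 + b3) (a4 + b4) (a5 + b5).
Proof.
by apply/colP => i; rewrite !mxE; case: i => [[|[|[|[|[|//]]]]] i5] /=.
Qed.

Lemma vecN (a1 a2 a3 a4 a5 : k) :
  - vec a1 a2 a3 a4 a5 = vec (- a1) (- a2) (- a3) (- a4) (- a5).
Proof.
by apply/colP => i; rewrite !mxE; case: i => [[|[|[|[|[|//]]]]] i5] /=.
Qed.

Lemma vecZ (b a1 a2 a3 a4 a5 : k) :
  b *: vec a1 a2 a3 a4 a5 = vec (b * a1) (b * a2) (b * a3) (b * a4) (b * a5).
Proof.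
by apply/colP => i; rewrite !mxE; case: i => [[|[|[|[|[|//]]]]] i5] /=.
Qed.

Lemma vec0 : vec 0 0 0 0 0 = 0 :> 'cV[k]_5.
Proof.
by apply/colP => i; rewrite !mxE; case: i => [[|[|[|[|[|//]]]]] i5] /=.
Qed.

Lemma vec_eq0 (a1 a2 a3 a4 a5 : k) :
  vec a1 a2 a3 a4 a5 = 0 -> [/\ a1 = 0, a2 = 0, a3 = 0, a4 = 0 & a5 = 0].
Proof. by rewrite -vec0 => /vec_inj. Qed.

Lemma nnE : (nn k 1 = vec 1 0 0 0 0) * (nn k 2 = vec 0 1 0 0 0) *
  (nn k 3 = vec 0 0 1 0 0) * (nn k 4 = vec 0 0 0 1 0) * (nn k 5 = vec 0 0 0 0 1).
Proof.
by do !split; apply/colP => i; rewrite !mxE;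
  case: i => [[|[|[|[|[|//]]]]] i5] /=.
Qed.

Definition vecE := (vecD, vecN, vecZ).

Lemma amul_table f (x1 x2 x3 x4 x5 y1 y2 y3 y4 y5 : k) :
  amul (of_table f) (vec x1 x2 x3 x4 x5) (vec y1 y2 y3 y4 y5) =
    (x1 * y1) *: f 1 1 + (x1 * y2 + x2 * y1) *: f 1 2 +
    (x1 * y3 + x3 * y1) *: f 1 3 + (x1 * y4 + x4 * y1) *: f 1 4 +
    (x1 * y5 + x5 * y1) *: f 1 5 + (x2 * y2) *: f 2 2 +
    (x2 * y3 + x3 * y2) *: f 2 3 + (x2 * y4 + x4 * y2) *: f 2 4 +
    (x2 * y5 + x5 * y2) *: f 2 5 + (x3 * y3) *: f 3 3 +
    (x3 * y4 + x4 * y3) *: f 3 4 + (x3 * y5 + x5 * y3) *: f 3 5 +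
    (x4 * y4) *: f 4 4 + (x4 * y5 + x5 * y4) *: f 4 5 + (x5 * y5) *: f 5 5.
Proof.
apply/colP => l; rewrite !mxE !big_ord_recl !big_ord0 /acoord /of_table !ffunE.
rewrite !mxE /= /bump /minn /maxn /=.
ring.
Qed.

Lemma table_comm f : commutative_structure (of_table f).
Proof.
move=> x y; have [x1 [x2 [x3 [x4 [x5 ->]]]]] := vecP x.
have [y1 [y2 [y3 [y4 [y5 ->]]]]] := vecP y.
rewrite !amul_table; do ![congr (_ + _)]; congr (_ *: _); ring.
Qed.

Lemma table_ext f1 f2 :
    (forall i j, (0 < i)%N -> (i <= j)%N -> (j <= 5)%N -> f1 i j = f2 i j) ->
  of_table f1 = of_table f2.
Proof.
move=> E; apply/ffunP => -[[i j] l]; rewrite !ffunE /= E //.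
  by rewrite ltnS geq_min leq_max leqnn.
by rewrite gtn_max !ltn_ord.
Qed.

Lemma line_table f1 f2 t :
  line (of_table f1) (of_table f2) t =
  of_table (fun i j => f1 i j + t *: (f2 i j - f1 i j)).
Proof. by apply/ffunP => i; rewrite !ffunE !mxE /acoord !ffunE. Qed.

Definition comb v1 v2 v3 v4 v5 w : 'cV[k]_5 :=
  w (inord 0) 0 *: v1 + w (inord 1) 0 *: v2 + w (inord 2) 0 *: v3 +
  w (inord 3) 0 *: v4 + w (inord 4) 0 *: v5.

Lemma combE v1 v2 v3 v4 v5 a1 a2 a3 a4 a5 :
  comb v1 v2 v3 v4 v5 (vec a1 a2 a3 a4 a5) =
  a1 *: v1 + a2 *: v2 + a3 *: v3 + a4 *: v4 + a5 *: v5.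
Proof. by rewrite /comb !mxE !inordK. Qed.

Definition independent v1 v2 v3 v4 v5 : Prop :=
  forall a1 a2 a3 a4 a5,
    a1 *: v1 + a2 *: v2 + a3 *: v3 + a4 *: v4 + a5 *: v5 = 0 ->
  [/\ a1 = 0, a2 = 0, a3 = 0, a4 = 0 & a5 = 0].

(** An isomorphism is reduced to five independent vectors and fifteen products. The shift [i.-1]
    reconciles tables numbered from 1 with lists numbered from 0. *)
Lemma orbit_table c f v1 v2 v3 v4 v5 :
    commutative_structure c -> independent v1 v2 v3 v4 v5 ->
    (forall i j, (0 < i)%N -> (i <= j)%N -> (j <= 5)%N ->
      amul c (nth 0 [:: v1; v2; v3; v4; v5] i.-1)
             (nth 0 [:: v1; v2; v3; v4; v5] j.-1) =
      comb v1 v2 v3 v4 v5 (f i j)) ->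
  gl_orbit (of_table f) c.
Proof.
move=> cC vI H.
pose g : 'M[k]_5 := \matrix_(i, j) (nth 0 [:: v1; v2; v3; v4; v5] j) i 0.
have colg i : col i g = nth 0 [:: v1; v2; v3; v4; v5] i.
  by apply/colP => j; rewrite !mxE.
have gE w : g *m w = comb v1 v2 v3 v4 v5 w.
  have [a1 [a2 [a3 [a4 [a5 ->]]]]] := vecP w; rewrite combE.
  apply/colP => i; rewrite !mxE !big_ord_recl !big_ord0 !mxE /=; ring.
have ug : g \in unitmx.
  rewrite -unitmx_tr -row_free_unit; apply: inj_row_free => w wg0.
  have : g *m w^T = 0 by rewrite -[g]trmxK -trmx_mul wg0 trmx0.
  have [a1 [a2 [a3 [a4 [a5 wE]]]]] := vecP w^T.
  rewrite wE gE combE => /vI[? ? ? ? ?]; subst.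
  by apply: trmx_inj; rewrite wE vec0 trmx0.
apply: (@orbit_basis _ _ _ _ g) => // i j.
have T : amul (of_table f) (delta_mx i 0) (delta_mx j 0) =
    f (minn i j).+1 (maxn i j).+1.
  by apply/colP => l; rewrite amul_delta /acoord ffunE.
rewrite T gE !colg -H //.
- by case: (leqP i j) => _ //=; rewrite cC.
- by rewrite ltnS geq_min leq_max leqnn.
- by rewrite gtn_max !ltn_ord.
Qed.

Lemma table_orbit f1 f2 v1 v2 v3 v4 v5 :
    independent v1 v2 v3 v4 v5 ->
    (forall i j, (0 < i)%N -> (i <= j)%N -> (j <= 5)%N ->
      amul (of_table f1) (nth 0 [:: v1; v2; v3; v4; v5] i.-1)
             (nth 0 [:: v1; v2; v3; v4; v5] j.-1) =
      comb v1 v2 v3 v4 v5 (f2 i j)) ->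
  gl_orbit (of_table f2) (of_table f1).
Proof. by move=> vI H; apply: orbit_table H => //; apply: table_comm. Qed.

Implicit Types (q p a b : nat -> nat -> k) (m r s : nat -> k).

(* In fam1, dim J^2 <= 2; in the other families dim J^2 <= 3, with R_3 in <n5> for fam2,
   R_3 in <n4, n5> and R_4 = 0 for fam3, and R_4 in <n5> for fam4. *)
Definition fam1 q p m : structures k 5 := of_table (fun i j =>
  if (j <= 3)%N then vec 0 0 0 (q i j) (p i j)
  else if (j == 4%N) && (i <= 3)%N then vec 0 0 0 0 (m i) else 0).

Lemma amul_fam1 q p m (x1 x2 x3 x4 x5 y1 y2 y3 y4 y5 : k) :
  amul (fam1 q p m) (vec x1 x2 x3 x4 x5) (vec y1 y2 y3 y4 y5) =
  vec 0 0 0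
    (x1 * y1 * q 1%N 1%N + (x1 * y2 + x2 * y1) * q 1%N 2%N +
     (x1 * y3 + x3 * y1) * q 1%N 3%N + x2 * y2 * q 2%N 2%N +
     (x2 * y3 + x3 * y2) * q 2%N 3%N + x3 * y3 * q 3%N 3%N)
    (x1 * y1 * p 1%N 1%N + (x1 * y2 + x2 * y1) * p 1%N 2%N +
     (x1 * y3 + x3 * y1) * p 1%N 3%N + x2 * y2 * p 2%N 2%N +
     (x2 * y3 + x3 * y2) * p 2%N 3%N + x3 * y3 * p 3%N 3%N +
     (x1 * y4 + x4 * y1) * m 1%N + (x2 * y4 + x4 * y2) * m 2%N +
     (x3 * y4 + x4 * y3) * m 3%N).
Proof. by rewrite amul_table /= -vec0 !vecE; congr vec; ring. Qed.

Definition fam2 a b p m r : structures k 5 := of_table (fun i j =>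
  if (j <= 2)%N then vec 0 0 (a i j) (b i j) (p i j)
  else if (j == 3%N) && (i <= 2)%N then vec 0 0 0 0 (m i)
  else if (j == 4%N) && (i <= 2)%N then vec 0 0 0 0 (r i) else 0).

Lemma amul_fam2 a b p m r (x1 x2 x3 x4 x5 y1 y2 y3 y4 y5 : k) :
  amul (fam2 a b p m r) (vec x1 x2 x3 x4 x5) (vec y1 y2 y3 y4 y5) =
  vec 0 0
    (x1 * y1 * a 1%N 1%N + (x1 * y2 + x2 * y1) * a 1%N 2%N + x2 * y2 * a 2%N 2%N)
    (x1 * y1 * b 1%N 1%N + (x1 * y2 + x2 * y1) * b 1%N 2%N + x2 * y2 * b 2%N 2%N)
    (x1 * y1 * p 1%N 1%N + (x1 * y2 + x2 * y1) * p 1%N 2%N + x2 * y2 * p 2%N 2%N +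
     (x1 * y3 + x3 * y1) * m 1%N + (x2 * y3 + x3 * y2) * m 2%N +
     (x1 * y4 + x4 * y1) * r 1%N + (x2 * y4 + x4 * y2) * r 2%N).
Proof. by rewrite amul_table /= -vec0 !vecE; congr vec; ring. Qed.

Definition fam3 a b p r s : structures k 5 := of_table (fun i j =>
  if (j <= 2)%N then vec 0 0 (a i j) (b i j) (p i j)
  else if (j == 3%N) && (i <= 2)%N then vec 0 0 0 (r i) (s i) else 0).

Lemma amul_fam3 a b p r s (x1 x2 x3 x4 x5 y1 y2 y3 y4 y5 : k) :
  amul (fam3 a b p r s) (vec x1 x2 x3 x4 x5) (vec y1 y2 y3 y4 y5) =
  vec 0 0
    (x1 * y1 * a 1%N 1%N + (x1 * y2 + x2 * y1) * a 1%N 2%N + x2 * y2 * a 2%N 2%N)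
    (x1 * y1 * b 1%N 1%N + (x1 * y2 + x2 * y1) * b 1%N 2%N + x2 * y2 * b 2%N 2%N +
     (x1 * y3 + x3 * y1) * r 1%N + (x2 * y3 + x3 * y2) * r 2%N)
    (x1 * y1 * p 1%N 1%N + (x1 * y2 + x2 * y1) * p 1%N 2%N + x2 * y2 * p 2%N 2%N +
     (x1 * y3 + x3 * y1) * s 1%N + (x2 * y3 + x3 * y2) * s 2%N).
Proof. by rewrite amul_table /= -vec0 !vecE; congr vec; ring. Qed.

(** This family is already normalized: n3, n4, n5 are the successive products n1 n1, n1 n3, n1 n4,
    and n3 n3 = n5 is the Jordan identity (x x)(x x) = ((x x) x) x at x = n1. *)
Definition fam4 (al be ga si ta : k) : structures k 5 := of_table (fun i j =>
  match i, j return 'cV[k]_5 with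
  | 1, 1 => nn k 3
  | 1, 2 => vec 0 0 0 al be
  | 1, 3 => nn k 4
  | 1, 4 => nn k 5
  | 2, 2 => vec 0 0 0 ga si
  | 2, 3 => vec 0 0 0 0 ta
  | 3, 3 => nn k 5
  | _, _ => 0%R
  end%N).

Lemma amul_fam4 al be ga si ta (x1 x2 x3 x4 x5 y1 y2 y3 y4 y5 : k) :
  amul (fam4 al be ga si ta) (vec x1 x2 x3 x4 x5) (vec y1 y2 y3 y4 y5) =
  vec 0 0
    (x1 * y1)
    ((x1 * y2 + x2 * y1) * al + (x1 * y3 + x3 * y1) + x2 * y2 * ga)
    ((x1 * y2 + x2 * y1) * be + (x1 * y4 + x4 * y1) + x2 * y2 * si +
     (x2 * y3 + x3 * y2) * ta + x3 * y3).
Proof. by rewrite amul_table /= !nnE -vec0 !vecE; congr vec; ring. Qed.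

Lemma amul_eps1 (x1 x2 x3 x4 x5 y1 y2 y3 y4 y5 : k) :
  amul (eps1 k) (vec x1 x2 x3 x4 x5) (vec y1 y2 y3 y4 y5) =
  vec 0 (x1 * y1) (x1 * y2 + x2 * y1) (x2 * y2 + x1 * y3 + x3 * y1)
    (x1 * y4 + x4 * y1 + x2 * y3 + x3 * y2).
Proof. by rewrite amul_table /= !nnE -vec0 !vecE; congr vec; ring. Qed.

Definition sym_coef (l : seq (nat * nat)) i j : k := ((i, j) \in l)%:R.

Lemma J21_fam1 : J21 k =
  fam1 (sym_coef [:: (1, 2); (3, 3)]%N) (sym_coef [:: (1, 1); (2, 2)]%N)
       (fun i => (i == 3)%:R).
Proof.
apply: table_ext => i j; case: j => [|[|[|[|[|[|//]]]]]] //;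
by case: i => [|[|[|[|[|[|//]]]]]] //= _ _ _; rewrite ?nnE -?vec0.
Qed.

Lemma J27_fam2 (e f : k) : J27 e f =
  fam2 (sym_coef [:: (1, 1)]%N) (sym_coef [:: (2, 2)]%N) (fun _ _ => 0)
       (fun i => if i is 1 then f else 1) (fun i => if i is 1 then 1 else e).
Proof.
apply: table_ext => i j; case: j => [|[|[|[|[|[|//]]]]]] //;
case: i => [|[|[|[|[|[|//]]]]]] //= _ _ _; rewrite ?nnE -?vec0 ?vecZ //;
by congr vec; rewrite ?mulr0 ?mulr1.
Qed.

Lemma J40_fam3 : J40 k =
  fam3 (sym_coef [:: (1, 2)]%N) (sym_coef [:: (2, 2)]%N) (sym_coef [:: (1, 1)]%N)
       (fun i => (i == 1)%:R) (fun i => (i == 2)%:R).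
Proof.
apply: table_ext => i j; case: j => [|[|[|[|[|[|//]]]]]] //;
by case: i => [|[|[|[|[|[|//]]]]]] //= _ _ _; rewrite ?nnE -?vec0.
Qed.

Lemma JorN_table f :
    (forall x y, amul (of_table f) (amul (of_table f) (amul (of_table f) x x) y) x =
       amul (of_table f) (amul (of_table f) x x) (amul (of_table f) y x)) ->
    rpower (of_table f) 5 = 0%VS ->
  JorN k 5 (of_table f).
Proof.
have C := @table_comm f; move=> J R; split; first by split.
exact/(nilpotentP C).
Qed.

Lemma rpower_vanish c (m p : nat) : (m <= p)%N ->
    (forall x (s : seq 'cV[k]_5), size s = m -> foldl (amul c) x s = 0) ->
  rpower c p = 0%VS.
Proof.
move=> mp H; apply/eqP; rewrite -subv0; apply: subv_trans (rpower_anti c mp) _.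
rewrite subv0; apply/eqP/rpower_eq0 => x s.
by apply: H; rewrite size_tuple.
Qed.

(** Here, and in [fam2] and [fam3], both sides of the Jordan identity vanish identically; in [fam4]
    both are x1^3 y1 times n5. *)
Lemma fam1_JorN q p m : JorN k 5 (fam1 q p m).
Proof.
apply: JorN_table => [x y|].
  by vecs; rewrite -/(fam1 q p m) !amul_fam1; congr vec; ring.
apply: (@rpower_vanish _ 3) => // x [|y [|z [|t [|//]]]] //= _.
by vecs; rewrite -/(fam1 q p m) !amul_fam1 -vec0; congr vec; ring.
Qed.

Lemma fam2_JorN a b p m r : JorN k 5 (fam2 a b p m r).
Proof.
apply: JorN_table => [x y|].
  by vecs; rewrite -/(fam2 a b p m r) !amul_fam2; congr vec; ring.
apply: (@rpower_vanish _ 3) => // x [|y [|z [|t [|//]]]] //= _.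
by vecs; rewrite -/(fam2 a b p m r) !amul_fam2 -vec0; congr vec; ring.
Qed.

Lemma fam3_JorN a b p r s : JorN k 5 (fam3 a b p r s).
Proof.
apply: JorN_table => [x y|].
  by vecs; rewrite -/(fam3 a b p r s) !amul_fam3; congr vec; ring.
apply: (@rpower_vanish _ 3) => // x [|y [|z [|t [|//]]]] //= _.
by vecs; rewrite -/(fam3 a b p r s) !amul_fam3 -vec0; congr vec; ring.
Qed.

Lemma fam4_JorN al be ga si ta : JorN k 5 (fam4 al be ga si ta).
Proof.
apply: JorN_table => [x y|].
  by vecs; rewrite -/(fam4 al be ga si ta) !amul_fam4; congr vec; ring.
apply: (@rpower_vanish _ 4) => // x [|y [|z [|t [|u [|//]]]]] //= _.
by vecs; rewrite -/(fam4 al be ga si ta) !amul_fam4 -vec0; congr vec; ring.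
Qed.

Lemma eps1_JorN : JorN k 5 (eps1 k).
Proof.
apply: JorN_table => [x y|].
  by vecs; rewrite -/(eps1 k) !amul_eps1; congr vec; ring.
apply: (@rpower_vanish _ 5) => // x [|y [|z [|t [|u [|v [|//]]]]]] //= _.
by vecs; rewrite -/(eps1 k) !amul_eps1 -vec0; congr vec; ring.
Qed.

End Tables.

(** * Covariants *)

Section Covariants.
Variables (k : fieldType) (n : nat).
Implicit Types (c d : structures k n) (x y z : 'cV[k]_n) (g : 'M[k]_n).
Implicit Types (u : nat -> 'cV[k]_n) (ph : nat -> 'rV[k]_n).

Definition app (f : 'rV[k]_n) x : k := (f *m x) 0 0.

Lemma appD f x y : app f (x + y) = app f x + app f y.
Proof. by rewrite /app mulmxDr mxE. Qed.

Lemma appN f x : app f (- x) = - app f x.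
Proof. by rewrite /app mulmxN mxE. Qed.

Lemma appB f x y : app f (x - y) = app f x - app f y.
Proof. by rewrite appD appN. Qed.

Lemma appZ f a x : app f (a *: x) = a * app f x.
Proof. by rewrite /app -scalemxAr mxE. Qed.

Lemma app_neq0 x : x != 0 -> exists f, app f x != 0.
Proof.
move=> /cV0Pn[i xi]; exists (delta_mx 0 i).
by rewrite /app -rowE mxE.
Qed.

Lemma polyfun_app f (F : structures k n -> 'cV[k]_n) :
  polyvec F -> polyfun (fun c => app f (F c)).
Proof.
move=> FP; rewrite (_ : (fun _ => _) = fun c => \sum_i f 0 i * F c i 0).
  by apply: polyfun_sum => i; apply: polyfunM (FP i); apply: polyfun_cst.
by apply/funext => c; rewrite /app mxE.
Qed.

Lemma amul_actM g c x y : g \in unitmx ->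
  amul (gl_act g c) (g *m x) (g *m y) = g *m amul c x y.
Proof. by move=> ug; rewrite amul_act // !mulKmx. Qed.

Lemma app_act g f x : g \in unitmx -> app (f *m invmx g) (g *m x) = app f x.
Proof. by move=> ug; rewrite /app -mulmxA mulKmx. Qed.

(** In a commutative algebra this is (x y) z - x (y z), written with left-nested products so that
    the formulas for (x y) z on the families apply to both terms. *)
Definition associator c x y z : 'cV[k]_n :=
  amul c (amul c x y) z - amul c (amul c z y) x.

Definition covariant (P : structures k n -> (nat -> 'cV[k]_n) ->
    (nat -> 'rV[k]_n) -> k) : Prop :=
  (forall u ph, polyfun (fun c => P c u ph)) /\
  (forall g c u ph, g \in unitmx ->
    P (gl_act g c) (fun i => g *m u i) (fun i => ph i *m invmx g) = P c u ph).

(** A single existential over pairs matches [open_nonzeros]: the set is a union of principal open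
    sets, one for each choice of vectors and functionals. *)
Definition nonvanishing (P : structures k n -> (nat -> 'cV[k]_n) ->
    (nat -> 'rV[k]_n) -> k) c : Prop :=
  exists t : (nat -> 'cV[k]_n) * (nat -> 'rV[k]_n), P c t.1 t.2 != 0.

Lemma open_nonvanishing P : covariant P -> open [set c | nonvanishing P c].
Proof. by move=> [PP _]; apply: open_nonzeros => -[u ph]; apply: PP. Qed.

Lemma closed_vanishing P : covariant P -> closed [set c | ~ nonvanishing P c].
Proof. by move=> /open_nonvanishing oP; apply: open_closedC. Qed.

Lemma nonvanishing_orbit P c d :
  covariant P -> gl_orbit c d -> nonvanishing P c -> nonvanishing P d.
Proof.
move=> [_ Pg] [g ug ->] [[u ph] Pc].
by exists (fun i => g *m u i, fun i => ph i *m invmx g); rewrite /= Pg.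
Qed.

Definition minor2 (f g : 'rV[k]_n) x y : k :=
  app f x * app g y - app g x * app f y.

(* Resultants of binary forms: a0 s^2 + a1 s t + a2 t^2 and the form of coefficients b. *)
Definition res22 (a0 a1 a2 b0 b1 b2 : k) : k :=
  (a0 * b2 - a2 * b0) ^+ 2 - (a0 * b1 - a1 * b0) * (a1 * b2 - a2 * b1).

Definition res23 (a0 a1 a2 b0 b1 b2 b3 : k) : k :=
  b0 ^+ 2 * a2 ^+ 3 - b0 * b1 * a2 ^+ 2 * a1 + b0 * b2 * a2 * (a1 ^+ 2 - 2 * a0 * a2)
  + b0 * b3 * (3 * a0 * a1 * a2 - a1 ^+ 3) + b1 ^+ 2 * a0 * a2 ^+ 2
  - b1 * b2 * a0 * a1 * a2 + b1 * b3 * a0 * (a1 ^+ 2 - 2 * a0 * a2)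
  + b2 ^+ 2 * a0 ^+ 2 * a2 - b2 * b3 * a0 ^+ 2 * a1 + b3 ^+ 2 * a0 ^+ 3.

(** The common factor is l0 s + l1 t, and the cofactors are given by the p's and the q's. *)
Lemma res22_common l0 l1 p0 p1 q0 q1 a0 a1 a2 b0 b1 b2 :
    a0 = l0 * p0 -> a1 = l0 * p1 + l1 * p0 -> a2 = l1 * p1 ->
    b0 = l0 * q0 -> b1 = l0 * q1 + l1 * q0 -> b2 = l1 * q1 ->
  res22 a0 a1 a2 b0 b1 b2 = 0.
Proof. by move=> -> -> -> -> -> ->; rewrite /res22; ring. Qed.

Lemma res23_common l0 l1 p0 p1 q0 q1 q2 a0 a1 a2 b0 b1 b2 b3 :
    a0 = l0 * p0 -> a1 = l0 * p1 + l1 * p0 -> a2 = l1 * p1 ->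
    b0 = l0 * q0 -> b1 = l0 * q1 + l1 * q0 -> b2 = l0 * q2 + l1 * q1 ->
    b3 = l1 * q2 ->
  res23 a0 a1 a2 b0 b1 b2 b3 = 0.
Proof. by move=> -> -> -> -> -> -> ->; rewrite /res23; ring. Qed.

(* On the algebras annihilated by P_eps1, the polynomials P22, P40 and P21 vanish outside
   the families fam4, fam3 and fam1 respectively; the others detect degeneracies inside
   these families. P27 and P_assoc vanish on fam1, fam3, fam4 and on eps1 respectively, but
   not on J27 1 (-1). *)
Definition P_eps1 c u ph : k :=
  app (ph 0%N) (amul c (u 0%N) (amul c (u 0%N) (amul c (u 0%N) (amul c (u 0%N) (u 0%N))))).

Definition P_assoc c u ph : k := app (ph 0%N) (associator c (u 0%N) (u 1%N) (u 2%N)).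

(** The minor on the pair (u0, u1) of the linear forms [f] and [h] in [y]. In [fam4] the form [h]
    only sees the n1-coordinate, so the minor extracts [ga]. *)
Definition P22 c u ph : k :=
  let f y := app (ph 0%N) (associator c (u 0%N) y (u 1%N)) in
  let h y := app (ph 0%N)
    (amul c (amul c (amul c (u 0%N) (u 0%N)) (u 0%N)) y) in
  f (u 0%N) * h (u 1%N) - f (u 1%N) * h (u 0%N).

(** Nonzero only if two associators are linearly independent, hence zero when all associators lie on
    one line. *)
Definition P40 c u ph : k :=
  minor2 (ph 0%N) (ph 1%N) (associator c (u 0%N) (u 1%N) (u 1%N))
                           (associator c (u 1%N) (u 0%N) (u 0%N)).

(* The resultant of the forms (x x) z and (x x) /\ ((v w) x) in (s, t), where
   x = s v + t w and /\ is the minor of two functionals. *)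
Definition P40' c u ph : k :=
  let v := u 0%N in let w := u 1%N in let z := u 2%N in
  let W := minor2 (ph 0%N) (ph 1%N) in let q x y := amul c x y in
  let vw := q v w in
  res23 (app (ph 2%N) (q (q v v) z)) (2 * app (ph 2%N) (q (q v w) z))
        (app (ph 2%N) (q (q w w) z))
    (W (q v v) (q vw v)) (2 * W (q v w) (q vw v) + W (q v v) (q vw w))
    (2 * W (q v w) (q vw w) + W (q w w) (q vw v)) (W (q w w) (q vw w)).

(** A 2 by 2 determinant of the bilinear form in (y, x) given by the associator; it vanishes as soon
    as the middle argument separates from the outer ones. *)
Definition P21 c u ph : k :=
  let g y x z := app (ph 0%N) (associator c x y z) in
  g (u 0%N) (u 0%N) (u 2%N) * g (u 1%N) (u 1%N) (u 2%N) -
  g (u 0%N) (u 1%N) (u 2%N) * g (u 1%N) (u 0%N) (u 2%N).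

(** The 3 by 3 determinant of (x, y) |-> (x y) u3. In [fam1] this form is a multiple of [q]. *)
Definition P21_gram c u ph : k :=
  let e i j := app (ph 0%N) (amul c (amul c (u i) (u j)) (u 3%N)) in
  e 0%N 0%N * (e 1%N 1%N * e 2%N 2%N - e 1%N 2%N * e 2%N 1%N) -
  e 0%N 1%N * (e 1%N 0%N * e 2%N 2%N - e 1%N 2%N * e 2%N 0%N) +
  e 0%N 2%N * (e 1%N 0%N * e 2%N 1%N - e 1%N 1%N * e 2%N 0%N).

(* For the family fam1, the vectors ker_vec c u ph i lie in the kernel of the form m. *)
Definition ker_vec c u ph i : 'cV[k]_n :=
  let m z := app (ph 0%N) (amul c (amul c (u 2%N) (u 2%N)) z) in
  m (u 2%N) *: u i - m (u i) *: u 2%N.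

(** For [fam1], up to a square factor, the discriminant of [q] on the kernel of [m]. *)
Definition P21_disc c u ph : k :=
  let y := ker_vec c u ph in
  let e i j := app (ph 0%N) (amul c (amul c (y i) (y j)) (u 2%N)) in
  e 0%N 0%N * e 1%N 1%N - e 0%N 1%N ^+ 2.

(** The resultant of two coordinates of x x, for [x] in the plane spanned by the kernel vectors. *)
Definition P21_res c u ph : k :=
  let y := ker_vec c u ph in
  let e i j := amul c (y i) (y j) in
  res22 (app (ph 1%N) (e 0%N 0%N)) (2 * app (ph 1%N) (e 0%N 1%N))
        (app (ph 1%N) (e 1%N 1%N))
        (app (ph 2%N) (e 0%N 0%N)) (2 * app (ph 2%N) (e 0%N 1%N))
        (app (ph 2%N) (e 1%N 1%N)).

(* The resultant of the forms (x v) x and (x w) x in (s, t), where x = s v + t w. *)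
Definition P27 c u ph : k :=
  let T x y z := app (ph 0%N) (amul c (amul c x y) z) in
  let v := u 0%N in let w := u 1%N in
  res22 (T v v v) (T v v w + T w v v) (T w v w)
        (T v w v) (T v w w + T w w v) (T w w w).

Ltac polyfuns := rewrite /minor2 /associator /ker_vec; repeat first
  [ exact: polyfun_cst | exact: polyvec_cst | apply: polyfunB | apply: polyfunD
  | apply: polyfunN | apply: polyfunX | apply: polyfunM | apply: polyfun_app
  | apply: polyvecB | apply: polyvecD | apply: polyvecZ | apply: polyvec_amul ].

Lemma associator_act g c x y z : g \in unitmx ->
  associator (gl_act g c) (g *m x) (g *m y) (g *m z) = g *m associator c x y z.
Proof. by move=> ug; rewrite /associator !amul_actM // mulmxBr. Qed.

Ltac acts := move=> g c u ph ug; rewrite /= /minor2;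
  rewrite ?associator_act ?amul_actM ?app_act //.

Lemma P_eps1_covariant : covariant P_eps1.
Proof. by split=> [u ph|]; rewrite /P_eps1; [polyfuns|acts]. Qed.

Lemma P_assoc_covariant : covariant P_assoc.
Proof. by split=> [u ph|]; rewrite /P_assoc; [polyfuns|acts]. Qed.

Lemma P22_covariant : covariant P22.
Proof. by split=> [u ph|]; rewrite /P22; [polyfuns|acts]. Qed.

Lemma P40_covariant : covariant P40.
Proof. by split=> [u ph|]; rewrite /P40; [polyfuns|acts]. Qed.

Lemma P40'_covariant : covariant P40'.
Proof. by split=> [u ph|]; rewrite /P40' /res23; [polyfuns|acts]. Qed.

Lemma P21_covariant : covariant P21.
Proof. by split=> [u ph|]; rewrite /P21; [polyfuns|acts]. Qed.

Lemma P21_gram_covariant : covariant P21_gram.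
Proof. by split=> [u ph|]; rewrite /P21_gram; [polyfuns|acts]. Qed.

Lemma ker_vec_act g c u ph i : g \in unitmx ->
  ker_vec (gl_act g c) (fun i => g *m u i) (fun i => ph i *m invmx g) i =
  g *m ker_vec c u ph i.
Proof.
by move=> ug; rewrite /ker_vec !amul_actM // !app_act // mulmxBr -!scalemxAr.
Qed.

Lemma P21_disc_covariant : covariant P21_disc.
Proof.
split=> [u ph|]; rewrite /P21_disc; first by polyfuns.
by move=> g c u ph ug; rewrite !ker_vec_act // !amul_actM // !app_act.
Qed.

Lemma P21_res_covariant : covariant P21_res.
Proof.
split=> [u ph|]; rewrite /P21_res /res22; first by polyfuns.
by move=> g c u ph ug; rewrite !ker_vec_act // !amul_actM // !app_act.
Qed.

Lemma P27_covariant : covariant P27.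
Proof. by split=> [u ph|]; rewrite /P27 /res22; [polyfuns|acts]. Qed.

End Covariants.

(** * Values of the covariants on the families *)

Section Values.
Variable k : fieldType.
Implicit Types (c d : structures k 5) (x y z : 'cV[k]_5).
Implicit Types (q p a b : nat -> nat -> k) (m r s : nat -> k).
Implicit Types (u : nat -> 'cV[k]_5) (ph : nat -> 'rV[k]_5).

Definition co x (i : nat) : k := x (inord i.-1) 0.

Lemma co_vec (a1 a2 a3 a4 a5 : k) :
  (co (vec a1 a2 a3 a4 a5) 1 = a1) * (co (vec a1 a2 a3 a4 a5) 2 = a2) *
  (co (vec a1 a2 a3 a4 a5) 3 = a3) * (co (vec a1 a2 a3 a4 a5) 4 = a4) *
  (co (vec a1 a2 a3 a4 a5) 5 = a5).
Proof. by rewrite /co !mxE !inordK. Qed.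

Definition bil2 a x y : k :=
  co x 1 * co y 1 * a 1%N 1%N + (co x 1 * co y 2 + co x 2 * co y 1) * a 1%N 2%N +
  co x 2 * co y 2 * a 2%N 2%N.

Definition bil3 q x y : k :=
  co x 1 * co y 1 * q 1%N 1%N + (co x 1 * co y 2 + co x 2 * co y 1) * q 1%N 2%N +
  (co x 1 * co y 3 + co x 3 * co y 1) * q 1%N 3%N + co x 2 * co y 2 * q 2%N 2%N +
  (co x 2 * co y 3 + co x 3 * co y 2) * q 2%N 3%N + co x 3 * co y 3 * q 3%N 3%N.

Definition lin2 m x : k := co x 1 * m 1%N + co x 2 * m 2%N.

Definition lin3 m x : k := co x 1 * m 1%N + co x 2 * m 2%N + co x 3 * m 3%N.

Definition om x y : k := co x 1 * co y 2 - co x 2 * co y 1.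

Lemma bil2C a x y : bil2 a x y = bil2 a y x.
Proof. by rewrite /bil2; ring. Qed.

Lemma bil3C a x y : bil3 a x y = bil3 a y x.
Proof. by rewrite /bil3; ring. Qed.

End Values.

Ltac covecs := vecs; rewrite /om /bil2 /bil3 /lin2 /lin3 ?co_vec.

Section Values.
Variable k : fieldType.
Implicit Types (c d : structures k 5) (x y z : 'cV[k]_5).
Implicit Types (q p a b : nat -> nat -> k) (m r s : nat -> k).
Implicit Types (u : nat -> 'cV[k]_5) (ph : nat -> 'rV[k]_5).

Lemma app0 (f : 'rV[k]_5) : app f 0 = 0.
Proof. by rewrite /app mulmx0 mxE. Qed.

Section Fam1.
Variables (q p : nat -> nat -> k) (m : nat -> k).
Let c := fam1 q p m.

Lemma fam1_mul x y : amul c x y = bil3 q x y *: nn k 4 +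
  (bil3 p x y + co x 4 * lin3 m y + co y 4 * lin3 m x) *: nn k 5.
Proof.
by covecs; rewrite /c amul_fam1 !nnE !vecE; congr vec; ring.
Qed.

Lemma fam1_mul2 x y z :
  amul c (amul c x y) z = (bil3 q x y * lin3 m z) *: nn k 5.
Proof.
rewrite (fam1_mul x y); covecs; rewrite !nnE !vecE /c amul_fam1.
by congr vec; ring.
Qed.

Lemma fam1_mul3 x y z t : amul c (amul c (amul c x y) z) t = 0.
Proof.
rewrite (fam1_mul2 x y z); covecs; rewrite !nnE !vecE /c amul_fam1 -vec0.
by congr vec; ring.
Qed.

Lemma fam1_P_eps1 u ph : P_eps1 c u ph = 0.
Proof.
have C := @table_comm _ _ : commutative_structure c.
rewrite /P_eps1; do 3!rewrite [amul c (u 0%N) (amul _ _ _)]C.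
by rewrite fam1_mul3 app0.
Qed.

Lemma fam1_P22 u ph : P22 c u ph = 0.
Proof. by rewrite /P22 !fam1_mul3 !app0; ring. Qed.

Lemma fam1_associator x y z : associator c x y z =
  (bil3 q x y * lin3 m z - bil3 q z y * lin3 m x) *: nn k 5.
Proof. by rewrite /associator !fam1_mul2 scalerBl. Qed.

Lemma fam1_P40 u ph : P40 c u ph = 0.
Proof. by rewrite /P40 /minor2 !fam1_associator !appZ; ring. Qed.

(** Since (x v) x is q(x, v) m(x) n5, both quadratic forms are divisible by m(x). *)
Lemma fam1_P27 u ph : P27 c u ph = 0.
Proof.
rewrite /P27 !fam1_mul2 !appZ (bil3C q (u 1%N) (u 0%N)).
apply: (@res22_common _ (lin3 m (u 0%N)) (lin3 m (u 1%N))
  (bil3 q (u 0%N) (u 0%N) * app (ph 0%N) (nn k 5))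
  (bil3 q (u 0%N) (u 1%N) * app (ph 0%N) (nn k 5))
  (bil3 q (u 0%N) (u 1%N) * app (ph 0%N) (nn k 5))
  (bil3 q (u 1%N) (u 1%N) * app (ph 0%N) (nn k 5))); ring.
Qed.

End Fam1.

Section Fam2.
Variables (a b p : nat -> nat -> k) (m r : nat -> k).
Let c := fam2 a b p m r.

Lemma fam2_mul2 x y z : amul c (amul c x y) z =
  (bil2 a x y * lin2 m z + bil2 b x y * lin2 r z) *: nn k 5.
Proof. by covecs; rewrite /c !amul_fam2 !nnE !vecE; congr vec; ring. Qed.

Lemma fam2_mul3 x y z t : amul c (amul c (amul c x y) z) t = 0.
Proof.
rewrite (fam2_mul2 x y z); covecs; rewrite !nnE !vecE /c amul_fam2 -vec0.
by congr vec; ring.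
Qed.

Lemma fam2_P_eps1 u ph : P_eps1 c u ph = 0.
Proof.
have C := @table_comm _ _ : commutative_structure c.
rewrite /P_eps1; do 3!rewrite [amul c (u 0%N) (amul _ _ _)]C.
by rewrite fam2_mul3 app0.
Qed.

Lemma fam2_P22 u ph : P22 c u ph = 0.
Proof. by rewrite /P22 !fam2_mul3 !app0; ring. Qed.

(** The associator alternates in [x] and [z] and depends only on n1- and n2-coordinates, so it is a
    multiple of the area form [om]. This factorization annihilates [P40] and [P21]. *)
Lemma fam2_associator x y z : associator c x y z = (om x z *
  (bil2 a (nn k 1) y * m 2%N + bil2 b (nn k 1) y * r 2%N -
   bil2 a (nn k 2) y * m 1%N - bil2 b (nn k 2) y * r 1%N)) *: nn k 5.
Proof.
rewrite /associator !fam2_mul2 -scalerBl; congr (_ *: _).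
by rewrite !nnE; covecs; ring.
Qed.

Lemma fam2_P40 u ph : P40 c u ph = 0.
Proof. by rewrite /P40 /minor2 !fam2_associator !appZ; ring. Qed.

Lemma fam2_P21 u ph : P21 c u ph = 0.
Proof. by rewrite /P21 !fam2_associator !appZ; ring. Qed.

End Fam2.

Section Fam3.
Variables (a b p : nat -> nat -> k) (r s : nat -> k).
Let c := fam3 a b p r s.

Lemma fam3_mul x y : amul c x y = bil2 a x y *: nn k 3 +
  (bil2 b x y + co x 3 * lin2 r y + co y 3 * lin2 r x) *: nn k 4 +
  (bil2 p x y + co x 3 * lin2 s y + co y 3 * lin2 s x) *: nn k 5.
Proof. by covecs; rewrite /c !amul_fam3 !nnE !vecE; congr vec; ring. Qed.

Lemma fam3_mul2 x y z : amul c (amul c x y) z =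
  bil2 a x y *: (lin2 r z *: nn k 4 + lin2 s z *: nn k 5).
Proof. by covecs; rewrite /c !amul_fam3 !nnE !vecE; congr vec; ring. Qed.

Lemma fam3_mul3 x y z t : amul c (amul c (amul c x y) z) t = 0.
Proof.
rewrite (fam3_mul2 x y z); covecs; rewrite !nnE !vecE /c amul_fam3 -vec0.
by congr vec; ring.
Qed.

Lemma fam3_P_eps1 u ph : P_eps1 c u ph = 0.
Proof.
have C := @table_comm _ _ : commutative_structure c.
rewrite /P_eps1; do 3!rewrite [amul c (u 0%N) (amul _ _ _)]C.
by rewrite fam3_mul3 app0.
Qed.

Lemma fam3_P22 u ph : P22 c u ph = 0.
Proof. by rewrite /P22 !fam3_mul3 !app0; ring. Qed.

(** The area form factors out as in [fam2], but the remaining factor is a vector in <n4, n5>: after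
    applying a functional [P21] still vanishes, while [P40] sees the plane. *)
Lemma fam3_associator x y z : associator c x y z = om x z *:
  ((bil2 a (nn k 1) y * r 2%N - bil2 a (nn k 2) y * r 1%N) *: nn k 4 +
   (bil2 a (nn k 1) y * s 2%N - bil2 a (nn k 2) y * s 1%N) *: nn k 5).
Proof.
rewrite /associator !fam3_mul2 !nnE !vecE.
by congr vec; covecs; ring.
Qed.

Lemma fam3_P21 u ph : P21 c u ph = 0.
Proof. by rewrite /P21 !fam3_associator !appZ; ring. Qed.

(** The value shows the two genericity conditions: [a] nondegenerate, [r] and [s] independent. *)
Lemma fam3_P40 u ph : P40 c u ph =
  (a 1%N 1%N * a 2%N 2%N - a 1%N 2%N ^+ 2) * (r 1%N * s 2%N - r 2%N * s 1%N) *
  (om (u 0%N) (u 1%N) ^+ 3 *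
   (app (ph 0%N) (nn k 4) * app (ph 1%N) (nn k 5) -
    app (ph 1%N) (nn k 4) * app (ph 0%N) (nn k 5))).
Proof.
rewrite /P40 /minor2 !fam3_associator !appZ !appD !appZ !nnE.
by move: (u 0%N) (u 1%N) => x y; covecs; ring.
Qed.

Lemma fam3_P27 u ph : P27 c u ph = 0.
Proof.
rewrite /P27 !fam3_mul2 !appZ (bil2C a (u 1%N) (u 0%N)).
set f := fun z => app (ph 0%N) (lin2 r z *: nn k 4 + lin2 s z *: nn k 5).
rewrite -!/(f _).
apply: (@res22_common _ (f (u 0%N)) (f (u 1%N))
  (bil2 a (u 0%N) (u 0%N)) (bil2 a (u 0%N) (u 1%N))
  (bil2 a (u 0%N) (u 1%N)) (bil2 a (u 1%N) (u 1%N))); ring.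
Qed.

End Fam3.

Section Fam4.
Variables (al be ga si ta : k).
Let c := fam4 al be ga si ta.

Lemma fam4_mul2 x y z : amul c (amul c x y) z =
  (co x 1 * co y 1 * co z 1) *: nn k 4 +
  (((co x 1 * co y 2 + co x 2 * co y 1) * al + (co x 1 * co y 3 + co x 3 * co y 1) +
    co x 2 * co y 2 * ga) * co z 1 +
   co x 1 * co y 1 * (co z 2 * ta + co z 3)) *: nn k 5.
Proof. by covecs; rewrite /c !amul_fam4 !nnE !vecE; congr vec; ring. Qed.

Lemma fam4_mul3 x y z t : amul c (amul c (amul c x y) z) t =
  (co x 1 * co y 1 * co z 1 * co t 1) *: nn k 5.
Proof.
rewrite (fam4_mul2 x y z); covecs; rewrite !nnE !vecE /c amul_fam4.
by congr vec; ring.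
Qed.

Lemma fam4_P_eps1 u ph : P_eps1 c u ph = 0.
Proof.
have C := @table_comm _ _ : commutative_structure c.
rewrite /P_eps1; do 3!rewrite [amul c (u 0%N) (amul _ _ _)]C.
move: (u 0%N) => x; rewrite (fam4_mul3 x x x x); covecs.
rewrite !nnE !vecE /c amul_fam4.
rewrite [X in app _ X](_ : _ = 0) ?app0 // -vec0.
by congr vec; ring.
Qed.

Lemma fam4_associator x y z : associator c x y z =
  (((al - ta) * co y 1 + ga * co y 2) * (co x 2 * co z 1 - co x 1 * co z 2)) *: nn k 5.
Proof. by rewrite /associator !fam4_mul2 !nnE !vecE; congr vec; ring. Qed.

Lemma fam4_P40 u ph : P40 c u ph = 0.
Proof. by rewrite /P40 /minor2 !fam4_associator !appZ; ring. Qed.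

Lemma fam4_P21 u ph : P21 c u ph = 0.
Proof. by rewrite /P21 !fam4_associator !appZ; ring. Qed.

Lemma fam4_P22 u ph : P22 c u ph = ga * (co (u 0%N) 1 ^+ 3 *
   om (u 0%N) (u 1%N) ^+ 2 * app (ph 0%N) (nn k 5) ^+ 2).
Proof.
by rewrite /P22 !fam4_associator !fam4_mul3 !appZ /om; ring.
Qed.

(** The n1-coordinate of [x] divides (x v) x; [l v x] is the cofactor. *)
Lemma fam4_P27 u ph : P27 c u ph = 0.
Proof.
rewrite /P27 !fam4_mul2 !appD !appZ.
set f := app (ph 0%N) (nn k 4); set g := app (ph 0%N) (nn k 5).
set x := u 0%N; set y := u 1%N.
pose l z t := co z 1 * co t 1 * f +
   ((co z 1 * co t 2 + co z 2 * co t 1) * al + (co z 1 * co t 3 + co z 3 * co t 1) +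
    co z 2 * co t 2 * ga + co z 1 * (co t 2 * ta + co t 3)) * g.
apply: (@res22_common _ (co x 1) (co y 1) (l x x) (l x y) (l y x) (l y y));
  rewrite /l; ring.
Qed.

End Fam4.

Lemma eps1_mul2 x y z : amul (eps1 k) (amul (eps1 k) x y) z =
  vec 0 0 (co x 1 * co y 1 * co z 1)
    (co x 1 * co y 1 * co z 2 + co x 1 * co y 2 * co z 1 + co x 2 * co y 1 * co z 1)
    (co x 1 * co y 1 * co z 3 + co x 1 * co y 3 * co z 1 + co x 3 * co y 1 * co z 1 +
     co x 1 * co y 2 * co z 2 + co x 2 * co y 1 * co z 2 + co x 2 * co y 2 * co z 1).
Proof. by covecs; rewrite !amul_eps1; congr vec; ring. Qed.

(** [eps1] is the ideal generated by t in k[t]/(t^6), with n_i = t^i, hence associative. *)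
Lemma eps1_associator x y z : associator (eps1 k) x y z = 0.
Proof.
by rewrite /associator !eps1_mul2 !vecE -vec0; congr vec; ring.
Qed.

Lemma eps1_P22 u ph : P22 (eps1 k) u ph = 0.
Proof. by rewrite /P22 !eps1_associator app0; ring. Qed.

Lemma eps1_P40 u ph : P40 (eps1 k) u ph = 0.
Proof. by rewrite /P40 /minor2 !eps1_associator !app0; ring. Qed.

Lemma eps1_P21 u ph : P21 (eps1 k) u ph = 0.
Proof. by rewrite /P21 !eps1_associator !app0; ring. Qed.

Lemma eps1_P_assoc u ph : P_assoc (eps1 k) u ph = 0.
Proof. by rewrite /P_assoc eps1_associator app0. Qed.

Definition dual (i : nat) : 'rV[k]_5 := (nn k i)^T.

Lemma dual_vec (a1 a2 a3 a4 a5 : k) :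
  (app (dual 1) (vec a1 a2 a3 a4 a5) = a1) * (app (dual 2) (vec a1 a2 a3 a4 a5) = a2) *
  (app (dual 3) (vec a1 a2 a3 a4 a5) = a3) * (app (dual 4) (vec a1 a2 a3 a4 a5) = a4) *
  (app (dual 5) (vec a1 a2 a3 a4 a5) = a5).
Proof.
by rewrite /app /dual !mxE !big_ord_recl !big_ord0 !mxE /=; do !split; ring.
Qed.

Lemma eps1_P_eps1 : nonvanishing (@P_eps1 k 5) (eps1 k).
Proof.
exists (fun=> nn k 1, fun=> dual 5) => /=; rewrite /P_eps1 !nnE !amul_eps1 !dual_vec.
by apply/eqP => /eqP; rewrite !(mul0r, mulr0, mul1r, addr0, add0r) oner_eq0.
Qed.

End Values.

(** * Adapted bases and powers *)

Section Flags.
Variables (k : fieldType) (n : nat).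
Implicit Types (c d : structures k n) (x y z : 'cV[k]_n) (g : 'M[k]_n).

Lemma basis_extend (vT : vectType k) (U W : {vspace vT}) (X : seq vT) :
  (U <= W)%VS -> basis_of U X ->
  exists2 s, size s = (\dim W - \dim U)%N & basis_of W (s ++ X).
Proof.
move=> sUW bX; exists (vbasis (W :\: U)).
  rewrite size_tuple -(dimv_cap_compl W U) (capv_idPr sUW).
  by rewrite addKn.
have E : (W :\: U + U)%VS = W by rewrite addv_diff; apply/addv_idPl.
have dWU : directv (W :\: U + U) by apply/directv_addP/capv_diff.
by have := cat_basis dWU (vbasisP _) bX; rewrite E.
Qed.

(** The basis grows from the smallest subspace upwards by prepending vectors, which leaves the tails
    already built unchanged. *)
Lemma chain_basis (vT : vectType k) (f : nat -> {vspace vT}) N :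
    (forall i, (f i.+1 <= f i)%VS) ->
  exists X, basis_of (f 0) X /\
    forall i, (i <= N)%N -> basis_of (f i) (drop (size X - \dim (f i)) X).
Proof.
move=> f_anti; have anti i j : (i <= j)%N -> (f j <= f i)%VS.
  move=> /subnK <-; elim: (j - i)%N => [|q IHq]; first exact: subvv.
  by rewrite addSn; apply: subv_trans IHq.
suff H j : (j <= N)%N -> exists X, basis_of (f (N - j)%N) X /\
    forall i, (N - j <= i <= N)%N -> basis_of (f i) (drop (size X - \dim (f i)) X).
  have [X []] := H N (leqnn N); rewrite subnn => bX HX.
  by exists X; split=> // i iN; apply: HX.
elim: j => [|j IHj] jN.
  exists (vbasis (f N)); rewrite subn0; split; first exact: vbasisP.
  move=> i; rewrite -eqn_leq => /eqP <-.
  by rewrite size_tuple subnn drop0 vbasisP.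
have [X [bX HX]] := IHj (ltnW jN).
have sX : size X = \dim (f (N - j)%N).
  by rewrite (@vector.size_basis _ _ _ _ (in_tuple X)).
have sNj : (f (N - j)%N <= f (N - j.+1)%N)%VS by apply: anti; rewrite leq_sub2l.
have [s szs bs] := basis_extend sNj bX.
exists (s ++ X); split=> // i /andP[]; rewrite leq_eqVlt => /predU1P[<- _|lt_i iN].
  by rewrite (@vector.size_basis _ _ _ _ (in_tuple (s ++ X)) bs) subnn drop0.
have le_i : (N - j <= i)%N by rewrite -subSS subSn.
have dle : (\dim (f i) <= size X)%N by rewrite sX dimvS ?anti.
rewrite size_cat -addnBA // drop_cat ltnNge leq_addr /= addKn.
by apply: HX; rewrite le_i.
Qed.

Lemma rpower_act_mem g c m x : g \in unitmx ->
  x \in rpower c m -> g *m x \in rpower (gl_act g c) m.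
Proof.
move=> ug; have E y U : (y \in (linfun (mulmx g) @^-1: U)%VS) = (g *m y \in U).
  by rewrite -memv_preim lfunE.
rewrite -E; move: x; apply/subvP.
elim: m => [|m IHm]; first by apply/subvP => y _; rewrite E memvf.
apply: vmul_sub => x y xR _; rewrite E -amul_actM //; apply: mem_rpower.
by rewrite -E; apply: (subvP IHm).
Qed.

Lemma rpower_act_memE g c m x : g \in unitmx ->
  (g *m x \in rpower (gl_act g c) m) = (x \in rpower c m).
Proof.
move=> ug; apply/idP/idP; last exact: rpower_act_mem.
have ug' : invmx g \in unitmx by rewrite unitmx_inv.
move/(rpower_act_mem ug').
by rewrite mulKmx // gl_actM // mulVmx // gl_act1.
Qed.

(** Acting with the inverse of the matrix whose columns form a chain basis moves the chain of right
    powers to coordinate subspaces. *)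
Lemma adapted_structure c : exists2 d, gl_orbit c d &
  forall m x, (m <= n)%N -> (x \in rpower d m) =
    [forall l : 'I_n, (l < n - \dim (rpower c m))%N ==> (x l 0 == 0)].
Proof.
have [X [bX HX]] := @chain_basis _ (rpower c) n (rpower_sub c).
have sX : size X = n.
  rewrite -(@vector.size_basis _ _ _ _ (in_tuple X) bX) dimvf.
  by rewrite /dim /= muln1.
pose h : 'M[k]_n := \matrix_(i, j) (nth 0 X j) i 0.
have hE y : h *m y = \sum_j y j 0 *: nth 0 X j.
  apply/colP => i; rewrite mxE summxE; apply: eq_bigr => j _.
  by rewrite !mxE mulrC.
have uh : h \in unitmx.
  rewrite -unitmx_tr -row_free_unit; apply: inj_row_free => w wh0.
  have hw : h *m w^T = 0 by rewrite -[h]trmxK -trmx_mul wh0 trmx0.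
  have := basis_free bX; rewrite -[X]/(val (in_tuple X)) => /freeP fX.
  apply/rowP => j; rewrite [RHS]mxE.
  have jX : (j < size X)%N by rewrite sX.
  have := fX (fun i => w 0 (cast_ord sX i)) _ (Ordinal jX).
  have -> : cast_ord sX (Ordinal jX) = j by apply/val_inj.
  apply; rewrite -[RHS]hw hE (reindex (cast_ord sX)) /=; last first.
    by apply: onW_bij; exists (cast_ord (esym sX)) => i; apply/val_inj.
  by apply: eq_bigr => i _; rewrite mxE.
have uh' : invmx h \in unitmx by rewrite unitmx_inv.
exists (gl_act (invmx h) c); first by exists (invmx h).
move=> m x mn; rewrite -{1}(mulKmx uh x) rpower_act_memE //.
set t := (n - _)%N; have := HX m mn; rewrite sX -/t => bm.
apply/idP/forallP => [|H].
  move: bm; rewrite -[drop t X]/(val (in_tuple _)) => bm xR.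
  have ti (i : 'I_(size (drop t X))) : (t + i < n)%N.
    by have := ltn_ord i; rewrite {2}size_drop sX ltn_subRL.
  pose y : 'cV[k]_n := \sum_i coord (in_tuple (drop t X)) i (h *m x) *:
    delta_mx (Ordinal (ti i)) 0.
  have -> : x = y.
    apply: (can_inj (mulKmx uh)); rewrite {1}(coord_basis bm xR) mulmx_sumr.
    apply: eq_bigr => i _; rewrite -scalemxAr -colE; congr (_ *: _).
    by apply/colP => l; rewrite !mxE /= nth_drop.
  move=> l; apply/implyP => lt; rewrite summxE big1 // => i _.
  rewrite !mxE [l == _](_ : _ = false) ?mulr0 //.
  by apply/negP => /eqP El; move: lt; rewrite El /= ltnNge leq_addr.
rewrite hE; apply: memv_suml => j _.
have [jt|jt] := ltnP j t; first by have /implyP/(_ jt)/eqP-> := H j; rewrite scale0r mem0v.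
apply: memvZ; apply: (basis_mem bm).
by rewrite -(subnKC jt) -nth_drop mem_nth // size_drop sX ltn_sub2r // (leq_ltn_trans jt).
Qed.

End Flags.

(** * Powers of an element of a Jordan algebra *)

Section Jordan.
Variables (k : fieldType) (n : nat).
Hypothesis char2 : (2 : k) != 0.
Implicit Types (c d : structures k n) (x y z : 'cV[k]_n).

Lemma app_inj x y : (forall f, app f x = app f y) -> x = y.
Proof.
move=> E; apply/eqP; rewrite -subr_eq0; apply: contraT => /app_neq0[f].
by rewrite appB E subrr eqxx.
Qed.

(** This is the part of the identity that is linear in [z]: the identity at x + z, minus that at x -
    z, minus twice that at z, is twice this part. *)
Lemma jordan_linearize c x y z : jordan c ->
  2 *: amul c (amul c (amul c x z) y) x + amul c (amul c (amul c x x) y) z =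
  2 *: amul c (amul c x z) (amul c y x) + amul c (amul c x x) (amul c y z).
Proof.
move=> [cC cJ]; apply: app_inj => f; apply: (mulfI char2).
have := congr1 (app f) (cJ z y); have := congr1 (app f) (cJ (x - z) y).
have := congr1 (app f) (cJ (x + z) y).
rewrite !(amulDl, amulDr, amulNl, amulNr) !(appD, appN) !appZ (cC z x).
set t1 := app f _; set t2 := app f _; set t3 := app f _; set t4 := app f _.
set t5 := app f _; set t6 := app f _; set t7 := app f _; set t8 := app f _.
set t9 := app f _; set t10 := app f _; set t11 := app f _; set t12 := app f _.
move=> E1 E2 E3; apply/eqP; rewrite -subr_eq0; apply/eqP.
lazymatch type of E1 with ?a1 = ?b1 =>
lazymatch type of E2 with ?a2 = ?b2 =>
lazymatch type of E3 with ?a3 = ?b3 =>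
  transitivity (a1 - b1 - (a2 - b2) - 2 * (a3 - b3)); first ring
end end end.
by rewrite E1 E2 E3; ring.
Qed.

Section Powers.
Variables (c : structures k n) (x : 'cV[k]_n).
Hypothesis cJ : jordan c.
Let m := amul c.
Let x2 := m x x.
Let x3 := m x x2.
Let x4 := m x x3.
Let x5 := m x x4.
Let x6 := m x x5.

Let mC y z : m y z = m z y. Proof. exact: cJ.1. Qed.

Lemma jordan_commute y : m x2 (m x y) = m x (m x2 y).
Proof. by rewrite (mC x (m x2 y)) /m cJ.2 -/m (mC y x). Qed.

Lemma jordan_x2x2 : m x2 x2 = x4.
Proof. by rewrite {2}/x2 jordan_commute (mC x2 x). Qed.

Lemma jordan_x2x3 : m x2 x3 = x5.
Proof. by rewrite /x3 jordan_commute jordan_x2x2. Qed.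

Lemma jordan_x2x4 : m x2 x4 = x6.
Proof. by rewrite /x4 jordan_commute jordan_x2x3. Qed.

(** In the linearized identity with z = x2, the terms without factor 2 are equal by commutativity;
    the others say that multiplications by x and x3 commute. *)
Lemma jordan_commute3 y : m x3 (m x y) = m x (m x3 y).
Proof.
have := jordan_linearize x y x2 cJ; rewrite -/m -/x2 -/x3 (mC (m x2 y) x2).
rewrite (mC x2 y) => /addIr /(scalerI char2).
by rewrite (mC (m x3 y)) (mC y x).
Qed.

Lemma jordan_x3x3 : m x3 x3 = x6.
Proof. by rewrite {2}/x3 jordan_commute3 (mC x3 x2) jordan_x2x3. Qed.

Lemma jordan_x3x4 : m x3 x4 = m x x6.
Proof. by rewrite {1}/x4 jordan_commute3 jordan_x3x3. Qed.

(** In the linearized identity with y = z = x3, every term other than 2 x4 x4 reduces to zero. *)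
Lemma jordan_x4x4 : x6 = 0 -> m x4 x4 = 0.
Proof.
move=> x60; have m0 y : m y 0 = 0 by apply: amul0r.
have x34 : m x3 x4 = 0 by rewrite jordan_x3x4 x60 m0.
have := jordan_linearize x x3 x3 cJ; rewrite -/m -/x2 -/x3 -/x4 (mC x4 x3) x34.
rewrite jordan_x3x3 x60 m0 jordan_x2x3 (mC x5) {1}/x5 jordan_commute3 x34.
rewrite (mC x3 x) (mC 0) !m0 scaler0 !addr0 => /esym/eqP.
by rewrite scaler_eq0 (negPf char2) => /eqP.
Qed.

End Powers.
End Jordan.

(** Proves e = 0 when [e] is, up to [ring], the right side of [E] minus the left one. *)
Ltac subtract E := lazymatch type of E with ?l = ?r =>
  transitivity (r - l); [ring|by rewrite E subrr] end.

Lemma comb0 (k : fieldType) (v1 v2 v3 v4 v5 : 'cV[k]_5) :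
  comb v1 v2 v3 v4 v5 0 = 0.
Proof. by rewrite -[X in comb _ _ _ _ _ X]vec0 combE !scale0r !addr0. Qed.

(** * Normal forms and classification *)

Section Classification.
Variable k : closedFieldType.
Hypotheses (char2 : (2 : k) != 0) (char3 : (3 : k) != 0).
Implicit Types (c d : structures k 5) (x y z w v : 'cV[k]_5).

Section NormalForms.
Implicit Types (q p a b e : nat -> nat -> k) (m mu r s : nat -> k).
Implicit Types (u : nat -> 'cV[k]_5) (ph : nat -> 'rV[k]_5).

Lemma sqrt_exists (t : k) : exists s : k, s ^+ 2 = t.
Proof.
have [s] := @solve_monicpoly k 2 (fun i => if i is 0 then t else 0) isT.
by rewrite !big_ord_recl big_ord0 mulr1 mul0r !addr0 => st; exists s.
Qed.

Lemma cbrt_exists (t : k) : exists s : k, s ^+ 3 = t.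
Proof.
have [s] := @solve_monicpoly k 3 (fun i => if i is 0 then t else 0) isT.
by rewrite !big_ord_recl big_ord0 mulr1 !mul0r !addr0 => st; exists s.
Qed.

(** The two isotropic lines of a nondegenerate binary form are found by the quadratic formula, the
    case a = 0 apart because (1, 0) is then isotropic. *)
Lemma null_basis (a b c : k) : a * c - b ^+ 2 != 0 ->
  exists s1 t1 s2 t2 : k,
    [/\ a * s1 ^+ 2 + 2 * b * s1 * t1 + c * t1 ^+ 2 = 0,
        a * s2 ^+ 2 + 2 * b * s2 * t2 + c * t2 ^+ 2 = 0 &
        a * s1 * s2 + b * (s1 * t2 + s2 * t1) + c * t1 * t2 != 0].
Proof.
have [->|a0] := eqVneq a 0 => D.
  exists 1, 0, (- c), (2 * b); split; [ring|ring|].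
  rewrite (_ : _ + _ = 2 * b ^+ 2); last by ring.
  by apply: contraNneq D => /eqP; rewrite mulf_eq0 (negPf char2) /= => /eqP b0;
    rewrite b0; apply/eqP; ring.
have [r r2] := sqrt_exists (b ^+ 2 - a * c).
exists (r - b), a, (- r - b), a; split.
- by ring: r2.
- by ring: r2.
rewrite (_ : _ + _ = 2 * a * (a * c - b ^+ 2) - a * (r ^+ 2 - (b ^+ 2 - a * c))); last by ring.
by rewrite r2 subrr mulr0 subr0 !mulf_neq0.
Qed.

Definition independent3 w1 w2 w3 : Prop := forall t1 t2 t3 : k,
  t1 * co w1 1 + t2 * co w2 1 + t3 * co w3 1 = 0 ->
  t1 * co w1 2 + t2 * co w2 2 + t3 * co w3 2 = 0 ->
  t1 * co w1 3 + t2 * co w2 3 + t3 * co w3 3 = 0 ->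
  [/\ t1 = 0, t2 = 0 & t3 = 0].

(** The new n_i is w_i + l_i n4 for i <= 3, the new n4 is a n4 + b n5 and the new n5 is e n5. Only
    the first three coordinates of the w_i are used. *)
Lemma fam1_change q p m q' p' m' w1 w2 w3 (l1 l2 l3 a b e : k) :
    independent3 w1 w2 w3 -> a != 0 -> e != 0 ->
    (forall i j, (0 < i <= j)%N -> (j <= 3)%N ->
       let w := nth 0 [:: w1; w2; w3] in let l := nth 0 [:: l1; l2; l3] in
       [/\ bil3 q (w i.-1) (w j.-1) = a * q' i j,
           bil3 p (w i.-1) (w j.-1) + l i.-1 * lin3 m (w j.-1) +
             l j.-1 * lin3 m (w i.-1) = b * q' i j + e * p' i j &
           a * lin3 m (w i.-1) = e * m' i]) ->
  gl_orbit (fam1 q' p' m') (fam1 q p m).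
Proof.
move=> wI a0 e0 H.
pose lift w l := vec (co w 1) (co w 2) (co w 3) l 0.
apply: (@table_orbit _ _ _ (lift w1 l1) (lift w2 l2) (lift w3 l3)
  (vec 0 0 0 a b) (vec 0 0 0 0 e)).
  move=> t1 t2 t3 t4 t5; rewrite /lift !vecE => /vec_eq0[E1 E2 E3 E4 E5].
  have [|||z1 z2 z3] := wI t1 t2 t3.
  - by rewrite -[RHS]E1; ring.
  - by rewrite -[RHS]E2; ring.
  - by rewrite -[RHS]E3; ring.
  subst t1 t2 t3; have z4 : t4 = 0.
    move: E4; rewrite !mul0r !add0r mulr0 addr0 => /eqP.
    by rewrite mulf_eq0 (negPf a0) orbF => /eqP.
  subst t4; split=> //.
  by move: E5; rewrite !mul0r !add0r => /eqP; rewrite mulf_eq0 (negPf e0) orbF => /eqP.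
have bilL t x y l l' : bil3 t (lift x l) (lift y l') = bil3 t x y.
  by rewrite /bil3 !co_vec.
have linL t x l : lin3 t (lift x l) = lin3 t x by rewrite /lin3 !co_vec.
have nthL i : (i < 3)%N ->
    nth 0 [:: lift w1 l1; lift w2 l2; lift w3 l3; vec 0 0 0 a b; vec 0 0 0 0 e] i =
    lift (nth 0 [:: w1; w2; w3] i) (nth 0 [:: l1; l2; l3] i).
  by case: i => [|[|[|]]].
move=> i j i0 ij j5; case: (leqP j 3) => [j3|].
  have [|E1 E2 _] := H i j _ j3; first by rewrite i0.
  rewrite !nthL ?(leq_trans _ j3) ?prednK ?(leq_trans i0 ij) //.
  rewrite -/(fam1 q p m) fam1_mul !bilL !linL !co_vec !combE E1 E2 !scale0r !add0r.
  by rewrite !nnE !vecE; congr vec; ring.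
move=> j3; rewrite /=; have [i3|i3] := leqP i 3.
  have [|_ _ E3] := H i i _ i3; first by rewrite i0 leqnn.
  rewrite nthL ?prednK // andbT.
  have -> : nth 0 [:: lift w1 l1; lift w2 l2; lift w3 l3; vec 0 0 0 a b; vec 0 0 0 0 e]
      j.-1 = if j == 4%N then vec 0 0 0 a b else vec 0 0 0 0 e.
    by case: j j3 j5 {ij} => [|[|[|[|[|[|//]]]]]].
  move: (nth 0 [:: w1; w2; w3] _) E3 (nth 0 [:: l1; l2; l3] _) => w E3 l.
  rewrite -/(fam1 q p m); case: eqP => _; rewrite amul_fam1.
    rewrite combE !vecE; congr vec; try ring.
    by transitivity (a * lin3 m w); [rewrite /lin3; ring|rewrite E3; ring].
  by rewrite comb0 -vec0; congr vec; ring.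
rewrite andbF comb0 -/(fam1 q p m).
case: i i0 ij i3 => [|[|[|[|[|[|i]]]]]] // _ ij _; last by have := leq_trans ij j5.
  by case: j j3 j5 {ij} => [|[|[|[|[|[|//]]]]]] //= _ _;
    rewrite amul_fam1 -vec0; congr vec; ring.
by case: j j3 j5 ij => [|[|[|[|[|[|//]]]]]] //= _ _ _;
    rewrite amul_fam1 -vec0; congr vec; ring.
Qed.

Lemma bil3Dl q x y z : bil3 q (x + y) z = bil3 q x z + bil3 q y z.
Proof. by rewrite /bil3 /co !mxE; ring. Qed.

Lemma bil3Zl q (t : k) x z : bil3 q (t *: x) z = t * bil3 q x z.
Proof. by rewrite /bil3 /co !mxE; ring. Qed.

Lemma bil3Dr q x y z : bil3 q z (x + y) = bil3 q z x + bil3 q z y.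
Proof. by rewrite bil3C bil3Dl !(bil3C _ z). Qed.

Lemma bil3Zr q (t : k) x z : bil3 q z (t *: x) = t * bil3 q z x.
Proof. by rewrite bil3C bil3Zl (bil3C _ z). Qed.

Lemma lin3D m x y : lin3 m (x + y) = lin3 m x + lin3 m y.
Proof. by rewrite /lin3 /co !mxE; ring. Qed.

Lemma lin3Z m (t : k) x : lin3 m (t *: x) = t * lin3 m x.
Proof. by rewrite /lin3 /co !mxE; ring. Qed.

Definition bil3E := (bil3Dl, bil3Dr, bil3Zl, bil3Zr, lin3D, lin3Z).

(** In a relation, [m] isolates the coefficient of [z], then [q] against [x] and [y] isolates the
    other two. *)
Lemma independent3_dual q m x y z :
    lin3 m x = 0 -> lin3 m y = 0 -> lin3 m z != 0 ->
    bil3 q x x = 0 -> bil3 q y y = 0 -> bil3 q x y != 0 ->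
  independent3 x y z.
Proof.
move=> mx my mz qx qy qxy t1 t2 t3 E1 E2 E3.
have Em : t1 * lin3 m x + t2 * lin3 m y + t3 * lin3 m z = 0.
  rewrite -[RHS](_ : (t1 * co x 1 + t2 * co y 1 + t3 * co z 1) * m 1%N +
    (t1 * co x 2 + t2 * co y 2 + t3 * co z 2) * m 2%N +
    (t1 * co x 3 + t2 * co y 3 + t3 * co z 3) * m 3%N = 0).
    by rewrite /lin3; ring.
  by rewrite E1 E2 E3; ring.
have t30 : t3 = 0.
  by move/eqP: Em; rewrite mx my !mulr0 !add0r mulf_eq0 (negPf mz) orbF => /eqP.
subst t3; have Eq w : t1 * bil3 q x w + t2 * bil3 q y w = 0.
  rewrite -[RHS](_ : (t1 * co x 1 + t2 * co y 1 + 0 * co z 1) * (co w 1 * q 1%N 1%N +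
      co w 2 * q 1%N 2%N + co w 3 * q 1%N 3%N) +
    (t1 * co x 2 + t2 * co y 2 + 0 * co z 2) * (co w 1 * q 1%N 2%N +
      co w 2 * q 2%N 2%N + co w 3 * q 2%N 3%N) +
    (t1 * co x 3 + t2 * co y 3 + 0 * co z 3) * (co w 1 * q 1%N 3%N +
      co w 2 * q 2%N 3%N + co w 3 * q 3%N 3%N) = 0).
    by rewrite /bil3; ring.
  by rewrite E1 E2 E3; ring.
have := Eq x; rewrite qx mulr0 add0r bil3C => /eqP.
rewrite mulf_eq0 (negPf qxy) orbF => /eqP ->.
have := Eq y; rewrite qy mulr0 addr0 => /eqP.
by rewrite mulf_eq0 (negPf qxy) orbF => /eqP ->.
Qed.

(** The new n1, n2 are isotropic for [q] and span the kernel of [m]; the new n3 is [q]-orthogonal to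
    them. Adding multiples of n4 to n1, n2, n3 removes the n5-parts of n1 n3, n2 n3, n3 n3, and n1
    n2 is taken as n4. *)
Lemma fam1_reduce q p m : nonvanishing (@P21_disc k 5) (fam1 q p m) ->
  exists g al be : k, gl_orbit
    (fam1 (fun i j => match i, j with 1, 2 => 1%R | 3, 3 => g | _, _ => 0%R end%N)
          (fun i j => match i, j with 1, 1 => al | 2, 2 => be | _, _ => 0%R end%N)
          (fun i => if i is 3 then 1 else 0)) (fam1 q p m).
Proof.
move=> [[u ph]] /=.
set x := u 0%N; set y := u 1%N; set z := u 2%N; set f := app (ph 0%N) (nn k 5).
have kE i : ker_vec (fam1 q p m) u ph i =
    (bil3 q z z * f) *: (lin3 m z *: u i + (- lin3 m (u i)) *: z).
  rewrite /ker_vec !fam1_mul2 !appZ -/f -/z scalerDr scaleNr scalerN !scalerA.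
  by congr (_ *: _ - _ *: _); ring.
set X := ker_vec (fam1 q p m) u ph 0%N; set Y := ker_vec (fam1 q p m) u ph 1%N.
have mX : lin3 m X = 0 by rewrite /X kE !bil3E; ring.
have mY : lin3 m Y = 0 by rewrite /Y kE !bil3E; ring.
rewrite /P21_disc -/X -/Y !fam1_mul2 !appZ -/f -/z => D.
clearbody X Y.
have mz : lin3 m z != 0 by apply: contraNneq D => ->; apply/eqP; ring.
have {D} : bil3 q X X * bil3 q Y Y - bil3 q X Y ^+ 2 != 0.
  apply: contraNneq D => D; rewrite (_ : _ - _ =
    (lin3 m z * f) ^+ 2 * (bil3 q X X * bil3 q Y Y - bil3 q X Y ^+ 2)); last by ring.
  by rewrite D mulr0.
move=> /null_basis[s1 [t1 [s2 [t2 [N1 N2 N12]]]]].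
set v := s1 *: X + t1 *: Y; set w := s2 *: X + t2 *: Y.
have qv : bil3 q v v = 0 by rewrite /v !bil3E (bil3C q Y X) -[RHS]N1; ring.
have qw : bil3 q w w = 0 by rewrite /w !bil3E (bil3C q Y X) -[RHS]N2; ring.
have [h hE] : exists h, h = bil3 q v w by exists (bil3 q v w).
have h0 : h != 0.
  rewrite hE /v /w !bil3E (bil3C q Y X).
  by apply: contraNneq N12 => <-; apply/eqP; ring.
have mv : lin3 m v = 0 by rewrite /v !bil3E mX mY; ring.
have mw : lin3 m w = 0 by rewrite /w !bil3E mX mY; ring.
clearbody v w.
set n := z + (- (bil3 q z w / h)) *: v + (- (bil3 q z v / h)) *: w.
have qvn : bil3 q v n = 0.
  by rewrite /n !bil3E (bil3C q v z) qv -hE; field.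
have qwn : bil3 q w n = 0.
  by rewrite /n !bil3E (bil3C q w z) (bil3C q w v) qw -hE; field.
have mn : lin3 m n != 0 by rewrite /n !bil3E mv mw !mulr0 !addr0.
clearbody n.
pose g := bil3 q n n / h; pose M := lin3 m n.
exists g, (bil3 p v v / (h * M)), (bil3 p w w / (h * M)).
apply: (@fam1_change _ _ _ _ _ _ v w n (- (bil3 p v n / M)) (- (bil3 p w n / M))
  ((bil3 p v w * g - bil3 p n n) / (2 * M)) h (bil3 p v w) (h * M)) => //.
- by apply: (independent3_dual mv mw mn qv qw); rewrite -hE.
- by rewrite mulf_neq0.
have C := bil3C.
move=> i j; case: j => [|[|[|[|//]]]]; case: i => [|[|[|[|//]]]] //= _ _;
  rewrite ?mv ?mw ?qv ?qw ?qvn ?qwn -?hE /g /M -?/M; split; try ring;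
  by field; rewrite ?h0 ?mn ?char2.
Qed.

Section Fam1Normal.
Variables g al be : k.
Let q i j : k := match i, j with 1, 2 => 1%R | 3, 3 => g | _, _ => 0%R end%N.
Let p i j : k := match i, j with 1, 1 => al | 2, 2 => be | _, _ => 0%R end%N.
Let m i : k := if i is 3%N then 1 else 0.

Lemma fam1_normal_gram : nonvanishing (@P21_gram k 5) (fam1 q p m) -> g != 0.
Proof.
move=> [[u ph]] /=; apply: contraNneq => g0.
rewrite /P21_gram !fam1_mul2 !appZ /bil3 /q g0; apply/eqP; ring.
Qed.

(** On the plane x3 = 0, x x is 2 x1 x2 n4 + (al x1^2 + be x2^2) n5. If al = 0 its coordinates share
    the factor x2, and if be = 0 the factor x1. *)
Lemma fam1_normal_res :
  nonvanishing (@P21_res k 5) (fam1 q p m) -> al != 0 /\ be != 0.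
Proof.
move=> [[u ph]] /= D.
have kE i : ker_vec (fam1 q p m) u ph i = (bil3 q (u 2%N) (u 2%N) *
    app (ph 0%N) (nn k 5)) *: (co (u 2%N) 3 *: u i + (- co (u i) 3) *: u 2%N).
  rewrite /ker_vec !fam1_mul2 !appZ scalerDr scaleNr scalerN !scalerA /lin3 /m.
  by congr (_ *: _ - _ *: _); ring.
have k3 i : co (ker_vec (fam1 q p m) u ph i) 3 = 0.
  by rewrite kE /co !mxE; ring.
move: D; rewrite /P21_res.
move: (ker_vec _ _ _ 0%N) (ker_vec _ _ _ 1%N) (k3 0%N) (k3 1%N) => x y x3 y3.
have mulE v w : co v 3 = 0 -> co w 3 = 0 -> amul (fam1 q p m) v w =
    (co v 1 * co w 2 + co v 2 * co w 1) *: nn k 4 +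
    (co v 1 * co w 1 * al + co v 2 * co w 2 * be) *: nn k 5.
  move=> v3 w3; rewrite fam1_mul /bil3 /lin3 v3 w3 /q /p /m.
  by congr (_ *: _ + _ *: _); ring.
rewrite !mulE // !appD !appZ => D; split; apply: contraNneq D => z0; apply/eqP.
  apply: (@res22_common _ (co x 2) (co y 2)
     (2 * co x 1 * app (ph 1%N) (nn k 4) + be * co x 2 * app (ph 1%N) (nn k 5))
     (2 * co y 1 * app (ph 1%N) (nn k 4) + be * co y 2 * app (ph 1%N) (nn k 5))
     (2 * co x 1 * app (ph 2%N) (nn k 4) + be * co x 2 * app (ph 2%N) (nn k 5))
     (2 * co y 1 * app (ph 2%N) (nn k 4) + be * co y 2 * app (ph 2%N) (nn k 5)));
  rewrite z0; ring.
apply: (@res22_common _ (co x 1) (co y 1)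
   (2 * co x 2 * app (ph 1%N) (nn k 4) + al * co x 1 * app (ph 1%N) (nn k 5))
   (2 * co y 2 * app (ph 1%N) (nn k 4) + al * co y 1 * app (ph 1%N) (nn k 5))
   (2 * co x 2 * app (ph 2%N) (nn k 4) + al * co x 1 * app (ph 2%N) (nn k 5))
   (2 * co y 2 * app (ph 2%N) (nn k 4) + al * co y 1 * app (ph 2%N) (nn k 5)));
rewrite z0; ring.
Qed.

Lemma fam1_normal_orbit : g != 0 -> al != 0 -> be != 0 ->
  gl_orbit (J21 k) (fam1 q p m).
Proof.
(* Scaling n1, n2, n3 by s1, s2, s3, the equations n1 n2 = n3 n3 and n3 n4 = n1 n1 = n2 n2 give s2 =
   s3^2 g / s1, s1^2 = s3^3 g / al and s3^2 = al be. *)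
move=> g0 al0 be0; have [s3 s3E] := sqrt_exists (al * be).
have s30 : s3 != 0.
  by apply: contraNneq al0 => s0; move/esym/eqP: s3E; rewrite s0 expr0n mulf_eq0 (negPf be0) orbF.
have [s1 s1E] := sqrt_exists (s3 ^+ 3 * g / al).
have s10 : s1 != 0.
  apply/eqP => s0; move/esym/eqP: s1E; rewrite s0 expr0n /=; apply/negP.
  by rewrite !mulf_neq0 ?expf_neq0 ?invr_neq0.
rewrite J21_fam1.
apply: (@fam1_change _ _ _ _ _ _ (vec s1 0 0 0 0) (vec 0 (s3 ^+ 2 * g / s1) 0 0 0)
  (vec 0 0 s3 0 0) 0 0 0 (s3 ^+ 2 * g) 0 (s3 ^+ 3 * g)).
- have I (t s : k) : s != 0 -> t * s = 0 -> t = 0.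
    by move=> s0 /eqP; rewrite mulf_eq0 (negPf s0) orbF => /eqP.
  move=> t1 t2 t3; rewrite !co_vec !mulr0 !addr0 !add0r => E1 E2 E3.
  split; [exact: I E1|apply: I E2|exact: I E3].
  by rewrite !mulf_neq0 ?expf_neq0 ?invr_neq0.
- by rewrite mulf_neq0 // expf_neq0.
- by rewrite mulf_neq0 // expf_neq0.
have s1E' : al * s1 ^+ 2 = s3 ^+ 3 * g by rewrite s1E; field.
have beE : be * (s3 ^+ 2 * g / s1) ^+ 2 = s3 ^+ 3 * g.
  have -> : be * (s3 ^+ 2 * g / s1) ^+ 2 = s3 ^+ 4 * g ^+ 2 * (al * be) / (al * s1 ^+ 2).
    by field; rewrite al0 s10.
  by rewrite s1E' -s3E; field; rewrite s30 g0.
move=> i j; case: j => [|[|[|[|//]]]]; case: i => [|[|[|[|//]]]] //= _ _;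
  rewrite /bil3 /lin3 !co_vec /q /p /m /sym_coef /=; split; try ring;
  first [by field; rewrite ?s10 | by rewrite -[RHS]addr0 -s1E'; ring |
         by rewrite -[RHS]addr0 -beE; ring].
Qed.

End Fam1Normal.

Lemma mulf_eq0l (t s : k) : s != 0 -> t * s = 0 -> t = 0.
Proof. by move=> s0 /eqP; rewrite mulf_eq0 (negPf s0) orbF => /eqP. Qed.

(* n2 becomes n2 - al n3 - be n4 *)
Lemma fam4_kill_12 (al be ga si ta : k) : exists si' ta',
  gl_orbit (fam4 0 0 ga si' ta') (fam4 al be ga si ta).
Proof.
exists (si - 2 * al * ta + al ^+ 2), (ta - al).
apply: (@table_orbit _ _ _ (vec 1 0 0 0 0) (vec 0 1 (- al) (- be) 0)
  (vec 0 0 1 0 0) (vec 0 0 0 1 0) (vec 0 0 0 0 1)).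
  move=> t1 t2 t3 t4 t5; rewrite !vecE => /vec_eq0[E1 E2 E3 E4 E5].
  have z1 : t1 = 0 by rewrite -[RHS]E1; ring.
  have z2 : t2 = 0 by rewrite -[RHS]E2; ring.
  subst; split=> //; [rewrite -[RHS]E3|rewrite -[RHS]E4|rewrite -[RHS]E5]; ring.
move=> i j i0 ij j5; rewrite -/(fam4 al be ga si ta).
case: j j5 ij => [|[|[|[|[|[|//]]]]]]; case: i i0 => [|[|[|[|[|[|//]]]]]] //= _ _ _;
  rewrite amul_fam4 ?comb0 -?vec0 ?nnE ?combE ?vecE; congr vec; ring.
Qed.

(* n1 becomes n1 + (ta / ga) n2, which makes the new n2 n3 zero *)
Lemma fam4_kill_23 (ga si ta : k) : ga != 0 -> exists si',
  gl_orbit (fam4 0 0 ga si' 0) (fam4 0 0 ga si ta).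
Proof.
move=> ga0; pose s := ta / ga; have sE : ta = s * ga by rewrite /s; field.
clearbody s; subst ta; exists (si - 3 * (s * ga) ^+ 2).
pose y := s * si - 2 * s * (s * ga) ^+ 2.
(* The n3-coordinate of the new n2 makes n2 n3 zero and cancels n4 in n1 n2; its n4-coordinate
   cancels n5 in n1 n2. *)
apply: (@table_orbit _ _ _ (vec 1 s 0 0 0)
  (vec 0 1 (- (s * ga)) (- (s * ga) ^+ 2 * s - y)
     (- (s * ga) * s ^+ 2 * si - y * (2 * s ^+ 2 * ga)))
  (vec 0 0 1 (s ^+ 2 * ga) (s ^+ 2 * si)) (vec 0 0 0 1 (2 * s ^+ 2 * ga))
  (vec 0 0 0 0 1)).
  move=> t1 t2 t3 t4 t5; rewrite !vecE => /vec_eq0[E1 E2 E3 E4 E5].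
  have z1 : t1 = 0 by rewrite -[RHS]E1; ring.
  subst; have z2 : t2 = 0 by rewrite -[RHS]E2; ring.
  subst; have z3 : t3 = 0 by rewrite -[RHS]E3; ring.
  subst; have z4 : t4 = 0 by rewrite -[RHS]E4; ring.
  by subst; split=> //; rewrite -[RHS]E5; ring.
move=> i j i0 ij j5; rewrite -/(fam4 0 0 ga si (s * ga)).
case: j j5 ij => [|[|[|[|[|[|//]]]]]]; case: i i0 => [|[|[|[|[|[|//]]]]]] //= _ _ _;
  rewrite amul_fam4 ?comb0 -?vec0 ?nnE ?combE ?vecE /y; congr vec; ring.
Qed.

(* n1 becomes n1 + t n3 with si = 3 ga t *)
Lemma fam4_J22 (ga si : k) : ga != 0 -> gl_orbit (J22 k) (fam4 0 0 ga si 0).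
Proof.
move=> ga0; pose t := si / (3 * ga).
have tE : si = 3 * ga * t by rewrite /t; field; rewrite ga0 char3.
clearbody t; subst si; have [rt rtE] := sqrt_exists ga.
have rt0 : rt != 0 by apply: contraNneq ga0 => r0; rewrite -rtE r0 expr0n.
subst ga; apply: (@table_orbit _ _ _ (vec 1 0 t 0 0) (vec 0 0 1 (2 * t) (t ^+ 2))
  (vec 0 rt^-1 0 0 0) (vec 0 0 0 1 (3 * t)) (vec 0 0 0 0 1)).
  move=> t1 t2 t3 t4 t5; rewrite !vecE => /vec_eq0[E1 E2 E3 E4 E5].
  have z1 : t1 = 0 by rewrite -[RHS]E1; ring.
  subst; have z3 : t3 = 0.
    by apply: (@mulf_eq0l _ rt^-1); rewrite ?invr_neq0 // -[RHS]E2; ring.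
  subst; have z2 : t2 = 0 by rewrite -[RHS]E3; ring.
  subst; have z4 : t4 = 0 by rewrite -[RHS]E4; ring.
  by subst; split=> //; rewrite -[RHS]E5; ring.
move=> i j i0 ij j5; rewrite -/(fam4 0 0 (rt ^+ 2) (3 * rt ^+ 2 * t) 0).
case: j j5 ij => [|[|[|[|[|[|//]]]]]]; case: i i0 => [|[|[|[|[|[|//]]]]]] //= _ _ _;
  rewrite amul_fam4 ?comb0 -?vec0 ?nnE ?combE ?vecE; congr vec;
  by [ring | field].
Qed.

Lemma fam4_normal (al be ga si ta : k) :
  nonvanishing (@P22 k 5) (fam4 al be ga si ta) ->
  gl_orbit (J22 k) (fam4 al be ga si ta).
Proof.
move=> [[u ph]] /=; rewrite fam4_P22 mulf_eq0 negb_or => /andP[ga0 _].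
have [si1 [ta1 o1]] := fam4_kill_12 al be ga si ta.
have [si2 o2] := fam4_kill_23 si1 ta1 ga0.
exact: orbit_trans (orbit_trans (fam4_J22 _ ga0) o2) o1.
Qed.

Lemma J22_fam4 : gl_orbit (J22 k) (fam4 0 0 1 0 0).
Proof. by apply: fam4_J22; rewrite oner_neq0. Qed.

Section Fam3Normal.
Variables be ga : k.
Let a i j : k := match i, j with 1, 2 => 1%R | _, _ => 0%R end%N.
Let b i j : k := match i, j with 2, 2 => ga | _, _ => 0%R end%N.
Let p i j : k := match i, j with 1, 1 => be | _, _ => 0%R end%N.
Let r i : k := if i is 1%N then 1 else 0.
Let s i : k := if i is 2%N then 1 else 0.

Definition fam3_normal := fam3 a b p r s.

(** The quadratic form is a multiple of X1 X2. The cubic is a multiple of be X1^3 modulo X2 and of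
    ga X2^3 modulo X1, so a zero parameter creates a common factor. *)
Lemma fam3_normal_res :
  nonvanishing (@P40' k 5) fam3_normal -> be != 0 /\ ga != 0.
Proof.
move=> [[u ph]] /= D.
have mE x y : amul fam3_normal x y =
    (co x 1 * co y 2 + co x 2 * co y 1) *: nn k 3 +
    (co x 2 * co y 2 * ga + co x 3 * co y 1 + co y 3 * co x 1) *: nn k 4 +
    (co x 1 * co y 1 * be + co x 3 * co y 2 + co y 3 * co x 2) *: nn k 5.
  rewrite /fam3_normal fam3_mul /bil2 /lin2 /a /b /p /r /s.
  by congr (_ *: _ + _ *: _ + _ *: _); ring.
have m2E x y z : amul fam3_normal (amul fam3_normal x y) z =
    (co x 1 * co y 2 + co x 2 * co y 1) *: (co z 1 *: nn k 4 + co z 2 *: nn k 5).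
  rewrite /fam3_normal fam3_mul2 /bil2 /lin2 /a /b /p /r /s.
  by congr (_ *: (_ *: _ + _ *: _)); ring.
move: D; rewrite /P40' /minor2 !m2E !mE !appD !appZ !appD !appZ.
set x := u 0%N; set y := u 1%N; set z := u 2%N.
set f3 := app (ph 0%N) (nn k 3); set f4 := app (ph 0%N) (nn k 4).
set f5 := app (ph 0%N) (nn k 5); set g3 := app (ph 1%N) (nn k 3).
set g4 := app (ph 1%N) (nn k 4); set g5 := app (ph 1%N) (nn k 5).
set h := co z 1 * app (ph 2%N) (nn k 4) + co z 2 * app (ph 2%N) (nn k 5).
pose B := co x 1 * co y 2 + co x 2 * co y 1; pose d := f4 * g5 - f5 * g4.
(* K = 2 X1 X2 L + B d (ga X2^3 - be X1^3), with L linear *)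
pose L v := B * (f3 * (g4 * co v 1 + g5 * co v 2) - g3 * (f4 * co v 1 + f5 * co v 2)).
move=> D; split; apply: contraNneq D => z0; apply/eqP.
  apply: (@res23_common _ (co x 2) (co y 2) (2 * co x 1 * h) (2 * co y 1 * h)
    (2 * co x 1 * L x + B * d * ga * co x 2 ^+ 2)
    (2 * co x 1 * L y + 2 * co y 1 * L x + 2 * B * d * ga * co x 2 * co y 2)
    (2 * co y 1 * L y + B * d * ga * co y 2 ^+ 2));
  rewrite /L /B /d /h ?z0; ring.
apply: (@res23_common _ (co x 1) (co y 1) (2 * co x 2 * h) (2 * co y 2 * h)
  (2 * co x 2 * L x - B * d * be * co x 1 ^+ 2)
  (2 * co x 2 * L y + 2 * co y 2 * L x - 2 * B * d * be * co x 1 * co y 1)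
  (2 * co y 2 * L y - B * d * be * co y 1 ^+ 2));
rewrite /L /B /d /h ?z0; ring.
Qed.

Lemma fam3_normal_orbit : be != 0 -> ga != 0 -> gl_orbit (J40 k) fam3_normal.
Proof.
(* Scaling n1 by t and n2 by e fixes the scales of n3, n4, n5; then n1 n1 = n5 and n2 n2 = n4
   require t be = e^2 and e ga = t^2, hence e^3 = ga be^2. *)
move=> be0 ga0; have [e eE] := cbrt_exists (ga * be ^+ 2).
have e0 : e != 0.
  by apply/eqP => e0; move/esym/eqP: eE; rewrite e0 expr0n; apply/negP;
    rewrite mulf_neq0 ?expf_neq0.
pose t := e ^+ 2 / be; have t0 : t != 0 by rewrite mulf_neq0 ?expf_neq0 ?invr_neq0.
have tE : t * be = e ^+ 2 by rewrite /t; field.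
have gaE : e * ga = t ^+ 2.
  have -> : t ^+ 2 = e * e ^+ 3 / be ^+ 2 by rewrite /t; field.
  by rewrite eE; field.
rewrite J40_fam3; apply: (@table_orbit _ _ _ (vec t 0 0 0 0) (vec 0 e 0 0 0)
  (vec 0 0 (t * e) 0 0) (vec 0 0 0 (t ^+ 2 * e) 0) (vec 0 0 0 0 (t * e ^+ 2))).
  have te0 : t * e != 0 by rewrite mulf_neq0.
  have t2e0 : t ^+ 2 * e != 0 by rewrite mulf_neq0 ?expf_neq0.
  have te20 : t * e ^+ 2 != 0 by rewrite mulf_neq0 ?expf_neq0.
  move=> t1 t2 t3 t4 t5; rewrite !vecE => /vec_eq0[E1 E2 E3 E4 E5].
  split; [apply: (mulf_eq0l t0); rewrite -[RHS]E1|
          apply: (mulf_eq0l e0); rewrite -[RHS]E2|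
          apply: (mulf_eq0l te0); rewrite -[RHS]E3|
          apply: (mulf_eq0l t2e0); rewrite -[RHS]E4|
          apply: (mulf_eq0l te20); rewrite -[RHS]E5]; ring.
move=> i j i0 ij j5; rewrite -/(fam3 a b p r s).
case: j j5 ij => [|[|[|[|[|[|//]]]]]]; case: i i0 => [|[|[|[|[|[|//]]]]]] //= _ _ _;
  rewrite amul_fam3 /a /b /p /r /s /sym_coef /= ?comb0 -?vec0 ?combE ?vecE;
  congr vec; first [ring | by transitivity (t * (t * be)); [ring|rewrite tE; ring]
    | by transitivity (e * (e * ga)); [ring|rewrite gaE; ring]].
Qed.

End Fam3Normal.

(** The new n1, n2 are isotropic for [a], and n3, n4, n5 are n1 n2, n1 n3, n2 n3. The multiples l1,
    l2 of n3 added to n1, n2 remove n4 from n1 n1 and n5 from n2 n2. *)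
Lemma fam3_reduce a b p r s : nonvanishing (@P40 k 5) (fam3 a b p r s) ->
  exists be ga, gl_orbit (fam3_normal be ga) (fam3 a b p r s).
Proof.
move=> [[u ph]] /=; rewrite fam3_P40 !mulf_eq0 !negb_or -!andbA => /and3P[D M0 _].
set M := r 1%N * s 2%N - r 2%N * s 1%N in M0.
have [s1 [t1 [s2 [t2 [N1 N2 N12]]]]] := null_basis D.
set h := (X in X != 0) in N12.
(* Gram identity: h^2 is the product of the two values of the form minus its discriminant times the
   square of this determinant. *)
have d0 : s1 * t2 - s2 * t1 != 0.
  apply/eqP => E; move/eqP: N12; apply.
  have : h ^+ 2 = 0; last by move/eqP; rewrite expf_eq0 => /eqP.
  rewrite -[RHS](_ : (a 1%N 1%N * s1 ^+ 2 + 2 * a 1%N 2%N * s1 * t1 + a 2%N 2%N * t1 ^+ 2) *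
     (a 1%N 1%N * s2 ^+ 2 + 2 * a 1%N 2%N * s2 * t2 + a 2%N 2%N * t2 ^+ 2) -
     (a 1%N 1%N * a 2%N 2%N - a 1%N 2%N ^+ 2) * (s1 * t2 - s2 * t1) ^+ 2 = 0).
    by rewrite /h; ring.
  by rewrite N1 E; ring.
pose r1 := s1 * r 1%N + t1 * r 2%N; pose r2 := s2 * r 1%N + t2 * r 2%N.
pose q1 := s1 * s 1%N + t1 * s 2%N; pose q2 := s2 * s 1%N + t2 * s 2%N.
have d'0 : r1 * q2 - r2 * q1 != 0.
  rewrite (_ : _ - _ = M * (s1 * t2 - s2 * t1)) ?mulf_neq0 //.
  by rewrite /r1 /q1 /r2 /q2 /M; ring.
(* b11, p11 are the components along n4, n5 of n1^2 for the new n1, and so on *)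
pose b11 := b 1%N 1%N * s1 ^+ 2 + 2 * b 1%N 2%N * s1 * t1 + b 2%N 2%N * t1 ^+ 2.
pose b22 := b 1%N 1%N * s2 ^+ 2 + 2 * b 1%N 2%N * s2 * t2 + b 2%N 2%N * t2 ^+ 2.
pose b12 := b 1%N 1%N * s1 * s2 + b 1%N 2%N * (s1 * t2 + s2 * t1) + b 2%N 2%N * t1 * t2.
pose p11 := p 1%N 1%N * s1 ^+ 2 + 2 * p 1%N 2%N * s1 * t1 + p 2%N 2%N * t1 ^+ 2.
pose p22 := p 1%N 1%N * s2 ^+ 2 + 2 * p 1%N 2%N * s2 * t2 + p 2%N 2%N * t2 ^+ 2.
pose p12 := p 1%N 1%N * s1 * s2 + p 1%N 2%N * (s1 * t2 + s2 * t1) + p 2%N 2%N * t1 * t2.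
pose D' := r1 * q2 - r2 * q1.
pose l1 := - (b11 * q2 - p11 * r2) / (2 * D').
pose l2 := - (p22 * r1 - b22 * q1) / (2 * D').
exists ((p11 * r1 - b11 * q1) / (h * D')), ((b22 * q2 - p22 * r2) / (h * D')).
apply: (@table_orbit _ _ _ (vec s1 t1 l1 0 0) (vec s2 t2 l2 0 0)
  (vec 0 0 h (b12 + l1 * r2 + l2 * r1) (p12 + l1 * q2 + l2 * q1))
  (vec 0 0 0 (h * r1) (h * q1)) (vec 0 0 0 (h * r2) (h * q2))).
  move=> x1 x2 x3 x4 x5; rewrite !vecE => /vec_eq0[E1 E2 E3 E4 E5].
  have z1 : x1 = 0.
    apply: (mulf_eq0l d0).
    transitivity (t2 * (x1 * s1 + x2 * s2 + x3 * 0 + x4 * 0 + x5 * 0) -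
      s2 * (x1 * t1 + x2 * t2 + x3 * 0 + x4 * 0 + x5 * 0)); first by ring.
    by rewrite E1 E2; ring.
  have z2 : x2 = 0.
    apply: (mulf_eq0l d0).
    transitivity (s1 * (x1 * t1 + x2 * t2 + x3 * 0 + x4 * 0 + x5 * 0) -
      t1 * (x1 * s1 + x2 * s2 + x3 * 0 + x4 * 0 + x5 * 0)); first by ring.
    by rewrite E1 E2; ring.
  subst x1 x2; have z3 : x3 = 0 by apply: (mulf_eq0l N12); rewrite -[RHS]E3; ring.
  have E4' : x4 * (h * r1) + x5 * (h * r2) = 0 by rewrite -[RHS]E4 z3; ring.
  have E5' : x4 * (h * q1) + x5 * (h * q2) = 0 by rewrite -[RHS]E5 z3; ring.
  split=> //; apply: (mulf_eq0l N12); apply: (mulf_eq0l d'0).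
    transitivity (q2 * (x4 * (h * r1) + x5 * (h * r2)) -
      r2 * (x4 * (h * q1) + x5 * (h * q2))); first by ring.
    by rewrite E4' E5'; ring.
  transitivity (r1 * (x4 * (h * q1) + x5 * (h * q2)) -
    q1 * (x4 * (h * r1) + x5 * (h * r2))); first by ring.
  by rewrite E4' E5'; ring.
move=> i j i0 ij j5; rewrite -/(fam3 a b p r s).
case: j j5 ij => [|[|[|[|[|[|//]]]]]]; case: i i0 => [|[|[|[|[|[|//]]]]]] //= _ _ _;
  rewrite amul_fam3 /= ?comb0 -?vec0 ?combE ?vecE; congr vec;
  try by rewrite /r1 /r2 /q1 /q2 /h; ring.
- by transitivity (0 : k); [rewrite -[RHS]N1; ring|ring].
- transitivity (b11 + 2 * l1 * r1); first by rewrite /b11 /r1; ring.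
  by rewrite /l1 /D'; field; rewrite N12 char2 d'0.
- transitivity (p11 + 2 * l1 * q1); first by rewrite /p11 /q1; ring.
  by rewrite /l1 /D'; field; rewrite N12 char2 d'0.
- by rewrite /b12 /r1 /r2; ring.
- by rewrite /p12 /q1 /q2; ring.
- by transitivity (0 : k); [rewrite -[RHS]N2; ring|ring].
- transitivity (b22 + 2 * l2 * r2); first by rewrite /b22 /r2; ring.
  by rewrite /l2 /D'; field; rewrite N12 char2 d'0.
- transitivity (p22 + 2 * l2 * q2); first by rewrite /p22 /q2; ring.
  by rewrite /l2 /D'; field; rewrite N12 char2 d'0.
Qed.

Lemma J22_P22 : nonvanishing (@P22 k 5) (J22 k).
Proof.
apply: (nonvanishing_orbit (@P22_covariant k 5) (orbit_sym J22_fam4)).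
exists (fun i => nn k i.+1, fun=> dual k 5) => /=.
rewrite fam4_P22 /om !nnE !co_vec !dual_vec; apply/eqP => /eqP.
by rewrite !(mul1r, mulr1, mul0r, mulr0, subr0, expr1n) oner_eq0.
Qed.

Lemma J40_P40 : nonvanishing (@P40 k 5) (J40 k).
Proof.
exists (fun i => nn k i.+1, fun i => dual k i.+4) => /=.
rewrite J40_fam3 fam3_P40 /om !nnE !co_vec !dual_vec /sym_coef /=.
rewrite (_ : _ * _ = -1) ?oppr_eq0 ?oner_eq0 //; ring.
Qed.

Lemma J40_P40' : nonvanishing (@P40' k 5) (J40 k).
Proof.
exists (fun i => if i is 1 then nn k 2 else nn k 1,
        fun i => if i is 1 then dual k 5 else dual k 4) => /=.
rewrite J40_fam3 /P40' /minor2 /= !nnE !amul_fam3 !dual_vec /sym_coef /res23 /=.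
rewrite (_ : _ + _ = 2 ^+ 3) ?expf_neq0 //; ring.
Qed.

Lemma J21_P21 : nonvanishing (@P21 k 5) (J21 k).
Proof.
exists (fun i => nn k i.+1, fun i => dual k 5) => /=.
rewrite J21_fam1 /P21 !fam1_associator !appZ /bil3 /lin3 !nnE !co_vec !dual_vec.
rewrite /sym_coef /= (_ : _ - _ = -1) ?oppr_eq0 ?oner_eq0 //; ring.
Qed.

Lemma J21_P21_gram : nonvanishing (@P21_gram k 5) (J21 k).
Proof.
exists (fun i => if i is 3 then nn k 3 else nn k i.+1, fun i => dual k 5) => /=.
rewrite J21_fam1 /P21_gram !fam1_mul2 !appZ /bil3 /lin3 !nnE !co_vec !dual_vec.
rewrite /sym_coef /= (_ : _ + _ = -1) ?oppr_eq0 ?oner_eq0 //; ring.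
Qed.

Lemma J21_P21_disc : nonvanishing (@P21_disc k 5) (J21 k).
Proof.
exists (fun i => nn k i.+1, fun i => dual k 5) => /=.
rewrite J21_fam1 /P21_disc /ker_vec !fam1_mul2 !appZ /bil3 /lin3 !nnE !co_vec !dual_vec.
rewrite !vecE !co_vec.
rewrite /sym_coef /= (_ : _ - _ = -1) ?oppr_eq0 ?oner_eq0 //; ring.
Qed.

Lemma J21_P21_res : nonvanishing (@P21_res k 5) (J21 k).
Proof.
exists (fun i => nn k i.+1, fun i => if i is 1 then dual k 4 else dual k 5) => /=.
rewrite J21_fam1 /P21_res /ker_vec !fam1_mul2 !appZ /bil3 /lin3 !nnE !co_vec !dual_vec.
rewrite !vecE !amul_fam1 !dual_vec /res22.
rewrite /sym_coef /= (_ : _ - _ = 2 ^+ 2) ?expf_neq0 //; ring.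
Qed.

(** At n1, n2 the resultant of [J27 e f] is e f (e f - 1); the parameters 1, -1 give 2. *)
Lemma J27_P27 : nonvanishing (@P27 k 5) (J27 1 (-1)).
Proof.
exists (fun i => nn k i.+1, fun i => dual k 5) => /=.
rewrite J27_fam2 /P27 !fam2_mul2 !appZ /bil2 /lin2 !nnE !co_vec !dual_vec /res22.
rewrite /sym_coef /= (_ : _ - _ = 2) ?char2 //; ring.
Qed.

Lemma J27_P_assoc : nonvanishing (@P_assoc k 5) (J27 1 (-1)).
Proof.
exists (fun i => if i is 0 then nn k 1 else nn k 2, fun i => dual k 5) => /=.
rewrite J27_fam2 /P_assoc fam2_associator !appZ /om /bil2 !nnE !co_vec !dual_vec.
rewrite /sym_coef /= (_ : _ * _ = -1) ?oppr_eq0 ?oner_eq0 //; ring.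
Qed.

End NormalForms.

Lemma vec_co x : x = vec (co x 1) (co x 2) (co x 3) (co x 4) (co x 5).
Proof. by have [a1 [a2 [a3 [a4 [a5 ->]]]]] := vecP x; rewrite !co_vec. Qed.

(** Multiplication by [x] shifts the powers, so applying it repeatedly to a linear relation isolates
    the coefficients in turn. The remaining products are the Jordan power identities. *)
Lemma orbit_eps1 c : JorN k 5 c -> nonvanishing (@P_eps1 k 5) c ->
  gl_orbit (eps1 k) c.
Proof.
move=> [cJ cN] [[u ph]]; rewrite /P_eps1 /=; set x := u 0%N => P.
pose m := amul c; pose x2 := m x x; pose x3 := m x x2; pose x4 := m x x3.
pose x5 := m x x4; have x50 : x5 != 0.
  by apply: contraNneq P; rewrite -/m -/x2 -/x3 -/x4 -/x5 => ->; rewrite app0.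
have mC y z : m y z = m z y by apply: cJ.1.
(* [x5] is a product of five factors, so it is in [rpower c 4], and one more factor gives zero. *)
have x5m y : m x5 y = 0.
  apply/eqP; rewrite -memv0 -(nilpotentP cJ.1).1 //; apply: mem_rpower.
  rewrite /x5 mC; apply: mem_rpower; rewrite /x4 mC; apply: mem_rpower.
  by rewrite /x3 mC; do 2!apply: mem_rpower; apply: memvf.
have mx5 : m x x5 = 0 by rewrite mC x5m.
have m0 y : m y 0 = 0 by apply: amul0r.
have mD a1 a2 a3 a4 a5 : m x (a1 *: x + a2 *: x2 + a3 *: x3 + a4 *: x4 + a5 *: x5) =
    a1 *: x2 + a2 *: x3 + a3 *: x4 + a4 *: x5.
  by rewrite /m !amulDr !amulZr -/m mx5 scaler0 addr0.
apply: (@orbit_table _ _ _ x x2 x3 x4 x5); first exact: cJ.1.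
  have shift a1 a2 a3 a4 a5 : a1 *: x + a2 *: x2 + a3 *: x3 + a4 *: x4 + a5 *: x5 = 0 ->
      0 *: x + a1 *: x2 + a2 *: x3 + a3 *: x4 + a4 *: x5 = 0.
    by move=> /(congr1 (m x)); rewrite mD m0 scale0r add0r.
  have last a : 0 *: x + 0 *: x2 + 0 *: x3 + 0 *: x4 + a *: x5 = 0 -> a = 0.
    by rewrite !scale0r !add0r => /eqP; rewrite scaler_eq0 (negPf x50) orbF => /eqP.
  move=> a1 a2 a3 a4 a5 E.
  have z1 := last _ (shift _ _ _ _ _ (shift _ _ _ _ _ (shift _ _ _ _ _ (shift _ _ _ _ _ E)))).
  subst a1; have z2 := last _ (shift _ _ _ _ _ (shift _ _ _ _ _ (shift _ _ _ _ _ E))).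
  subst a2; have z3 := last _ (shift _ _ _ _ _ (shift _ _ _ _ _ E)).
  subst a3; have z4 := last _ (shift _ _ _ _ _ E).
  by subst a4; split=> //; apply: last.
have x60 : m x (m x x4) = 0 by [].
have P22 : m x2 x2 = x4 by apply: jordan_x2x2.
have P23 : m x2 x3 = x5 by apply: jordan_x2x3.
have P24 : m x2 x4 = 0 by rewrite -mx5; apply: jordan_x2x4.
have P33 : m x3 x3 = 0 by rewrite -mx5; apply: jordan_x3x3.
have P34 : m x3 x4 = 0 by rewrite -[RHS](m0 x) -mx5; apply: jordan_x3x4.
have P44 : m x4 x4 = 0 by apply: jordan_x4x4.
move=> i j i0 ij j5; rewrite -/m.
by case: j j5 ij => [|[|[|[|[|[|//]]]]]]; case: i i0 => [|[|[|[|[|[|//]]]]]] //= _ _ _;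
  rewrite ?nnE ?comb0 ?combE ?scale0r ?scale1r ?add0r ?addr0 ?(mC _ x5) ?x5m.
Qed.

(* If J = <x> + J^2, then the powers of x span J, since J^2 = J J. *)
Lemma rpower1_dim c : JorN k 5 c -> ~ nonvanishing (@P_eps1 k 5) c ->
  (\dim (rpower c 1) <= 3)%N.
Proof.
move=> [cJ cN] P; rewrite leqNgt; apply/negP => d1.
have [x xR1] : exists x, x \notin rpower c 1.
  apply: contrapT => /forallNP H.
  have : (fullv <= rpower c 1)%VS.
    by apply/subvP => x _; apply: contrapT => /negP /H.
  move/dimvS; rewrite leqNgt rpower_lt_dim // -dimv_eq0.
  by rewrite dimvf.
pose m := amul c; pose x2 := m x x; pose x3 := m x x2; pose x4 := m x x3.
have x50 : m x x4 = 0.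
  apply: app_inj => f; rewrite app0; apply: contrapT => /eqP E.
  by apply: P; exists (fun=> x, fun=> f).
have mC y z : m y z = m z y by apply: cJ.1.
have m0 y : m y 0 = 0 by apply: amul0r.
pose S := <<[:: x; x2; x3; x4]>>%VS.
have P22 : m x2 x2 = x4 by apply: jordan_x2x2.
have P23 : m x2 x3 = 0 by rewrite -x50; apply: jordan_x2x3.
have P24 : m x2 x4 = 0 by rewrite -[RHS](m0 x) -x50; apply: jordan_x2x4.
have P33 : m x3 x3 = 0 by rewrite -[RHS](m0 x) -x50; apply: jordan_x3x3.
have P34 : m x3 x4 = 0.
  by rewrite -[RHS](m0 x) -[X in m x X](m0 x) -x50; apply: jordan_x3x4.
have P44 : m x4 x4 = 0.
  by apply: jordan_x4x4 => //; rewrite -/m -/x2 -/x3 -/x4 x50.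
have memS y : y \in [:: x; x2; x3; x4] -> y \in S by apply: memv_span.
have SS y z : y \in S -> z \in S -> m y z \in S.
  move=> /coord_span -> /coord_span ->; rewrite /m amul_suml.
  apply: memv_suml => i _; rewrite amul_sumr; apply: memv_suml => j _.
  rewrite amulZl amulZr; do 2!apply: memvZ.
  case: i => [[|[|[|[|//]]]] ?]; case: j => [[|[|[|[|//]]]] ?] /=; rewrite -/m;
  rewrite ?(mC _ x) ?(mC x3 x2) ?(mC x4 x2) ?(mC x4 x3) ?x50 ?P22 ?P23 ?P24 ?P33 ?P34 ?P44;
  rewrite ?mem0v //; apply: memS; by rewrite !inE eqxx ?orbT.
have d5 : \dim {:'cV[k]_5} = 5%N by rewrite dimvf.
have J1 : (fullv <= <[x]> + rpower c 1)%VS.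
  have sR : (rpower c 1 <= <[x]> + rpower c 1)%VS by apply: addvSr.
  suff : (\dim {:'cV[k]_5} <= \dim (<[x]> + rpower c 1))%N.
    by move=> le5; have/eqP <- : ((<[x]> + rpower c 1)%VS == fullv) by rewrite eqEdim subvf.
  rewrite d5 leqNgt; apply: contra xR1 => lt5.
  have /eqP -> : (rpower c 1 == <[x]> + rpower c 1)%VS.
    by rewrite eqEdim sR (leq_trans _ d1).
  by apply: (subvP (addvSl _ _)); apply: memv_line.
(* [S] is a subalgebra, so expanding a product of two elements of S + R leaves, outside [S], only
   terms one step deeper in the chain. *)
have span i : (fullv <= S + rpower c i.+1)%VS.
  elim: i => [|i IHi].
    apply: subv_trans J1 _; rewrite addvS ?subvv //.
    by rewrite -memvE memS // inE eqxx.
  apply: subv_trans J1 _; rewrite subv_add -memvE.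
  rewrite (subvP (addvSl _ _)) ?memS ?inE ?eqxx //=.
  apply: vmul_sub => y z _ _.
  have /memv_addP[s sS [r rR ->]] := subvP IHi y (memvf y).
  have /memv_addP[s' s'S [r' r'R ->]] := subvP IHi z (memvf z).
  rewrite amulDl !amulDr -addrA; apply: memv_add; first exact: SS.
  apply: memvD; first by rewrite cJ.1; apply: (@mem_rpower _ _ _ i.+1).
  by apply: memvD; apply: (@mem_rpower _ _ _ i.+1).
have : (\dim {:'cV[k]_5} <= \dim S)%N.
  by apply: dimvS; have := span 4; rewrite (nilpotentP cJ.1).1 // addv0.
by rewrite d5 leqNgt ltnS dim_span.
Qed.

Let P c i j := amul c (nn k i) (nn k j).

(** * From adapted flags to the four families *)

Section Coordinates.
Implicit Types (q p a b e : nat -> nat -> k) (m mu r s : nat -> k).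
Implicit Types (u : nat -> 'cV[k]_5) (ph : nat -> 'rV[k]_5).

Lemma structure_table c : commutative_structure c ->
  c = of_table (fun i j => amul c (nn k i) (nn k j)).
Proof.
move=> cC; apply/ffunP => -[[i j] l]; rewrite ffunE /=.
have E (o : 'I_5) : nn k o.+1 = delta_mx o 0.
  by apply/colP => s; rewrite !mxE eqxx andbT eqSS.
case: (leqP i j) => _; rewrite !E ?(cC (delta_mx j 0)) amul_delta //.
Qed.

(** Used contrapositively: a functional nonzero on a right power is nonzero on some product, so
    certain structure constants cannot all vanish. *)
Lemma rpower_functional c (f : 'cV[k]_5 -> k) i :
    (forall t x y, f (t *: x + y) = t * f x + f y) ->
    (forall x y, x \in rpower c i -> f (amul c x y) = 0) ->
  forall z, z \in rpower c i.+1 -> f z = 0.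
Proof.
move=> lf H; pose fl := GRing.isLinear.Build _ _ _ _ (f : 'cV[k]_5 -> k^o) lf.
pose fL : {linear 'cV[k]_5 -> k^o} := HB.pack (f : 'cV[k]_5 -> k^o) fl.
have sub : (rpower c i.+1 <= lker (linfun fL))%VS.
  by apply: vmul_sub => x y xR _; rewrite memv_ker lfunE /= H.
by move=> z /(subvP sub); rewrite memv_ker lfunE /= => /eqP.
Qed.

Lemma co_linear l (t : k) x y : co (t *: x + y) l = t * co x l + co y l.
Proof. by rewrite /co !mxE. Qed.

Lemma coD l x y : co (x + y) l = co x l + co y l.
Proof. by rewrite /co mxE. Qed.

Lemma co_nn l i : (0 < l <= 5)%N -> co (nn k i) l = (l == i)%:R.
Proof. by case: l => // l l5; rewrite /co mxE inordK. Qed.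

(** [D i] is the dimension of R_(i+1). It is a parameter because it is computed on the original
    structure, while the flag is that of a transported one. *)
Definition adapted (D : nat -> nat) c : Prop :=
  [/\ JorN k 5 c, D 0%N = 5%N,
      forall i, (D i.+1 <= (D i).-1)%N &
      forall i x, (i <= 5)%N -> (x \in rpower c i) =
        [forall l : 'I_5, (l < 5 - D i)%N ==> (x l 0 == 0)]].

Lemma exists_adapted c : JorN k 5 c ->
  exists2 d, gl_orbit c d & adapted (fun i => \dim (rpower c i)) d.
Proof.
move=> cJ; have [d cd dR] := adapted_structure c; exists d => //.
split=> //; [exact: JorN_orbit cd cJ|by rewrite /= dimvf| ].
move=> i; have [R0|R0] := eqVneq (rpower c i) 0%VS.
  by have := dimvS (rpower_sub c i); rewrite R0 dimv0.
by rewrite -ltnS (leq_trans _ (leqSpred _)) // rpower_lt_dim //; case: cJ.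
Qed.

Section Adapted.
Variables (D : nat -> nat) (c : structures k 5).
Hypothesis cD : adapted D c.

Let cC : commutative_structure c. Proof. by case: cD => -[[]]. Qed.
Let cJ : jordan c. Proof. by case: cD => -[]. Qed.

Lemma adapted_co i l x : (i <= 5)%N -> (0 < l <= 5 - D i)%N ->
  x \in rpower c i -> co x l = 0.
Proof.
case: cD => _ _ _ H i5; case: l => // l /= lD; rewrite H // => /forallP.
have l5 : (l < 5)%N by rewrite (leq_trans lD) // leq_subr.
move=> /(_ (inord l)) /implyP; rewrite inordK // => /(_ lD) /eqP.
by rewrite /co.
Qed.

Lemma adapted_nn i l : (i <= 5)%N -> (5 - D i < l)%N -> nn k l \in rpower c i.
Proof.
case: cD => _ _ _ H i5 lD; rewrite H //; apply/forallP => s; apply/implyP => sD.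
rewrite mxE [_ == l](_ : _ = false) //; apply/negP => /eqP E.
by move: lD; rewrite -E ltnS leqNgt sD.
Qed.

Lemma adapted_mul_co i l x y : (i < 5)%N -> (0 < l <= 5 - D i.+1)%N ->
  x \in rpower c i -> co (amul c x y) l = 0.
Proof. by move=> i5 lD xR; apply: (@adapted_co i.+1) => //; apply: mem_rpower. Qed.

Lemma adapted_functional i l (f : 'cV[k]_5 -> k) : (i < 5)%N -> (5 - D i.+1 < l)%N ->
    (forall t x y, f (t *: x + y) = t * f x + f y) ->
    (forall x y, x \in rpower c i -> f (amul c x y) = 0) ->
  f (nn k l) = 0.
Proof. by move=> i5 lD lf /(rpower_functional lf); apply; apply: adapted_nn. Qed.

Lemma adapted_zero i x : (i <= 5)%N -> D i = 0%N -> x \in rpower c i -> x = 0.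
Proof.
move=> i5 Di xR; rewrite [x]vec_co -vec0.
by congr vec; apply: (@adapted_co i) xR; rewrite ?Di.
Qed.

(* If J^4 = 0 then (x x)(y x) = 0. *)
Lemma square_zero l : D 3%N = 0%N -> (0 < l <= 5)%N -> (5 - D 1 < l)%N ->
    exists2 x, co (amul c x x) l != 0 & amul c (amul c x x) (amul c x x) = 0.
Proof.
move=> D3 l5 lD.
(* Otherwise, by polarization, coordinate [l] would vanish on all products, whereas n_l lies in
   R_2. *)
have [x xl] : exists x, co (amul c x x) l != 0.
  apply: contrapT => /forallNP H.
  have Q x : co (amul c x x) l = 0.
    by have /negP := H x; rewrite negbK => /eqP.
  have := @adapted_functional 0 l (fun z => co z l) isT lD (co_linear l).
  rewrite co_nn // eqxx => E; have /eqP := oner_neq0 k; apply; apply: E => x y _.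
  apply: (mulfI char2); rewrite mulr0.
  have := Q (x + y); rewrite !(amulDl, amulDr) (cC y x).
  by rewrite !coD !Q => <-; ring.
exists x => //.
rewrite -[X in amul c _ X = _]/(amul c x x) -cJ.2; apply: (@adapted_zero 3) => //.
by do 3!apply: mem_rpower; apply: memvf.
Qed.

End Adapted.

Lemma amul_nn_sym c (f : nat -> nat -> 'cV[k]_5) : commutative_structure c ->
    (forall i j, (0 < i <= j)%N -> (j <= 5)%N -> amul c (nn k i) (nn k j) = f i j) ->
  c = of_table f.
Proof.
move=> cC E; rewrite (structure_table cC); apply: table_ext => i j i0 ij j5.
by rewrite E // i0.
Qed.

Lemma vec_split x (a1 a2 a3 a4 a5 : k) :
    co x 1 = a1 -> co x 2 = a2 -> co x 3 = a3 -> co x 4 = a4 -> co x 5 = a5 ->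
  x = vec a1 a2 a3 a4 a5.
Proof. by move=> <- <- <- <- <-; apply: vec_co. Qed.

(** The flag gives every vanishing except n4 n4 = 0. For that, (x x)(x x) = 0 for some x x with
    nonzero n4-coordinate, and n5 annihilates the algebra. The same argument gives n3 n3 = 0 in
    [adapted_fam3]. *)
Lemma adapted_fam1 D c : adapted D c -> D 1%N = 2%N ->
  exists q p m, c = fam1 q p m.
Proof.
move=> cD D1; have cC : commutative_structure c by case: (cD) => -[[]].
have [_ _ Dlt _] := cD.
have D2 : (D 2 <= 1)%N by have := Dlt 1%N; rewrite D1.
have D3 : D 3%N = 0%N.
  by apply/eqP; rewrite -leqn0; apply: leq_trans (Dlt 2%N) _; case: (D 2%N) D2 => [|[]].
have R4 : nn k 4 \in rpower c 1 by apply: (adapted_nn cD); rewrite ?D1.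
have c0 i j l : (0 < l <= 3)%N -> co (P c i j) l = 0.
  by move=> l3; apply: (@adapted_mul_co _ _ cD 0) (memvf _); rewrite ?D1.
have c4 i : co (P c i 4) 4 = 0.
  rewrite /P cC; apply: (@adapted_mul_co _ _ cD 1) R4 => //.
  by lia.
have c5 i : P c i 5 = 0.
  rewrite /P cC; have [D20|D20] := posnP (D 2%N).
    apply: (adapted_zero cD _ D20) => //; apply: mem_rpower.
    by apply: (adapted_nn cD); rewrite ?D1.
  apply: (adapted_zero cD _ D3) => //; apply: mem_rpower.
  by apply: (adapted_nn cD) => //; lia.
have c44 : P c 4 4 = 0.
  have [||x q0 xx0] := @square_zero _ _ cD 4 D3; rewrite ?D1 //.
  have E : amul c x x = co (amul c x x) 4 *: nn k 4 + co (amul c x x) 5 *: nn k 5.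
    rewrite [LHS]vec_co !nnE !vecE; congr vec; rewrite ?mulr0 ?mulr1 ?addr0 ?add0r //;
      by apply: (@adapted_mul_co _ _ cD 0) (memvf _); rewrite ?D1.
  move: xx0; rewrite {1 2}E amulDl !amulDr !amulZl !amulZr (cC (nn k 5)) -!/(P c _ _) !c5.
  rewrite !scaler0 !addr0 scalerA => /eqP; rewrite scaler_eq0 mulf_eq0.
  by rewrite (negPf q0) => /eqP.
exists (fun i j => co (P c i j) 4), (fun i j => co (P c i j) 5), (fun i => co (P c i 4) 5).
apply: amul_nn_sym => // i j /andP[i0 ij] j5; rewrite -/(P c i j).
case: leqP => [j3|j3]; first by apply: vec_split => //; apply: c0.
have [j4|j4] := eqVneq j 4%N; last first.
  suff -> : j = 5%N by rewrite c5.
  lia.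
subst j.
case: leqP => i3 /=; first by apply: vec_split => //; apply: c0.
suff -> : i = 4%N by rewrite c44.
lia.
Qed.

Lemma adapted_fam3 D c : adapted D c -> D 1%N = 3%N -> D 2%N = 2%N -> D 3%N = 0%N ->
  exists a b p r s, c = fam3 a b p r s.
Proof.
move=> cD D1 D2 D3; have cC : commutative_structure c by case: (cD) => -[[]].
have R l : (2 < l)%N -> nn k l \in rpower c 1.
  by move=> l3; apply: (adapted_nn cD); rewrite ?D1.
have c0 i j l : (0 < l <= 2)%N -> co (P c i j) l = 0.
  by move=> l3; apply: (@adapted_mul_co _ _ cD 0) (memvf _); rewrite ?D1.
have c3 i l : (0 < l <= 3)%N -> co (P c i 3) l = 0.
  move=> l3; rewrite /P cC; apply: (@adapted_mul_co _ _ cD 1) (R _ _) => //.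
  by rewrite D2.
have c45 i l : (3 < l)%N -> P c i l = 0.
  move=> l3; rewrite /P cC; apply: (adapted_zero cD _ D3) => //; apply: mem_rpower.
  by apply: (adapted_nn cD); rewrite ?D2.
have c33 : P c 3 3 = 0.
  have [||x q0 xx0] := @square_zero _ _ cD 3 D3; rewrite ?D1 //.
  have E : amul c x x = co (amul c x x) 3 *: nn k 3 + co (amul c x x) 4 *: nn k 4
      + co (amul c x x) 5 *: nn k 5.
    rewrite [LHS]vec_co !nnE !vecE.
    congr vec; rewrite ?mulr0 ?mulr1 ?addr0 ?add0r //;
      by apply: (@adapted_mul_co _ _ cD 0) (memvf _); rewrite ?D1.
  move: xx0; rewrite {1 2}E !amulDl !amulDr !amulZl !amulZr.
  rewrite (cC (nn k 4) (nn k 3)) (cC (nn k 5) (nn k 3)) -!/(P c _ _).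
  rewrite !(c45 _ 4%N isT) !(c45 _ 5%N isT).
  rewrite !scaler0 !addr0 scalerA => /eqP; rewrite scaler_eq0 mulf_eq0.
  by rewrite (negPf q0) => /eqP.
exists (fun i j => co (P c i j) 3), (fun i j => co (P c i j) 4), (fun i j => co (P c i j) 5).
exists (fun i => co (P c i 3) 4), (fun i => co (P c i 3) 5).
apply: amul_nn_sym => // i j /andP[i0 ij] j5; rewrite -/(P c i j).
case: leqP => [j2|j2]; first by apply: vec_split => //; apply: c0.
have [j3|j3] := eqVneq j 3%N; last by rewrite c45 //; lia.
subst j; case: leqP => i2 /=; first by apply: vec_split => //; apply: c3.
suff -> : i = 3%N by rewrite c33.
lia.
Qed.

(* The shape given by a flag with dim R_2 = 3 and R_3 = <n5>; the Jordan identity then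
   gives e = 0, that is, fam2. *)
Definition famX a b p m r e : structures k 5 := of_table (fun i j =>
  if (j <= 2)%N then vec 0 0 (a i j) (b i j) (p i j)
  else if j == 5%N then 0
  else if (i <= 2)%N then vec 0 0 0 0 (if j == 3%N then m i else r i)
  else vec 0 0 0 0 (e i j)).

Lemma amul_famX a b p m r e (x1 x2 x3 x4 x5 y1 y2 y3 y4 y5 : k) :
  amul (famX a b p m r e) (vec x1 x2 x3 x4 x5) (vec y1 y2 y3 y4 y5) =
  vec 0 0
    (x1 * y1 * a 1%N 1%N + (x1 * y2 + x2 * y1) * a 1%N 2%N + x2 * y2 * a 2%N 2%N)
    (x1 * y1 * b 1%N 1%N + (x1 * y2 + x2 * y1) * b 1%N 2%N + x2 * y2 * b 2%N 2%N)
    (x1 * y1 * p 1%N 1%N + (x1 * y2 + x2 * y1) * p 1%N 2%N + x2 * y2 * p 2%N 2%N +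
     (x1 * y3 + x3 * y1) * m 1%N + (x2 * y3 + x3 * y2) * m 2%N +
     (x1 * y4 + x4 * y1) * r 1%N + (x2 * y4 + x4 * y2) * r 2%N +
     x3 * y3 * e 3%N 3%N + (x3 * y4 + x4 * y3) * e 3%N 4%N + x4 * y4 * e 4%N 4%N).
Proof. by rewrite amul_table /= -vec0 !vecE; congr vec; ring. Qed.

(** [e] is a symmetric form on <n3, n4> and [B] its value on pairs of products of n1, n2. As ((x x)
    y) x = 0 here, the Jordan identity says e(x x, y x) = 0; the hypothesis [sp] says that the
    products span <n3, n4> modulo n5. *)
Lemma famX_jordan a b p m r e : jordan (famX a b p m r e) ->
    (forall al be : k, (forall i j, (0 < i <= j)%N -> (j <= 2)%N ->
       al * a i j + be * b i j = 0) -> al = 0 /\ be = 0) ->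
  [/\ e 3%N 3%N = 0, e 3%N 4%N = 0 & e 4%N 4%N = 0].
Proof.
move=> cJ sp.
pose B i1 i2 j1 j2 : k := a i1 i2 * a j1 j2 * e 3%N 3%N +
  (a i1 i2 * b j1 j2 + b i1 i2 * a j1 j2) * e 3%N 4%N + b i1 i2 * b j1 j2 * e 4%N 4%N.
have Buu : B 1%N 1%N 1%N 1%N = 0.
  have := cJ.2 (nn k 1) (nn k 1); rewrite !nnE !amul_famX => /vec_inj[_ _ _ _ E].
  by rewrite /B; subtract E.
have Buv : B 1%N 1%N 1%N 2%N = 0.
  have := cJ.2 (nn k 1) (nn k 2); rewrite !nnE !amul_famX => /vec_inj[_ _ _ _ E].
  by rewrite /B; subtract E.
have Bww : B 2%N 2%N 2%N 2%N = 0.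
  have := cJ.2 (nn k 2) (nn k 2); rewrite !nnE !amul_famX => /vec_inj[_ _ _ _ E].
  by rewrite /B; subtract E.
have Bvw : B 1%N 2%N 2%N 2%N = 0.
  have := cJ.2 (nn k 2) (nn k 1); rewrite !nnE !amul_famX => /vec_inj[_ _ _ _ E].
  by rewrite /B; subtract E.
have Buw : B 1%N 1%N 2%N 2%N = - 2 * B 1%N 2%N 1%N 2%N.
  have := jordan_linearize char2 (nn k 1) (nn k 2) (nn k 2) cJ.
  rewrite !nnE !amul_famX !vecE => /vec_inj[_ _ _ _ E].
  apply/eqP; rewrite -subr_eq0; apply/eqP.
  by rewrite /B; subtract E.
have Bvv : B 1%N 2%N 1%N 2%N = 0.
  (* The 3 by 3 Gram determinant of n1 n1, n1 n2, n2 n2, whose images modulo n5 lie in a plane, is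
     zero; the relations found so far reduce it to -4 times this cube. *)
  apply/eqP; have : 4 * B 1%N 2%N 1%N 2%N ^+ 3 = 0.
    transitivity (B 1%N 1%N 2%N 2%N ^+ 2 * B 1%N 2%N 1%N 2%N); first by rewrite Buw; ring.
    transitivity (B 1%N 1%N 1%N 1%N *
        (B 1%N 2%N 1%N 2%N * B 2%N 2%N 2%N 2%N - B 1%N 2%N 2%N 2%N ^+ 2)
      - B 1%N 1%N 1%N 2%N *
        (B 1%N 1%N 1%N 2%N * B 2%N 2%N 2%N 2%N - 2 * B 1%N 2%N 2%N 2%N * B 1%N 1%N 2%N 2%N));
      last by rewrite Buu Buv; ring.
    rewrite /B; ring.
  have -> : (4 : k) = 2 * 2 by ring.
  by move/eqP; rewrite !mulf_eq0 !(negPf char2) /= !orbb.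
have B0 i j i' j' : (0 < i <= j)%N -> (j <= 2)%N -> (0 < i' <= j')%N -> (j' <= 2)%N ->
    B i j i' j' = 0.
  have BC i1 i2 j1 j2 : B i1 i2 j1 j2 = B j1 j2 i1 i2 by rewrite /B; ring.
  have Buw0 : B 1%N 1%N 2%N 2%N = 0 by rewrite Buw Bvv mulr0.
  case: i j i' j' => [|[|[|i]]] [|[|[|j]]] [|[|[|i']]] [|[|[|j']]] //= _ _ _ _;
  by rewrite // BC.
have e3 i j : (0 < i <= j)%N -> (j <= 2)%N ->
    a i j * e 3%N 3%N + b i j * e 3%N 4%N = 0 /\
    a i j * e 3%N 4%N + b i j * e 4%N 4%N = 0.
  move=> ij j2; apply: sp => i' j' ij' j'2; rewrite -[RHS](B0 i j i' j') //.
  rewrite /B; ring.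
have [|e33 e34] := sp (e 3%N 3%N) (e 3%N 4%N).
  by move=> i j ij j2; rewrite -[RHS](e3 i j ij j2).1; ring.
have [|_ e44] := sp (e 3%N 4%N) (e 4%N 4%N).
  by move=> i j ij j2; rewrite -[RHS](e3 i j ij j2).2; ring.
by [].
Qed.

Lemma adapted_fam2 D c : adapted D c -> D 1%N = 3%N -> (D 2%N <= 1)%N ->
  exists a b p m r, c = fam2 a b p m r.
Proof.
move=> cD D1 D2; have cC : commutative_structure c by case: (cD) => -[[]].
have [[cJ _] _ Dlt _] := cD.
have D3 : D 3%N = 0%N by have := Dlt 2%N; lia.
have R l : (2 < l)%N -> nn k l \in rpower c 1.
  by move=> l3; apply: (adapted_nn cD); rewrite ?D1.
have c0 i j l : (0 < l <= 2)%N -> co (P c i j) l = 0.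
  by move=> l3; apply: (@adapted_mul_co _ _ cD 0) (memvf _); rewrite ?D1.
have c34 i j l : (2 < j)%N -> (0 < l <= 4)%N -> co (P c i j) l = 0.
  move=> j2 l3; rewrite /P cC; apply: (@adapted_mul_co _ _ cD 1) (R _ _) => //.
  by lia.
have c5 i : P c i 5 = 0.
  rewrite /P cC; have [D20|D20] := posnP (D 2%N).
    by apply: (adapted_zero cD _ D20) => //; apply: mem_rpower; apply: R.
  apply: (adapted_zero cD _ D3) => //; apply: mem_rpower.
  by apply: (adapted_nn cD) => //; lia.
pose a i j := co (P c i j) 3; pose b i j := co (P c i j) 4.
pose p i j := co (P c i j) 5.
have cX : c = famX a b p (fun i => p i 3%N) (fun i => p i 4%N) p.
  apply: amul_nn_sym => // i j /andP[i0 ij] j5; rewrite -/(P c i j).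
  case: leqP => [j2|j2]; first by apply: vec_split => //; apply: c0.
  have [->|j5'] := eqVneq j 5%N; first by rewrite c5.
  case: leqP => i2; apply: vec_split; try by [|apply: c34].
  by case: eqP => [->|j3] //; congr (co (P c _ _) _); lia.
have [||e33 e34 e44] := @famX_jordan a b p (fun i => p i 3%N) (fun i => p i 4%N) p.
- by rewrite -cX.
- move=> al be E.
  have F t x y : al * co (t *: x + y) 3 + be * co (t *: x + y) 4 =
      t * (al * co x 3 + be * co x 4) + (al * co y 3 + be * co y 4).
    by rewrite !co_linear; ring.
  have N l : (2 < l)%N -> al * co (nn k l) 3 + be * co (nn k l) 4 = 0.
    move=> l2; apply: (@adapted_functional _ _ cD 0 l
      (fun z => al * co z 3 + be * co z 4)) => //; rewrite ?D1 // => x y _.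
    rewrite cX; vecs; rewrite amul_famX !co_vec.
    have E11 := E 1%N 1%N isT isT; have E12 := E 1%N 2%N isT isT.
    have E22 := E 2%N 2%N isT isT.
    transitivity (x0 * y0 * (al * a 1%N 1%N + be * b 1%N 1%N) +
      (x0 * y1 + x1 * y0) * (al * a 1%N 2%N + be * b 1%N 2%N) +
      x1 * y1 * (al * a 2%N 2%N + be * b 2%N 2%N)); first by ring.
    by rewrite E11 E12 E22; ring.
  have := N 3%N isT; have := N 4%N isT; rewrite !co_nn //=.
  by rewrite !mulr0 !mulr1 add0r addr0.
exists a, b, p, (fun i => p i 3%N), (fun i => p i 4%N).
rewrite {1}cX; apply: table_ext => i j i0 ij j5; case: leqP => // j2.
have [->|j5'] := eqVneq j 5%N; first by rewrite /= .
case: leqP => i2; first by case: eqP => [->|j3] //=; rewrite (_ : j = 4%N) //; lia.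
rewrite !andbF; have [i3|i4] : i = 3%N \/ i = 4%N by lia.
  have [j3|j4] : j = 3%N \/ j = 4%N by lia.
    by rewrite i3 j3 e33 vec0.
  by rewrite i3 j4 e34 vec0.
have j4 : j = 4%N by lia.
by rewrite i4 j4 e44 vec0.
Qed.

(* The shape given by a flag with dim R_2 = 3 and R_3 = <n4, n5>, before the Jordan
   identity is used. *)
Definition famG a b p m mu r (k4 k5 dl ze : k) : structures k 5 := of_table (fun i j =>
  if (j <= 2)%N then vec 0 0 (a i j) (b i j) (p i j)
  else if j == 5%N then 0
  else if (i <= 2)%N then if j == 3%N then vec 0 0 0 (m i) (mu i) else vec 0 0 0 0 (r i)
  else if j == 3%N then vec 0 0 0 k4 k5
  else vec 0 0 0 0 (if i == 3%N then dl else ze)).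

Lemma amul_famG a b p m mu r k4 k5 dl ze (x1 x2 x3 x4 x5 y1 y2 y3 y4 y5 : k) :
  amul (famG a b p m mu r k4 k5 dl ze) (vec x1 x2 x3 x4 x5) (vec y1 y2 y3 y4 y5) =
  vec 0 0
    (x1 * y1 * a 1%N 1%N + (x1 * y2 + x2 * y1) * a 1%N 2%N + x2 * y2 * a 2%N 2%N)
    (x1 * y1 * b 1%N 1%N + (x1 * y2 + x2 * y1) * b 1%N 2%N + x2 * y2 * b 2%N 2%N +
     (x1 * y3 + x3 * y1) * m 1%N + (x2 * y3 + x3 * y2) * m 2%N + x3 * y3 * k4)
    (x1 * y1 * p 1%N 1%N + (x1 * y2 + x2 * y1) * p 1%N 2%N + x2 * y2 * p 2%N 2%N +
     (x1 * y3 + x3 * y1) * mu 1%N + (x2 * y3 + x3 * y2) * mu 2%N +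
     (x1 * y4 + x4 * y1) * r 1%N + (x2 * y4 + x4 * y2) * r 2%N +
     x3 * y3 * k5 + (x3 * y4 + x4 * y3) * dl + x4 * y4 * ze).
Proof. by rewrite amul_table /= -vec0 !vecE; congr vec; ring. Qed.

(** If the product of the two forms vanished everywhere, its values at (1, 0), (0, 1), (1, 1), (1,
    -1) would give the four coefficients of the zero cubic. *)
Lemma quad_lin_neq0 (a1 a2 a3 m1 m2 : k) :
    ~ [/\ a1 = 0, a2 = 0 & a3 = 0] -> ~ (m1 = 0 /\ m2 = 0) ->
  exists x1 x2 : k, a1 * x1 ^+ 2 + 2 * a2 * x1 * x2 + a3 * x2 ^+ 2 != 0 /\
    m1 * x1 + m2 * x2 != 0.
Proof.
move=> a0 m0; apply: contrapT => H.
have {}H (x1 x2 : k) : (a1 * x1 ^+ 2 + 2 * a2 * x1 * x2 + a3 * x2 ^+ 2) *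
    (m1 * x1 + m2 * x2) = 0.
  apply/eqP; rewrite mulf_eq0; apply: contraT; rewrite negb_or => /andP[].
  by move=> q0 l0; case: H; exists x1, x2.
have E1 : a1 * m1 = 0 by rewrite -[RHS](H 1 0); ring.
have E2 : a3 * m2 = 0 by rewrite -[RHS](H 0 1); ring.
have {}H := (H 1 1, H 1 (-1)).
have E3 : 2 * (a1 * m2 + 2 * a2 * m1) = 0.
  rewrite -[RHS](_ : 0 - 0 - 2 * 0 = 0); last by ring.
  by rewrite -{1}H.1 -{1}H.2 -E2; ring.
have E4 : 2 * (2 * a2 * m2 + a3 * m1) = 0.
  rewrite -[RHS](_ : 0 + 0 - 2 * 0 = 0); last by ring.
  by rewrite -{1}H.1 -{1}H.2 -E1; ring.
have Z (t s : k) : t != 0 -> t * s = 0 -> s = 0.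
  by move=> t0 /eqP; rewrite mulf_eq0 (negPf t0) => /eqP.
have {}E3 := Z _ _ char2 E3; have {}E4 := Z _ _ char2 E4.
have [m10|m10] := eqVneq m1 0.
  have [m20|m20] := eqVneq m2 0; first by case: m0.
  case: a0; split; apply: (Z _ _ m20).
  - by move: E3; rewrite m10 mulr0 addr0 mulrC.
  - by apply: (Z _ _ char2); rewrite -[RHS]E4 m10; ring.
  - by rewrite mulrC.
have a10 : a1 = 0 by apply: (Z _ _ m10); rewrite mulrC.
have a20 : a2 = 0.
  by apply: (Z _ _ m10); apply: (Z _ _ char2); rewrite -[RHS]E3 a10; ring.
by case: a0; split=> //; apply: (Z _ _ m10); rewrite -[RHS]E4 a20; ring.
Qed.

(** For [x] in <n1, n2>, [Q], [M], [R] are the coefficients of n3 in x x, of n4 in x n3 and of n5 in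
    x n4. The Jordan identity kills [k4], [ze], [dl] and then reads Q(x) (B(x, y) k5 - M(y) R(x)) =
    0, with [B] the polar form of [Q]. Hence the vector orthogonal to one where [Q] and [R] are
    nonzero is killed by [M], [Q] and [R]: these two vectors are the new n2 and n1. *)
Lemma famG_fam4 a b p m mu r k4 k5 dl ze :
    jordan (famG a b p m mu r k4 k5 dl ze) ->
    ~ [/\ a 1%N 1%N = 0, a 1%N 2%N = 0 & a 2%N 2%N = 0] ->
    (k4 = 0 -> ~ (m 1%N = 0 /\ m 2%N = 0)) ->
    (dl = 0 -> ze = 0 -> ~ (r 1%N = 0 /\ r 2%N = 0)) ->
  exists al be ga si ta, gl_orbit (fam4 al be ga si ta)
    (famG a b p m mu r k4 k5 dl ze).
Proof.
move=> cJ a0 m0 r0.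
have Z (t s : k) : t != 0 -> t * s = 0 -> s = 0.
  by move=> t0 /eqP; rewrite mulf_eq0 (negPf t0) => /eqP.
pose Q (x1 x2 : k) := a 1%N 1%N * x1 ^+ 2 + 2 * a 1%N 2%N * x1 * x2 + a 2%N 2%N * x2 ^+ 2.
pose M (x1 x2 : k) := m 1%N * x1 + m 2%N * x2.
pose R (x1 x2 : k) := r 1%N * x1 + r 2%N * x2.
have k40 : k4 = 0.
  have [x1 [x2 [Q0 _]]] : exists x1 x2 : k, Q x1 x2 != 0 /\ 1 * x1 + 0 * x2 != 0.
    by apply: quad_lin_neq0 => // -[/eqP]; rewrite oner_eq0.
  apply: (Z _ _ Q0); apply: (Z _ _ Q0).
  have := cJ.2 (vec x1 x2 0 0 0) (vec x1 x2 0 0 0).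
  rewrite !amul_famG => /vec_inj[_ _ _ E _].
  by rewrite /Q; subtract E.
move: (m0 k40) => {}m0; subst k4.
have [x1 [x2 [Q0 M0]]] : exists x1 x2 : k, Q x1 x2 != 0 /\ M x1 x2 != 0.
  exact: quad_lin_neq0.
have ze0 : ze = 0.
  apply: (Z _ _ char2); apply: (Z _ _ M0); apply: (Z _ _ M0).
  have := jordan_linearize char2 (vec x1 x2 0 0 0) (nn k 3) (nn k 3) cJ.
  rewrite !nnE !amul_famG !vecE => /vec_inj[_ _ _ _ E].
  by rewrite /M; subtract E.
subst ze; have dl0 : dl = 0.
  apply: (Z _ _ char2); apply: (Z _ _ M0); apply: (Z _ _ Q0).
  have := jordan_linearize char2 (vec x1 x2 0 0 0) (vec x1 x2 0 0 0) (nn k 3) cJ.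
  rewrite !nnE !amul_famG !vecE => /vec_inj[_ _ _ _ E].
  by rewrite /M /Q; subtract E.
move: (r0 dl0 erefl) => {}r0; subst dl; clear x1 x2 Q0 M0.
have [s [t [A0 R0]]] : exists s t : k, Q s t != 0 /\ R s t != 0 by exact: quad_lin_neq0.
pose B (x1 x2 y1 y2 : k) := a 1%N 1%N * x1 * y1 + a 1%N 2%N * (x1 * y2 + x2 * y1) +
  a 2%N 2%N * x2 * y2.
have K (x1 x2 y1 y2 : k) : Q x1 x2 * (B x1 x2 y1 y2 * k5 - M y1 y2 * R x1 x2) = 0.
  have := cJ.2 (vec x1 x2 0 0 0) (vec y1 y2 0 0 0).
  rewrite !amul_famG => /vec_inj[_ _ _ _ E].
  by rewrite /M /Q /R /B; subtract E.
have [A AE] : exists A : k, A = Q s t by exists (Q s t).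
have [rh rhE] : exists rh : k, rh = R s t by exists (R s t).
have [M1 M1E] : exists M1 : k, M1 = M s t by exists (M s t).
rewrite -AE in A0; rewrite -rhE in R0.
have Kst (y1 y2 : k) : B s t y1 y2 * k5 = M y1 y2 * rh.
  apply/eqP; rewrite -subr_eq0; apply/eqP/(Z _ _ A0).
  by rewrite rhE AE K.
have Ak5 : A * k5 = M1 * rh.
  by rewrite M1E -Kst AE /B /Q; ring.
have k50 : k5 != 0.
  apply/eqP => k50; case: m0; split; apply: (Z _ _ R0).
    by transitivity (M 1 0 * rh); [rewrite /M; ring|rewrite -Kst k50 mulr0].
  by transitivity (M 0 1 * rh); [rewrite /M; ring|rewrite -Kst k50 mulr0].
have M10 : M1 != 0.
  by apply: contraNneq A0 => M10; apply/eqP/(Z _ _ k50); rewrite mulrC Ak5 M10 mul0r.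
(* (s', t') is orthogonal to (s, t) for the quadratic form *)
have [s' s'E] : exists s' : k, s' = - (a 1%N 2%N * s + a 2%N 2%N * t) by eexists.
have [t' t'E] : exists t' : k, t' = a 1%N 1%N * s + a 1%N 2%N * t by eexists.
have det : s * t' - t * s' = A by rewrite s'E t'E AE /Q; ring.
have Bst : B s t s' t' = 0 by rewrite s'E t'E /B; ring.
have Mst' : M s' t' = 0.
  by apply: (Z _ _ R0); rewrite mulrC -Kst Bst mul0r.
(* On the line through (s, t) directed by (s', t') the identity [K] becomes (A + x^2 Q') x Q' k5 =
   0, with Q' = Q s' t'. Comparing x = 1 and x = 2 leaves 3 Q'^2 = 0. *)
have Qst' : Q s' t' = 0.
  have F (x : k) : (A + x ^+ 2 * Q s' t') * (x * Q s' t' * k5) = 0.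
    transitivity (Q (s + x * s') (t + x * t') * (B (s + x * s') (t + x * t') s' t' * k5
      - M s' t' * R (s + x * s') (t + x * t'))); last exact: K.
    rewrite Mst' AE; move: Bst; rewrite /Q /B => Bst.
    have -> : a 1%N 1%N * (s + x * s') ^+ 2 + 2 * a 1%N 2%N * (s + x * s') * (t + x * t')
       + a 2%N 2%N * (t + x * t') ^+ 2 = Q s t + x ^+ 2 * Q s' t' + 2 * x * B s t s' t'.
      by rewrite /Q /B; ring.
    have -> : a 1%N 1%N * (s + x * s') * s' + a 1%N 2%N * ((s + x * s') * t' + (t + x * t') * s')
       + a 2%N 2%N * (t + x * t') * t' = B s t s' t' + x * Q s' t'.
      by rewrite /Q /B; ring.
    by rewrite /B Bst /Q; ring.
  have {}F (x : k) : x != 0 -> (A + x ^+ 2 * Q s' t') * Q s' t' = 0.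
    by move=> x0; apply: (Z _ _ x0); apply: (Z _ _ k50); rewrite -[RHS](F x); ring.
  have F1 := F 1 (oner_neq0 k); have F2 := F 2 char2.
  have : 3 * Q s' t' ^+ 2 = 0.
    transitivity ((A + 2 ^+ 2 * Q s' t') * Q s' t' - (A + 1 ^+ 2 * Q s' t') * Q s' t').
      by ring.
    by rewrite F1 F2 subrr.
  by move/(Z _ _ char3)/eqP; rewrite expf_eq0 => /eqP.
have Rst' : R s' t' = 0.
  have F : A * (A * k5 - M1 * (rh + R s' t')) = 0.
    transitivity (Q (s + s') (t + t') * (B (s + s') (t + t') s t * k5
      - M s t * R (s + s') (t + t'))); last exact: K.
    have -> : Q (s + s') (t + t') = Q s t + 2 * B s t s' t' + Q s' t'.
      by rewrite /Q /B; ring.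
    have -> : B (s + s') (t + t') s t = Q s t + B s t s' t'.
      by rewrite /Q /B; ring.
    by rewrite Bst Qst' M1E rhE AE /R; ring.
  apply: (Z _ _ M10); have := Z _ _ A0 F; rewrite Ak5 => {}F.
  by subtract F.
clear K Kst k50 m0 r0 a0.
(* The new n3, n4, n5 are n1 n1, n1 n3, n1 n4. The names below are old n4- and n5-coordinates: P4,
   P5 of n1 n1, D5 of n1 n3, m23 of n2 n3, and b12, p12, b22, p22 of n1 n2 and n2 n2. *)
pose P4 := b 1%N 1%N * s ^+ 2 + 2 * b 1%N 2%N * s * t + b 2%N 2%N * t ^+ 2.
pose P5 := p 1%N 1%N * s ^+ 2 + 2 * p 1%N 2%N * s * t + p 2%N 2%N * t ^+ 2.
pose D5 := (mu 1%N * s + mu 2%N * t) * A + rh * P4.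
pose b12 := b 1%N 1%N * s * s' + b 1%N 2%N * (s * t' + t * s') + b 2%N 2%N * t * t'.
pose p12 := p 1%N 1%N * s * s' + p 1%N 2%N * (s * t' + t * s') + p 2%N 2%N * t * t'.
pose b22 := b 1%N 1%N * s' ^+ 2 + 2 * b 1%N 2%N * s' * t' + b 2%N 2%N * t' ^+ 2.
pose p22 := p 1%N 1%N * s' ^+ 2 + 2 * p 1%N 2%N * s' * t' + p 2%N 2%N * t' ^+ 2.
pose m23 := (mu 1%N * s' + mu 2%N * t') * A.
exists (b12 / (M1 * A)), ((p12 - b12 / (M1 * A) * D5) / (rh * M1 * A)).
exists (b22 / (M1 * A)), ((p22 - b22 / (M1 * A) * D5) / (rh * M1 * A)).
exists (m23 / (rh * M1 * A)).
apply: (@table_orbit _ _ _ (vec s t 0 0 0) (vec s' t' 0 0 0) (vec 0 0 A P4 P5)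
  (vec 0 0 0 (M1 * A) D5) (vec 0 0 0 0 (rh * M1 * A))).
  move=> x1 x2 x3 x4 x5; rewrite !vecE => /vec_eq0[E1 E2 E3 E4 E5].
  have z1 : x1 = 0.
    apply: (Z _ _ A0); rewrite -det.
    transitivity (t' * (x1 * s + x2 * s' + x3 * 0 + x4 * 0 + x5 * 0) -
      s' * (x1 * t + x2 * t' + x3 * 0 + x4 * 0 + x5 * 0)); first by ring.
    by rewrite E1 E2; ring.
  have z2 : x2 = 0.
    apply: (Z _ _ A0); rewrite -det.
    transitivity (s * (x1 * t + x2 * t' + x3 * 0 + x4 * 0 + x5 * 0) -
      t * (x1 * s + x2 * s' + x3 * 0 + x4 * 0 + x5 * 0)); first by ring.
    by rewrite E1 E2; ring.
  subst x1 x2; have z3 : x3 = 0 by apply: (Z _ _ A0); rewrite -[RHS]E3; ring.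
  subst x3; have z4 : x4 = 0.
    by apply: (Z _ _ A0); apply: (Z _ _ M10); rewrite -[RHS]E4; ring.
  subst x4; split=> //.
  by apply: (Z _ _ A0); apply: (Z _ _ M10); apply: (Z _ _ R0); rewrite -[RHS]E5; ring.
move=> i j i0 ij j5; rewrite -/(famG a b p m mu r 0 k5 0 0).
case: j j5 ij => [|[|[|[|[|[|//]]]]]]; case: i i0 => [|[|[|[|[|[|//]]]]]] //= _ _ _;
  rewrite amul_famG ?comb0 -?vec0 ?nnE ?combE ?vecE; congr vec; try ring.
all: first
  [ by rewrite AE /Q; ring | by rewrite /P4; ring | by rewrite /P5; ring
  | by rewrite M1E /M; ring | by rewrite /D5 rhE /R; ring
  | by transitivity (B s t s' t'); [rewrite /B; ring|rewrite Bst; ring]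
  | by transitivity (Q s' t'); [rewrite /Q; ring|rewrite Qst'; ring]
  | by transitivity (A * M s' t'); [rewrite /M; ring|rewrite Mst'; ring]
  | by transitivity (R s' t' * (M1 * A)); [rewrite /R; ring|rewrite Rst'; ring]
  | by transitivity (A * (A * k5)); [ring|rewrite Ak5; ring]
  | by transitivity (m23 + R s' t' * P4);
      [rewrite /m23 /R; ring|rewrite Rst'; field; rewrite ?A0 ?M10 ?R0]
  | by transitivity b12; [rewrite /b12; ring|field; rewrite ?A0 ?M10 ?R0]
  | by transitivity p12; [rewrite /p12; ring|field; rewrite ?A0 ?M10 ?R0]
  | by transitivity b22; [rewrite /b22; ring|field; rewrite ?A0 ?M10 ?R0]
  | by transitivity p22; [rewrite /p22; ring|field; rewrite ?A0 ?M10 ?R0]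
  ].
Qed.

(** The three non-degeneracy hypotheses of [famG_fam4] express that n3, n4, n5 lie in R_2, R_3,
    R_4. *)
Lemma adapted_fam4 D c : adapted D c -> D 1%N = 3%N -> D 2%N = 2%N -> D 3%N = 1%N ->
  exists al be ga si ta, gl_orbit (fam4 al be ga si ta) c.
Proof.
move=> cD D1 D2 D3; have cC : commutative_structure c by case: (cD) => -[[]].
have [[cJ _] _ Dlt _] := cD.
have D4 : D 4%N = 0%N by have := Dlt 3%N; lia.
have R1 l : (2 < l)%N -> nn k l \in rpower c 1.
  by move=> l3; apply: (adapted_nn cD); rewrite ?D1.
have R2 l : (3 < l)%N -> nn k l \in rpower c 2.
  by move=> l3; apply: (adapted_nn cD); rewrite ?D2.
have c0 i j l : (0 < l <= 2)%N -> co (P c i j) l = 0.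
  by move=> l3; apply: (@adapted_mul_co _ _ cD 0) (memvf _); rewrite ?D1.
have c3 i j l : (2 < j)%N -> (0 < l <= 3)%N -> co (P c i j) l = 0.
  move=> j2 l3; rewrite /P cC; apply: (@adapted_mul_co _ _ cD 1) (R1 _ _) => //.
  by lia.
have c4 i j l : (3 < j)%N -> (0 < l <= 4)%N -> co (P c i j) l = 0.
  move=> j2 l3; rewrite /P cC; apply: (@adapted_mul_co _ _ cD 2) (R2 _ _) => //.
  by lia.
have c5 i : P c i 5 = 0.
  rewrite /P cC; apply: (adapted_zero cD _ D4) => //; apply: mem_rpower.
  by apply: (adapted_nn cD) => //; lia.
pose a i j := co (P c i j) 3; pose b i j := co (P c i j) 4.
pose p i j := co (P c i j) 5.
have cG : c = famG a b p (fun i => b i 3%N) (fun i => p i 3%N) (fun i => p i 4%N)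
    (b 3%N 3%N) (p 3%N 3%N) (p 3%N 4%N) (p 4%N 4%N).
  apply: amul_nn_sym => // i j /andP[i0 ij] j5; rewrite -/(P c i j).
  case: leqP => [j2|j2]; first by apply: vec_split => //; apply: c0.
  have [->|j5'] := eqVneq j 5%N; first by rewrite c5.
  have [j3|j3] := eqVneq j 3%N.
    subst j; case: leqP => i2; first by apply: vec_split => //; apply: c3.
    by have -> : i = 3%N by [lia|]; apply: vec_split => //; apply: c3.
  have j4 : j = 4%N by lia.
  subst j; case: leqP => i2; first by apply: vec_split => //; apply: c4.
  have [->|i3] := eqVneq i 3%N; first by apply: vec_split => //; apply: c4.
  by have -> : i = 4%N by [lia|]; apply: vec_split => //; apply: c4.
rewrite cG; apply: famG_fam4; first by rewrite -cG.
- move=> [a1 a2 a3].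
  have := @adapted_functional _ _ cD 0 3 (fun z => co z 3) isT.
  rewrite D1 co_nn //= => H; have /eqP := oner_neq0 k; apply; apply: H => //.
    exact: co_linear.
  move=> x y _; rewrite cG; vecs; rewrite amul_famG co_vec a1 a2 a3; ring.
- move=> b33 [m1 m2].
  have := @adapted_functional _ _ cD 1 4 (fun z => co z 4) isT.
  rewrite D2 co_nn //= => H; have /eqP := oner_neq0 k; apply; apply: H => //.
    exact: co_linear.
  move=> x y xR.
  have x1 : co x 1 = 0 by apply: (@adapted_co _ _ cD 1) xR; rewrite ?D1.
  have x2 : co x 2 = 0 by apply: (@adapted_co _ _ cD 1) xR; rewrite ?D1.
  rewrite (vec_co x) (vec_co y) cG amul_famG co_vec x1 x2 b33 m1 m2; ring.
move=> b34 b44 [r1 r2].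
have := @adapted_functional _ _ cD 2 5 (fun z => co z 5) isT.
rewrite D3 co_nn //= => H; have /eqP := oner_neq0 k; apply; apply: H => //.
  exact: co_linear.
move=> x y xR.
have x1 : co x 1 = 0 by apply: (@adapted_co _ _ cD 2) xR; rewrite ?D2.
have x2 : co x 2 = 0 by apply: (@adapted_co _ _ cD 2) xR; rewrite ?D2.
have x3 : co x 3 = 0 by apply: (@adapted_co _ _ cD 2) xR; rewrite ?D2.
rewrite (vec_co x) (vec_co y) cG amul_famG co_vec x1 x2 x3 b34 b44 r1 r2; ring.
Qed.

Definition famB q : structures k 5 := of_table (fun i j =>
  if (j <= 4)%N then vec 0 0 0 0 (q i j) else 0).

Lemma amul_famB q (x1 x2 x3 x4 x5 y1 y2 y3 y4 y5 : k) :
  amul (famB q) (vec x1 x2 x3 x4 x5) (vec y1 y2 y3 y4 y5) = vec 0 0 0 0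
    (x1 * y1 * q 1%N 1%N + (x1 * y2 + x2 * y1) * q 1%N 2%N +
     (x1 * y3 + x3 * y1) * q 1%N 3%N + (x1 * y4 + x4 * y1) * q 1%N 4%N +
     x2 * y2 * q 2%N 2%N + (x2 * y3 + x3 * y2) * q 2%N 3%N +
     (x2 * y4 + x4 * y2) * q 2%N 4%N + x3 * y3 * q 3%N 3%N +
     (x3 * y4 + x4 * y3) * q 3%N 4%N + x4 * y4 * q 4%N 4%N).
Proof. by rewrite amul_table /= -vec0 !vecE; congr vec; ring. Qed.

(** All products are multiples of n5. A vector of <n3, n4> with square zero, available over an
    algebraically closed field, serves as the new n4. *)
Lemma famB_fam1 q : exists p m, gl_orbit (fam1 (fun _ _ => 0) p m) (famB q).
Proof.
have mulE x y : amul (famB q) x y = co (amul (famB q) x y) 5 *: nn k 5.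
  by vecs; rewrite amul_famB co_vec !nnE vecZ; congr vec; ring.
have n5 x : amul (famB q) x (nn k 5) = 0.
  by vecs; rewrite nnE amul_famB -vec0; congr vec; ring.
pose v3 : 'cV[k]_5 := if q 3%N 3%N == 0 then vec 0 0 0 1 0 else vec 0 0 1 0 0.
pose v4 (s : k) := if q 3%N 3%N == 0 then vec 0 0 1 0 0 else vec 0 0 s 1 0.
have [s sE] : exists s : k, amul (famB q) (v4 s) (v4 s) = 0.
  rewrite /v4; have [q3|q3] := eqVneq (q 3%N 3%N) 0.
    by exists 0; rewrite amul_famB q3 -vec0; congr vec; ring.
  have [r rE] := sqrt_exists (q 3%N 4%N ^+ 2 - q 3%N 3%N * q 4%N 4%N).
  exists ((r - q 3%N 4%N) / q 3%N 3%N); rewrite amul_famB -vec0; congr vec.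
  transitivity ((r ^+ 2 - (q 3%N 4%N ^+ 2 - q 3%N 3%N * q 4%N 4%N)) / q 3%N 3%N).
    by field.
  by rewrite rE subrr mul0r.
pose w := nth 0 [:: vec 1 0 0 0 0; vec 0 1 0 0 0; v3; v4 s].
pose f i j := co (amul (famB q) (w i.-1) (w j.-1)) 5.
have fE i j : amul (famB q) (w i.-1) (w j.-1) = f i j *: nn k 5 by apply: mulE.
exists f, (fun i => f i 4%N).
apply: (@table_orbit _ _ _ (vec 1 0 0 0 0) (vec 0 1 0 0 0) v3 (v4 s) (nn k 5)).
  move=> t1 t2 t3 t4 t5; rewrite /v3 /v4 nnE.
  case: eqP => _; rewrite !vecE => /vec_eq0[E1 E2 E3 E4 E5].
    split; [rewrite -[RHS]E1|rewrite -[RHS]E2|rewrite -[RHS]E4|rewrite -[RHS]E3|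
            rewrite -[RHS]E5]; ring.
  have z4 : t4 = 0 by rewrite -[RHS]E4; ring.
  subst t4.
  split=> //; [rewrite -[RHS]E1|rewrite -[RHS]E2|rewrite -[RHS]E3|rewrite -[RHS]E5]; ring.
have nthE i : (i < 4)%N ->
    nth 0 [:: vec 1 0 0 0 0; vec 0 1 0 0 0; v3; v4 s; nn k 5] i = w i.
  by case: i => [|[|[|[|]]]].
move=> i j i0 ij j5; rewrite -/(famB q); have [j4|j4] := leqP j 4; last first.
  have -> : j = 5%N by lia.
  by rewrite n5 /= comb0.
rewrite !nthE ?fE; [|lia|lia].
case: leqP => j3; first by rewrite combE !scale0r !add0r.
have -> : j = 4%N by lia.
case: leqP => i3 /=; first by rewrite combE !scale0r !add0r.
have -> : i = 4%N by lia.
by rewrite comb0 -[RHS]sE -fE.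
Qed.

(** The dimensions of R_2, R_3, R_4 decrease strictly down to zero: 3, 2, 1 gives [fam4]; 3, 2, 0
    gives [fam3]; 3 followed by at most 1 gives [fam2]; at most 2 gives [fam1], passing through
    [famB] when dim R_2 <= 1. *)
Lemma classification c : JorN k 5 c -> ~ nonvanishing (@P_eps1 k 5) c ->
  [\/ exists q p m, gl_orbit (fam1 q p m) c,
      exists a b p m r, gl_orbit (fam2 a b p m r) c,
      exists a b p r s, gl_orbit (fam3 a b p r s) c |
      exists al be ga si ta, gl_orbit (fam4 al be ga si ta) c].
Proof.
move=> cJ /(rpower1_dim cJ) d1.
have [d cd] := exists_adapted cJ; set D := fun i => \dim (rpower c i) => dD.
have dc : gl_orbit d c by apply: orbit_sym.
have [_ _ Dlt _] := dD; have D1 : (D 1%N <= 3)%N by [].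
have [D1'|D1'] : D 1%N = 3%N \/ (D 1%N <= 2)%N by lia.
  have [D2|D2] : D 2%N = 2%N \/ (D 2%N <= 1)%N by have := Dlt 1%N; lia.
    have [D3|D3] : D 3%N = 1%N \/ D 3%N = 0%N by have := Dlt 2%N; lia.
      have [al [be [ga [si [ta o]]]]] := adapted_fam4 dD D1' D2 D3.
      by constructor 4; exists al, be, ga, si, ta; apply: orbit_trans dc.
    have [a [b [p [r [s o]]]]] := adapted_fam3 dD D1' D2 D3.
    by constructor 3; exists a, b, p, r, s; rewrite -o.
  have [a [b [p [m [r o]]]]] := adapted_fam2 dD D1' D2.
  by constructor 2; exists a, b, p, m, r; rewrite -o.
constructor 1; have [D2|D2] : D 1%N = 2%N \/ (D 1%N <= 1)%N by lia.
  by have [q [p [m o]]] := adapted_fam1 dD D2; exists q, p, m; rewrite -o.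
have dC : commutative_structure d by case: (dD) => -[[]].
suff E : d = famB (fun i j => co (P d i j) 5).
  have [p [m o]] := famB_fam1 (fun i j => co (P d i j) 5).
  by exists (fun _ _ => 0), p, m; apply: orbit_trans dc; rewrite E.
have D20 : D 2%N = 0%N by have := Dlt 1%N; lia.
apply: amul_nn_sym => // i j /andP[i0 ij] j5; rewrite -/(P d i j).
case: leqP => j4.
  by apply: vec_split => //; apply: (@adapted_mul_co _ _ dD 0) (memvf _) => //; lia.
have -> : j = 5%N by lia.
have [D10|D10] := posnP (D 1%N).
  by apply: (adapted_zero dD _ D10) => //; apply: mem_rpower; apply: memvf.
rewrite /P dC; apply: (adapted_zero dD _ D20) => //; apply: mem_rpower.
by apply: (adapted_nn dD) => //; lia.
Qed.

End Coordinates.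

End Classification.

(** * Irreducibility *)

Section Irreducible.
Variables (k : closedFieldType) (n : nat).
Implicit Types (c d : structures k n) (g h : 'M[k]_n) (A : set (structures k n)).

Lemma regular_ext (D : {poly k}) (h1 h2 : k -> k) :
  (forall t, D.[t] != 0 -> h1 t = h2 t) -> regular D h2 -> regular D h1.
Proof. by move=> E [p [N H]]; exists p, N => t Dt; rewrite E // H. Qed.

Definition mx_segment g h : 'M[{poly k}]_n :=
  map_mx polyC g + 'X *: map_mx polyC (h - g).

Lemma mx_segmentE g h t : map_mx (horner_eval t) (mx_segment g h) = g + t *: (h - g).
Proof.
by apply/matrixP => i j; rewrite !mxE /horner_eval !hornerE.
Qed.

(** The matrix and the structure move together on lines. The matrix stays invertible off the roots
    of its determinant, which is nonzero at 0 and 1; [E] removes further bad parameters. *)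
Lemma joined_orbits A c0 c1 g h (E : {poly k}) :
    g \in unitmx -> h \in unitmx -> E.[0] != 0 -> E.[1] != 0 ->
    (forall t f, E.[t] != 0 -> f \in unitmx -> A (gl_act f (line c0 c1 t))) ->
  @joined k _ A (gl_act g c0) (gl_act h c1).
Proof.
move=> ug uh E0 E1 HA; pose G t := g + t *: (h - g).
pose D := \det (mx_segment g h) * E.
have dE t : (\det (mx_segment g h)).[t] = \det (G t).
  by rewrite /G -mx_segmentE det_map_mx.
have G0 : G 0 = g by rewrite /G scale0r addr0.
have G1 : G 1 = h by rewrite /G scale1r addrC subrK.
exists D, (fun t => gl_act (G t) (line c0 c1 t)); split.
- rewrite !hornerM !dE G0 G1 !mulf_neq0 // -unitfE -unitmxE //.
- move=> [[i j] l].
  have rG p q : regular D (fun t => G t p q).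
    have := @regular_horner k D (mx_segment g h p q); congr regular.
    by apply/funext => t; rewrite /G -mx_segmentE [RHS]mxE.
  (* Cramer's rule: the inverse is the adjugate, polynomial in t, divided by the determinant, that
     is, multiplied by E / D. *)
  have rI p q : regular D (fun t => invmx (G t) p q).
    apply: (@regular_ext _ _ (fun t => (D.[t]^-1 * E.[t]) * (\adj (mx_segment g h) p q).[t])).
      move=> t; rewrite hornerM dE mulf_eq0 negb_or => /andP[dt Et].
      rewrite /invmx unitmxE unitfE dt mxE; congr (_ * _).
        by rewrite ?hornerM ?dE; field; rewrite dt Et.
      by rewrite /G -mx_segmentE -map_mx_adj [LHS]mxE.
    by apply: regularM; [apply: regularM; [exact: regularV|exact: regular_horner]|
                         exact: regular_horner].
  have rv p q : regular D (fun t => (invmx (G t) *m delta_mx q 0 : 'cV[k]_n) p 0).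
    have := rI p q; congr regular; apply/funext => t.
    by rewrite -colE mxE.
  apply: (@regular_ext _ _ (fun t => \sum_s
    G t l s * \sum_p \sum_q (invmx (G t) *m delta_mx i 0 : 'cV[k]_n) p 0 *
      (invmx (G t) *m delta_mx j 0 : 'cV[k]_n) q 0 * acoord (line c0 c1 t) (p, q, s))).
    move=> t _; rewrite /acoord ffunE mxE; apply: eq_bigr => s _.
    by rewrite [X in _ * X]mxE.
  apply: regular_sum => s; apply: regularM; first exact: rG.
  apply: regular_sum => p; apply: regular_sum => q; apply: regularM.
    by apply: regularM.
  exact: regular_segment.
- by rewrite G0 /line segment0.
- by rewrite G1 /line segment1.
move=> t; rewrite hornerM dE mulf_eq0 negb_or => /andP[dt Et].
by apply: HA => //; rewrite unitmxE unitfE.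
Qed.

Lemma irreducible_orbit c : irreducible (gl_orbit c).
Proof.
have lineE t : line c c t = c.
  by apply/ffunP => i; rewrite ffunE subrr mulr0 addr0.
apply: irreducible_joined; first by exists c; apply: orbit_refl.
move=> _ _ [g ug ->] [h uh ->]; apply: (@joined_orbits _ c c g h 1) => //.
- by rewrite hornerC oner_neq0.
- by rewrite hornerC oner_neq0.
by move=> t f _ uf; rewrite lineE; exists f.
Qed.

Lemma polyfun_act g f : g \in unitmx -> @polyfun k ('I_n * 'I_n * 'I_n)%type f ->
  @polyfun k ('I_n * 'I_n * 'I_n)%type (fun c => f (gl_act g c)).
Proof.
move=> ug [p fp].
have -> : (fun c : structures k n => f (gl_act g c)) = fun c => peval p (gl_act g c).
  by apply/funext => c; rewrite fp.
elim/mpolyind: p {fp} => [|a m p _ _ IHp].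
  have := @polyfun_cst k ('I_n * 'I_n * 'I_n)%type 0; congr polyfun.
  by apply/funext => c; rewrite /peval meval0.
have -> : (fun c => peval (a *: 'X_[m] + p) (gl_act g c)) = (fun c =>
    a * \prod_i acoord (gl_act g c) (enum_val i) ^+ m i + peval p (gl_act g c)).
  by apply/funext => c; rewrite /peval mevalD mevalZ mevalX.
apply: polyfunD => //; apply: polyfunM; first exact: polyfun_cst.
have H r : @polyfun k ('I_n * 'I_n * 'I_n)%type (fun c => \prod_(i <- r)
      acoord (gl_act g c) (enum_val i) ^+ m i).
  elim: r => [|i r IHr].
    have := @polyfun_cst k ('I_n * 'I_n * 'I_n)%type 1; congr polyfun.
    by apply/funext => c; rewrite big_nil.
  rewrite (_ : (fun _ => _) = fun c => acoord (gl_act g c) (enum_val i) ^+ m i *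
    \prod_(i <- r) acoord (gl_act g c) (enum_val i) ^+ m i); last first.
    by apply/funext => c; rewrite big_cons.
  apply: polyfunM => //; apply: polyfunX.
  case: (enum_val i) => -[i1 i2] l.
  rewrite (_ : (fun _ => _) = fun c => \sum_s g l s *
    amul c (invmx g *m delta_mx i1 0) (invmx g *m delta_mx i2 0) s 0); last first.
    by apply/funext => c; rewrite /acoord ffunE mxE.
  apply: polyfun_sum => s; apply: polyfunM; first exact: polyfun_cst.
  by apply: polyvec_amul; apply: polyvec_cst.
exact: H.
Qed.

(** The action is polynomial, so the preimage of the zero set of a polynomial vanishing on [A] is a
    closed set, which contains [A]. *)
Lemma closure_act A g c : g \in unitmx ->
    (forall h d, h \in unitmx -> A d -> A (gl_act h d)) ->
  closure A c -> closure A (gl_act g c).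
Proof.
move=> ug gA Ac; apply: contrapT => nA.
have [f [fP f0 fA]] := @closed_sep k _ _ _ (@closed_closure _ A) nA.
have cl : closed [set d : structures k n | forall _ : unit, f (gl_act g d) = 0].
  by apply: closed_zeros => _; apply: polyfun_act.
have : closure A `<=` [set d | forall _ : unit, f (gl_act g d) = 0].
  by apply: closure_sub => // d Ad _; apply/fA/subset_closure/gA.
by move=> /(_ _ Ac tt) /eqP; rewrite (negPf f0).
Qed.

End Irreducible.

(** * The infinite union of orbits *)

Section Component27.
Variable k : closedFieldType.
Hypothesis char2 : (2 : k) != 0.
Implicit Types (c d : structures k 5).
Implicit Types (a b p : nat -> nat -> k) (m r : nat -> k).

Lemma line_fam2 a b p m r a' b' p' m' r' t :
  line (fam2 a b p m r) (fam2 a' b' p' m' r') t =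
  fam2 (fun i j => a i j + t * (a' i j - a i j)) (fun i j => b i j + t * (b' i j - b i j))
    (fun i j => p i j + t * (p' i j - p i j)) (fun i => m i + t * (m' i - m i))
    (fun i => r i + t * (r' i - r i)).
Proof.
rewrite line_table; apply: table_ext => i j _ _ _.
case: ifP => _; first by rewrite !vecE; congr vec; ring.
case: ifP => _; first by rewrite !vecE; congr vec; ring.
case: ifP => _; first by rewrite !vecE; congr vec; ring.
by rewrite subr0 scaler0 addr0.
Qed.

Lemma fam2_change a b p m r (s1 t1 s2 t2 : k) : s1 * t2 - t1 * s2 != 0 ->
  let w i := if i is 1%N then vec s1 t1 0 0 0 else vec s2 t2 0 0 0 in
  gl_orbit (fam2 (fun i j => bil2 a (w i) (w j)) (fun i j => bil2 b (w i) (w j))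
    (fun i j => bil2 p (w i) (w j)) (fun i => lin2 m (w i)) (fun i => lin2 r (w i)))
    (fam2 a b p m r).
Proof.
move=> det w; apply: (@table_orbit _ _ _ (vec s1 t1 0 0 0) (vec s2 t2 0 0 0)
  (vec 0 0 1 0 0) (vec 0 0 0 1 0) (vec 0 0 0 0 1)).
  move=> x1 x2 x3 x4 x5; rewrite !vecE => /vec_eq0[E1 E2 E3 E4 E5].
  have z1 : x1 = 0.
    apply: (mulf_eq0l det).
    transitivity (t2 * (x1 * s1 + x2 * s2 + x3 * 0 + x4 * 0 + x5 * 0) -
      s2 * (x1 * t1 + x2 * t2 + x3 * 0 + x4 * 0 + x5 * 0)); first by ring.
    by rewrite E1 E2; ring.
  have z2 : x2 = 0.
    apply: (mulf_eq0l det).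
    transitivity (s1 * (x1 * t1 + x2 * t2 + x3 * 0 + x4 * 0 + x5 * 0) -
      t1 * (x1 * s1 + x2 * s2 + x3 * 0 + x4 * 0 + x5 * 0)); first by ring.
    by rewrite E1 E2; ring.
  subst; split=> //; [rewrite -[RHS]E3|rewrite -[RHS]E4|rewrite -[RHS]E5]; ring.
move=> i j i0 ij j5; rewrite -/(fam2 a b p m r).
case: j j5 ij => [|[|[|[|[|[|//]]]]]]; case: i i0 => [|[|[|[|[|[|//]]]]]] //= _ _ _;
  rewrite amul_fam2 /bil2 /lin2 ?co_vec ?comb0 -?vec0 ?combE ?vecE; congr vec; ring.
Qed.

(* n1 is shifted by a multiple of n1^2 in order to make n1 n2 = 0, and n3, n4 are
   taken to be the squares of n1 and n2. *)
Lemma fam2_generic a b p m r :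
    a 1%N 2%N = 0 -> b 1%N 2%N = 0 ->
    a 1%N 1%N * b 2%N 2%N - a 2%N 2%N * b 1%N 1%N != 0 ->
    m 2%N * a 1%N 1%N + r 2%N * b 1%N 1%N != 0 ->
    m 1%N * a 2%N 2%N + r 1%N * b 2%N 2%N != 0 ->
    m 1%N * r 2%N - m 2%N * r 1%N != 0 ->
  N27 k (fam2 a b p m r).
Proof.
move=> a0 b0 dab t10 t20 dmr.
have [t1 t1E] : exists t1, t1 = m 2%N * a 1%N 1%N + r 2%N * b 1%N 1%N by eexists.
have [t2 t2E] : exists t2, t2 = m 1%N * a 2%N 2%N + r 1%N * b 2%N 2%N by eexists.
have [T1 T1E] : exists T1, T1 = m 1%N * a 1%N 1%N + r 1%N * b 1%N 1%N by eexists.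
have [T2 T2E] : exists T2, T2 = m 2%N * a 2%N 2%N + r 2%N * b 2%N 2%N by eexists.
rewrite -t1E in t10; rewrite -t2E in t20.
(* Scaling n1 by t2 and n2 by t1 makes both n2 n3 and n1 n4 equal to t1^2 t2^2 n5; the parameters
   are the ratios of n2 n4 and n1 n3 to this vector. *)
exists (t1 * T2 / t2 ^+ 2, t2 * T1 / t1 ^+ 2) => /=.
  (* The product of the parameters is T1 T2 / (t1 t2); by this determinant identity it differs from
     1. *)
  have D : (m 1%N * r 2%N - m 2%N * r 1%N) *
      (a 1%N 1%N * b 2%N 2%N - a 2%N 2%N * b 1%N 1%N) = T1 * T2 - t1 * t2.
    by rewrite T1E T2E t1E t2E; ring.
  apply/negP => /eqP E; move: (mulf_neq0 dmr dab); rewrite D.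
  have -> : T1 * T2 = t1 * t2 * ((t1 * T2 / t2 ^+ 2) * (t2 * T1 / t1 ^+ 2)).
    by field; rewrite t10 t20.
  by rewrite E mulr1 subrr eqxx.
pose rho := - (p 1%N 2%N / t1).
apply: (@table_orbit _ _ _
  (vec t2 0 (t2 * rho * a 1%N 1%N) (t2 * rho * b 1%N 1%N) (t2 * rho * p 1%N 1%N))
  (vec 0 t1 0 0 0)
  (vec 0 0 (t2 ^+ 2 * a 1%N 1%N) (t2 ^+ 2 * b 1%N 1%N)
     (t2 ^+ 2 * (p 1%N 1%N + 2 * rho * T1)))
  (vec 0 0 (t1 ^+ 2 * a 2%N 2%N) (t1 ^+ 2 * b 2%N 2%N) (t1 ^+ 2 * p 2%N 2%N))
  (vec 0 0 0 0 (t1 ^+ 2 * t2 ^+ 2))).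
  move=> x1 x2 x3 x4 x5; rewrite !vecE => /vec_eq0[E1 E2 E3 E4 E5].
  have z1 : x1 = 0 by apply: (mulf_eq0l t20); rewrite -[RHS]E1; ring.
  have z2 : x2 = 0 by apply: (mulf_eq0l t10); rewrite -[RHS]E2; ring.
  subst x1 x2.
  have z3 : x3 = 0.
    apply: (mulf_eq0l (mulf_neq0 dab (expf_neq0 2 t20))).
    transitivity (b 2%N 2%N * (0 * (t2 * rho * a 1%N 1%N) + 0 * 0 +
      x3 * (t2 ^+ 2 * a 1%N 1%N) + x4 * (t1 ^+ 2 * a 2%N 2%N) + x5 * 0) -
      a 2%N 2%N * (0 * (t2 * rho * b 1%N 1%N) + 0 * 0 +
      x3 * (t2 ^+ 2 * b 1%N 1%N) + x4 * (t1 ^+ 2 * b 2%N 2%N) + x5 * 0)); first by ring.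
    by rewrite E3 E4; ring.
  have z4 : x4 = 0.
    apply: (mulf_eq0l (mulf_neq0 dab (expf_neq0 2 t10))).
    transitivity (a 1%N 1%N * (0 * (t2 * rho * b 1%N 1%N) + 0 * 0 +
      x3 * (t2 ^+ 2 * b 1%N 1%N) + x4 * (t1 ^+ 2 * b 2%N 2%N) + x5 * 0) -
      b 1%N 1%N * (0 * (t2 * rho * a 1%N 1%N) + 0 * 0 +
      x3 * (t2 ^+ 2 * a 1%N 1%N) + x4 * (t1 ^+ 2 * a 2%N 2%N) + x5 * 0)); first by ring.
    by rewrite E3 E4; ring.
  subst x3 x4; split=> //.
  apply: (mulf_eq0l (mulf_neq0 (expf_neq0 2 t10) (expf_neq0 2 t20))).
  by rewrite -[RHS]E5; ring.
move=> i j i0 ij j5; rewrite -/(fam2 a b p m r).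
case: j j5 ij => [|[|[|[|[|[|//]]]]]]; case: i i0 => [|[|[|[|[|[|//]]]]]] //= _ _ _;
  rewrite amul_fam2 ?comb0 -?vec0 ?nnE ?vecZ ?combE ?vecE a0 b0; congr vec; try ring;
  first [ by rewrite T1E; ring
  | by transitivity (t1 * t2 * (p 1%N 2%N + rho * t1));
      [rewrite t1E; ring|rewrite /rho; field; rewrite ?t10 ?t20]
  | by transitivity (t2 ^+ 3 * T1); [rewrite T1E; ring|field; rewrite ?t10 ?t20]
  | by transitivity (t2 * t1 ^+ 2 * (m 1%N * a 2%N 2%N + r 1%N * b 2%N 2%N));
      [ring|rewrite -t2E; ring]
  | by transitivity (t1 * t2 ^+ 2 * (m 2%N * a 1%N 1%N + r 2%N * b 1%N 1%N));
      [ring|rewrite -t1E; ring]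
  | by transitivity (t1 ^+ 3 * T2); [rewrite T2E; ring|field; rewrite ?t10 ?t20] ].
Qed.

Lemma N27_act h d : h \in unitmx -> N27 k d -> N27 k (gl_act h d).
Proof.
move=> uh [p pP [g ug ->]]; exists p => //; exists (h *m g).
  by rewrite unitmx_mul uh.
by rewrite gl_actM.
Qed.

Lemma closure_N27_orbit c d : gl_orbit c d -> closure (N27 k) c -> closure (N27 k) d.
Proof. by move=> [g ug ->] cN; apply: closure_act => // h e; apply: N27_act. Qed.

(** The line to [J27 1 (-1)] keeps both mixed coefficients zero. [F] is the product of the four
    conditions of [fam2_generic], written with coordinates of products so as to be polynomial on the
    whole space. *)
Lemma fam2_diagonal a b p m r : a 1%N 2%N = 0 -> b 1%N 2%N = 0 ->
  closure (N27 k) (fam2 a b p m r).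
Proof.
move=> a0 b0; pose cf i j l (c : structures k 5) := co (amul c (nn k i) (nn k j)) l.
have cfP i j l : polyfun (cf i j l).
  by apply: polyvec_amul; apply: polyvec_cst.
pose F c := (cf 1 1 3 c * cf 2 2 4 c - cf 2 2 3 c * cf 1 1 4 c) *
  (cf 2 3 5 c * cf 1 1 3 c + cf 2 4 5 c * cf 1 1 4 c) *
  (cf 1 3 5 c * cf 2 2 3 c + cf 1 4 5 c * cf 2 2 4 c) *
  (cf 1 3 5 c * cf 2 4 5 c - cf 2 3 5 c * cf 1 4 5 c).
have FP : polyfun F.
  by do ![apply: polyfunM|apply: polyfunB|apply: polyfunD]; apply: cfP.
have FE a' b' p' m' r' : F (fam2 a' b' p' m' r') =
   (a' 1%N 1%N * b' 2%N 2%N - a' 2%N 2%N * b' 1%N 1%N) *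
   (m' 2%N * a' 1%N 1%N + r' 2%N * b' 1%N 1%N) *
   (m' 1%N * a' 2%N 2%N + r' 1%N * b' 2%N 2%N) *
   (m' 1%N * r' 2%N - m' 2%N * r' 1%N).
  by rewrite /F /cf !nnE !amul_fam2 !co_vec; ring.
apply: (closure_segment (b := J27 1 (-1)) FP).
  rewrite J27_fam2 FE /sym_coef /= (_ : _ * _ = - 2) ?oppr_eq0 //; ring.
move=> t; rewrite -/(line _ _ _) J27_fam2 line_fam2 FE !mulf_eq0 !negb_or -!andbA.
move=> /and4P[d1 d2 d3 d4]; apply: fam2_generic => //.
  by rewrite a0 /sym_coef /=; ring.
by rewrite b0 /sym_coef /=; ring.
Qed.

(* On the line below, n1 (n1 + t n2) has no component on n3 and n4. *)
Lemma fam2_square_zero a b p m r : a 1%N 1%N = 0 -> b 1%N 1%N = 0 ->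
  closure (N27 k) (fam2 a b p m r).
Proof.
(* The square of n1 acquires -t times the components of n1 n2 on n3 and n4, which cancels those of t
   n1 n2. *)
move=> a0 b0; pose tw f i j : k := if (i == 1%N) && (j == 1%N) then - f 1%N 2%N else f i j.
pose c1 := fam2 (tw a) (tw b) p m r.
have lineE t : line (fam2 a b p m r) c1 t =
    fam2 (fun i j => a i j + t * (tw a i j - a i j))
      (fun i j => b i j + t * (tw b i j - b i j))
      (fun i j => p i j + t * (p i j - p i j)) (fun i => m i + t * (m i - m i))
      (fun i => r i + t * (r i - r i)) by apply: line_fam2.
have cl t : t != 0 -> closure (N27 k) (line (fam2 a b p m r) c1 t).
  move=> t0; rewrite lineE; have det : 1 * t - 0 * 1 != 0 by rewrite mul1r mul0r subr0.
  apply: (closure_N27_orbit (fam2_change _ _ _ _ _ det)); apply: fam2_diagonal.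
    by rewrite /bil2 !co_vec /tw /= a0; ring.
  by rewrite /bil2 !co_vec /tw /= b0; ring.
(* [closure_segment] needs a polynomial in the structure that detects t != 0. The n3- or
   n4-coordinate of n1 n1 serves, unless n1 n2 has neither component, and then [fam2_diagonal]
   applies directly. *)
suff H l : (forall t, co (amul (line (fam2 a b p m r) c1 t) (nn k 1) (nn k 1)) l != 0 ->
    t != 0) -> co (amul c1 (nn k 1) (nn k 1)) l != 0 -> closure (N27 k) (fam2 a b p m r).
  have E t : amul (line (fam2 a b p m r) c1 t) (nn k 1) (nn k 1) =
      vec 0 0 (- t * a 1%N 2%N) (- t * b 1%N 2%N) (p 1%N 1%N).
    by rewrite lineE !nnE amul_fam2 /tw /= a0 b0; congr vec; ring.
  have E1 : amul c1 (nn k 1) (nn k 1) = vec 0 0 (- a 1%N 2%N) (- b 1%N 2%N) (p 1%N 1%N).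
    by rewrite !nnE amul_fam2 /tw /=; congr vec; ring.
  have [a20|a20] := eqVneq (a 1%N 2%N) 0; last first.
    apply: (H 3%N); last by rewrite E1 co_vec oppr_eq0.
    by move=> t; rewrite E co_vec mulf_eq0 oppr_eq0 negb_or => /andP[].
  have [b20|b20] := eqVneq (b 1%N 2%N) 0; first exact: fam2_diagonal.
  apply: (H 4%N); last by rewrite E1 co_vec oppr_eq0.
  by move=> t; rewrite E co_vec mulf_eq0 oppr_eq0 negb_or => /andP[].
move=> Ht H1; rewrite (closure_id (closure (N27 k))).1; last exact: closed_closure.
apply: (@closure_segment _ _ _ _ c1 (fun c => co (amul c (nn k 1) (nn k 1)) l)) => //.
  by apply: polyvec_amul; apply: polyvec_cst.
by move=> t /Ht; apply: cl.
Qed.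

Lemma quadratic_isotropic (al be ga : k) : exists s t : k,
  al * s ^+ 2 + be * s * t + ga * t ^+ 2 = 0 /\ ~ (s = 0 /\ t = 0).
Proof.
have [->|al0] := eqVneq al 0.
  by exists 1, 0; split; [ring|case=> /eqP; rewrite oner_eq0].
have [s sE] := sqrt_exists (be ^+ 2 - 4 * al * ga).
exists ((s - be) / (2 * al)), 1; split; last by case=> _ /eqP; rewrite oner_eq0.
transitivity ((s ^+ 2 - (be ^+ 2 - 4 * al * ga)) / (4 * al)); last by rewrite sE subrr mul0r.
have four : (4 : k) != 0 by rewrite (_ : 4 = 2 * 2) ?mulf_neq0 //; ring.
by field; rewrite al0 char2 four.
Qed.

(* Some product v w of two nonzero combinations of n1 and n2 lies in <n5>. *)
Lemma fam2_closure a b p m r : closure (N27 k) (fam2 a b p m r).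
Proof.
(* For v = s n1 + t n2, this form is the determinant of w |-> (a(v, w), b(v, w)). At an isotropic v
   this map has a nonzero kernel vector w, with coordinates s', t'. *)
have [s [t [E st0]]] := quadratic_isotropic
  (a 1%N 1%N * b 1%N 2%N - a 1%N 2%N * b 1%N 1%N)
  (a 1%N 1%N * b 2%N 2%N - a 2%N 2%N * b 1%N 1%N)
  (a 1%N 2%N * b 2%N 2%N - a 2%N 2%N * b 1%N 2%N).
pose x1 := s * a 1%N 1%N + t * a 1%N 2%N; pose y1 := s * b 1%N 1%N + t * b 1%N 2%N.
pose x2 := s * a 1%N 2%N + t * a 2%N 2%N; pose y2 := s * b 1%N 2%N + t * b 2%N 2%N.
have {E} D : x1 * y2 = x2 * y1.
  by apply/eqP; rewrite -subr_eq0 -[X in _ == X]E; apply/eqP; rewrite /x1 /x2 /y1 /y2; ring.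
have [s' [t' [Ex Ey st0']]] : exists s' t' : k,
    [/\ s' * x1 + t' * x2 = 0, s' * y1 + t' * y2 = 0 & ~ (s' = 0 /\ t' = 0)].
  have [x10|x10] := eqVneq x1 0; last first.
    exists x2, (- x1); split; [ring|by rewrite mulNr D; ring|].
    by case=> _ /eqP; rewrite oppr_eq0 (negPf x10).
  have [y10|y10] := eqVneq y1 0; last first.
    exists y2, (- y1); split; [by rewrite (mulrC y2) D; ring|ring|].
    by case=> _ /eqP; rewrite oppr_eq0 (negPf y10).
  by exists 1, 0; rewrite x10 y10; split; [ring|ring|case=> /eqP; rewrite oner_eq0].
(* Independent v and w make the structure diagonal; proportional ones make the n3- and n4-components
   of v v vanish. *)
have [det|det] := eqVneq (s * t' - t * s') 0; last first.
  apply: (closure_N27_orbit (fam2_change _ _ _ _ _ det)); apply: fam2_diagonal.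
    by rewrite /bil2 !co_vec -[RHS]Ex /x1 /x2; ring.
  by rewrite /bil2 !co_vec -[RHS]Ey /y1 /y2; ring.
have {det} det : s * t' = t * s' by apply/eqP; rewrite -subr_eq0 det.
have sq f : s' * (s * f 1%N 1%N + t * f 1%N 2%N) + t' * (s * f 1%N 2%N + t * f 2%N 2%N) = 0 ->
    bil2 f (vec s t 0 0 0) (vec s t 0 0 0) = 0.
  move=> F; rewrite /bil2 !co_vec; have [s0|s0] := eqVneq s 0.
    have t0 : t != 0 by apply/eqP => t0; apply: st0.
    have s'0 : s' = 0.
      by apply: (mulf_eq0l t0); rewrite mulrC -det s0 mul0r.
    have t'0 : t' != 0 by apply/eqP => t'0; apply: st0'.
    apply: (mulf_eq0l t'0); transitivity (t * (s' * (s * f 1%N 1%N + t * f 1%N 2%N) +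
      t' * (s * f 1%N 2%N + t * f 2%N 2%N))); last by rewrite F mulr0.
    by rewrite s'0 s0; ring.
  have s'0 : s' != 0.
    apply/eqP => s'0; apply: st0'; split=> //.
    by apply: (mulf_eq0l s0); rewrite mulrC det s'0 mulr0.
  apply: (mulf_eq0l s'0); transitivity (s * (s' * (s * f 1%N 1%N + t * f 1%N 2%N) +
    t' * (s * f 1%N 2%N + t * f 2%N 2%N))); last by rewrite F mulr0.
  transitivity (s * s' * (s * f 1%N 1%N + t * f 1%N 2%N) +
    t * s' * (s * f 1%N 2%N + t * f 2%N 2%N)).
    by ring.
  by rewrite -det; ring.
have [s0|s0] := eqVneq s 0.
  have det' : s * 0 - t * 1 != 0.
    rewrite mulr0 mulr1 sub0r oppr_eq0; apply/eqP => t0; exact: st0.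
  apply: (closure_N27_orbit (fam2_change _ _ _ _ _ det')).
  by apply: fam2_square_zero; apply: sq.
have det' : s * 1 - t * 0 != 0 by rewrite mulr0 mulr1 subr0.
apply: (closure_N27_orbit (fam2_change _ _ _ _ _ det')).
by apply: fam2_square_zero; apply: sq.
Qed.

Lemma J27_JorN (e f : k) : JorN k 5 (J27 e f).
Proof. by rewrite J27_fam2; apply: fam2_JorN. Qed.

Lemma line_J27 (e f e' f' t : k) :
  line (J27 e f) (J27 e' f') t = J27 (e + t * (e' - e)) (f + t * (f' - f)).
Proof.
rewrite !J27_fam2 line_fam2; apply: table_ext => i j _ _ _; rewrite /sym_coef.
case: ifP => _; first by congr vec; ring.
case: ifP => _; first by case: i => [|[|i]]; congr vec; ring.
by case: ifP => _ //; case: i => [|[|i]]; congr vec; ring.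
Qed.

(** The parameters also move on a line, and [E] keeps this line off the curve where their product is
    1. *)
Lemma irreducible_N27 : irreducible (N27 k).
Proof.
apply: irreducible_joined.
  exists (J27 0 0); exists (0, 0) => /=; first by rewrite mul0r eq_sym oner_neq0.
  exact: orbit_refl.
move=> _ _ [[e f] /= ef [g ug ->]] [[e' f'] /= ef' [h uh ->]].
pose E : {poly k} := 1 - (e%:P + 'X * (e' - e)%:P) * (f%:P + 'X * (f' - f)%:P).
have EE t : E.[t] = 1 - (e + t * (e' - e)) * (f + t * (f' - f)) by rewrite !hornerE.
apply: (@joined_orbits _ _ _ (J27 e f) (J27 e' f') g h E) => //.
- by rewrite EE !mul0r !addr0 subr_eq0 eq_sym.
- by rewrite EE !mul1r !(addrC e) !(addrC f) !subrK subr_eq0 eq_sym.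
move=> t u Et uu; rewrite line_J27.
exists (e + t * (e' - e), f + t * (f' - f)); last by exists u.
by rewrite /= eq_sym -subr_eq0 -EE.
Qed.

(** For the images x, y of n1, n2, the relation x y = 0 puts them on the two coordinate axes modulo
    <n3, n4, n5>, up to exchange. Then (x x) y = (y y) x equates their scales, and (y y) y reads off
    the parameter. *)
Lemma J27_orbit_inj (e e' : k) : gl_orbit (J27 e e) (J27 e' e') -> e = e'.
Proof.
move=> [g ug E]; have ug' : invmx g \in unitmx by rewrite unitmx_inv.
have M x y : amul (J27 e e) (invmx g *m x) (invmx g *m y) =
    invmx g *m amul (J27 e' e') x y by rewrite E amul_act // mulKmx.
set x := invmx g *m nn k 1; set y := invmx g *m nn k 2.
set z := invmx g *m nn k 5.
have z0 : z != 0.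
  apply/eqP => /(congr1 (mulmx g)); rewrite mulKVmx // mulmx0 nnE => /vec_eq0[_ _ _ _].
  by move/eqP; rewrite oner_eq0.
have xy : amul (J27 e e) x y = 0.
  rewrite M J27_fam2 !nnE amul_fam2 /sym_coef /=.
  rewrite [X in _ *m X](_ : _ = 0) ?mulmx0 // -vec0; congr vec; ring.
have T (v w u : 'cV[k]_5) (s : k) :
    amul (J27 e' e') (amul (J27 e' e') v w) u = s *: nn k 5 ->
    amul (J27 e e) (amul (J27 e e) (invmx g *m v) (invmx g *m w)) (invmx g *m u) = s *: z.
  by move=> H; rewrite !M H -scalemxAr.
have xxy : amul (J27 e e) (amul (J27 e e) x x) y = 1 *: z.
  apply: T; rewrite J27_fam2 !nnE !amul_fam2 /sym_coef /= vecZ; congr vec; ring.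
have yyx : amul (J27 e e) (amul (J27 e e) y y) x = 1 *: z.
  apply: T; rewrite J27_fam2 !nnE !amul_fam2 /sym_coef /= vecZ; congr vec; ring.
have xxx : amul (J27 e e) (amul (J27 e e) x x) x = e' *: z.
  apply: T; rewrite J27_fam2 !nnE !amul_fam2 /sym_coef /= vecZ; congr vec; ring.
have yyy : amul (J27 e e) (amul (J27 e e) y y) y = e' *: z.
  apply: T; rewrite J27_fam2 !nnE !amul_fam2 /sym_coef /= vecZ; congr vec; ring.
have [z5 z5E] : exists z5, z = z5 *: nn k 5.
  by eexists; rewrite -[LHS]scale1r -xxy J27_fam2 fam2_mul2; reflexivity.
have z50 : z5 != 0.
  by apply: contraNneq z0 => H; rewrite z5E H scale0r.
move: xy xxy yyx xxx yyy; rewrite z5E J27_fam2 !fam2_mul2 !scalerA !nnE !vecZ.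
have [x1 [x2 [x3 [x4 [x5 ->]]]]] := vecP x.
have [y1 [y2 [y3 [y4 [y5 ->]]]]] := vecP y.
rewrite amul_fam2 /bil2 /lin2 !co_vec /sym_coef /=.
move=> /vec_eq0[_ _ E3 E4 _] /vec_inj[_ _ _ _ E5] /vec_inj[_ _ _ _ E6].
move=> /vec_inj[_ _ _ _ E7] /vec_inj[_ _ _ _ E8].
have xy1 : x1 * y1 = 0 by rewrite -[RHS]E3; ring.
have xy2 : x2 * y2 = 0 by rewrite -[RHS]E4; ring.
have {}E5 : x1 ^+ 2 * (e * y1 + y2) + x2 ^+ 2 * (y1 + e * y2) = z5.
  by apply: etrans (etrans _ E5) _; ring.
have {}E6 : y1 ^+ 2 * (e * x1 + x2) + y2 ^+ 2 * (x1 + e * x2) = z5.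
  by apply: etrans (etrans _ E6) _; ring.
have {}E7 : x1 ^+ 2 * (e * x1 + x2) + x2 ^+ 2 * (x1 + e * x2) = e' * z5.
  by apply: etrans (etrans _ E7) _; ring.
have {}E8 : y1 ^+ 2 * (e * y1 + y2) + y2 ^+ 2 * (y1 + e * y2) = e' * z5.
  by apply: etrans (etrans _ E8) _; ring.
apply: (mulIf z50); rewrite -E8.
have [x10|x10] := eqVneq x1 0; last first.
  have y10 : y1 = 0 by apply: (mulf_eq0l x10); rewrite mulrC.
  subst y1; have y20 : y2 != 0.
    by apply: contraNneq z50 => y20; rewrite -E5 y20; apply/eqP; ring.
  have x20 : x2 = 0 by apply: (mulf_eq0l y20).
  subst x2; have xy : x1 = y2.
    apply: (mulfI x10); apply: (mulfI y20).
    transitivity z5; first by rewrite -E5; ring.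
    by rewrite -E6; ring.
  by rewrite -E5 xy; ring.
subst x1; have x20 : x2 != 0.
  by apply: contraNneq z50 => x20; rewrite -E5 x20; apply/eqP; ring.
have y20 : y2 = 0 by apply: (mulf_eq0l x20); rewrite mulrC.
subst y2; have y10 : y1 != 0.
  by apply: contraNneq z50 => y10; rewrite -E5 y10; apply/eqP; ring.
have xy : x2 = y1.
  apply: (mulfI x20); apply: (mulfI y10).
  transitivity z5; first by rewrite -E5; ring.
  by rewrite -E6; ring.
by rewrite -E5 xy; ring.
Qed.

Lemma infinite_orbits :
  infinite_set [set O | exists2 c, JorN k 5 c & O = gl_orbit c].
Proof.
pose f (e : k) := gl_orbit (J27 e e).
move=> fin; have finf : finite_set (f @^-1`
    [set O | exists2 c, JorN k 5 c & O = gl_orbit c]).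
  apply: finite_preimage fin => e e' _ _ E; apply: J27_orbit_inj.
  by rewrite -/(f e) E; apply: orbit_refl.
have : finite_set [set: k].
  by apply: sub_finite_set finf => e _; exists (J27 e e) => //; apply: J27_JorN.
move=> /finite_seqP[s sE].
have [|t] := @poly_nonroot k (\prod_(x <- s) ('X - x%:P)).
  by rewrite monic_neq0 // monic_prod_XsubC.
have : t \in s by have : [set: k] t by []; rewrite sE.
by rewrite -root_prod_XsubC rootE => ->.
Qed.

End Component27.

(** * Components *)

Section Components.
Variable k : closedFieldType.
Hypotheses (char2 : (2 : k) != 0) (char3 : (3 : k) != 0).
Implicit Types (c d : structures k 5) (A B : set (structures k 5)).

Lemma vanishing (P : structures k 5 -> (nat -> 'cV[k]_5) -> (nat -> 'rV[k]_5) -> k) c :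
  (forall u ph, P c u ph = 0) -> ~ nonvanishing P c.
Proof. by move=> H [[u ph]]; rewrite H eqxx. Qed.

Lemma vanishing_orbit (P : structures k 5 -> (nat -> 'cV[k]_5) -> (nat -> 'rV[k]_5) -> k) c d :
  covariant P -> (forall u ph, P c u ph = 0) -> gl_orbit c d -> ~ nonvanishing P d.
Proof.
move=> PC /vanishing H cd Pd; apply: H.
exact: nonvanishing_orbit PC (orbit_sym cd) Pd.
Qed.

Lemma orbit_J22 c : JorN k 5 c -> nonvanishing (@P22 k 5) c -> gl_orbit (J22 k) c.
Proof.
move=> cJ Pc; have PC := @P22_covariant k 5.
have [nil|nil] := pselect (nonvanishing (@P_eps1 k 5) c).
  by have := vanishing_orbit PC (@eps1_P22 k) (orbit_eps1 char2 cJ nil).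
have [[q [p [m o]]]|[a [b [p [m [r o]]]]]|[a [b [p [r [s o]]]]]|
      [al [be [ga [si [ta o]]]]]] := classification char2 char3 cJ nil.
- by have := vanishing_orbit PC (@fam1_P22 k q p m) o.
- by have := vanishing_orbit PC (@fam2_P22 k a b p m r) o.
- by have := vanishing_orbit PC (@fam3_P22 k a b p r s) o.
apply: (orbit_trans _ o); apply: fam4_normal => //.
exact: nonvanishing_orbit PC (orbit_sym o) Pc.
Qed.

Lemma orbit_J40 c : JorN k 5 c -> nonvanishing (@P40 k 5) c ->
  nonvanishing (@P40' k 5) c -> gl_orbit (J40 k) c.
Proof.
move=> cJ Pc Pc'; have PC := @P40_covariant k 5.
have [nil|nil] := pselect (nonvanishing (@P_eps1 k 5) c).
  by have := vanishing_orbit PC (@eps1_P40 k) (orbit_eps1 char2 cJ nil).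
have [[q [p [m o]]]|[a [b [p [m [r o]]]]]|[a [b [p [r [s o]]]]]|
      [al [be [ga [si [ta o]]]]]] := classification char2 char3 cJ nil.
- by have := vanishing_orbit PC (@fam1_P40 k q p m) o.
- by have := vanishing_orbit PC (@fam2_P40 k a b p m r) o.
- have [be [ga o']] := fam3_reduce char2 (nonvanishing_orbit PC (orbit_sym o) Pc).
  have o1 := orbit_trans o' o.
  have [be0 ga0] := fam3_normal_res
    (nonvanishing_orbit (@P40'_covariant k 5) (orbit_sym o1) Pc').
  exact: orbit_trans (fam3_normal_orbit be0 ga0) o1.
by have := vanishing_orbit PC (@fam4_P40 k al be ga si ta) o.
Qed.

Lemma orbit_J21 c : JorN k 5 c -> nonvanishing (@P21 k 5) c ->
  nonvanishing (@P21_gram k 5) c -> nonvanishing (@P21_disc k 5) c ->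
  nonvanishing (@P21_res k 5) c -> gl_orbit (J21 k) c.
Proof.
move=> cJ Pc Pg Pd Pr; have PC := @P21_covariant k 5.
have [nil|nil] := pselect (nonvanishing (@P_eps1 k 5) c).
  by have := vanishing_orbit PC (@eps1_P21 k) (orbit_eps1 char2 cJ nil).
have [[q [p [m o]]]|[a [b [p [m [r o]]]]]|[a [b [p [r [s o]]]]]|
      [al [be [ga [si [ta o]]]]]] := classification char2 char3 cJ nil.
- have [g [al [be o']]] := fam1_reduce char2
    (nonvanishing_orbit (@P21_disc_covariant k 5) (orbit_sym o) Pd).
  have o1 := orbit_trans o' o.
  have g0 := fam1_normal_gram
    (nonvanishing_orbit (@P21_gram_covariant k 5) (orbit_sym o1) Pg).
  have [al0 be0] := fam1_normal_res
    (nonvanishing_orbit (@P21_res_covariant k 5) (orbit_sym o1) Pr).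
  exact: orbit_trans (fam1_normal_orbit g0 al0 be0) o1.
- by have := vanishing_orbit PC (@fam2_P21 k a b p m r) o.
- by have := vanishing_orbit PC (@fam3_P21 k a b p r s) o.
by have := vanishing_orbit PC (@fam4_P21 k al be ga si ta) o.
Qed.

Lemma J22_JorN : JorN k 5 (J22 k).
Proof. exact: JorN_orbit (orbit_sym (J22_fam4 char3)) (fam4_JorN _ _ _ _ _). Qed.

Lemma rigidP c (U : set (structures k 5)) : JorN k 5 c -> open U ->
    (forall d, gl_orbit c d -> U d) -> (forall d, JorN k 5 d -> U d -> gl_orbit c d) ->
  rigid c.
Proof.
move=> cJ oU cU Uc; split=> //; exists U => //; apply/seteqP; split=> d.
  by move=> cd; split; [apply: JorN_orbit cd cJ|apply: cU].
by move=> [dJ Ud]; apply: Uc.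
Qed.

Lemma rigid_eps1 : rigid (eps1 k).
Proof.
apply: rigidP (@eps1_JorN k) (open_nonvanishing (@P_eps1_covariant k 5)) _ _.
  by move=> d cd; apply: nonvanishing_orbit (@P_eps1_covariant k 5) cd (@eps1_P_eps1 k).
by move=> d dJ /(orbit_eps1 char2 dJ).
Qed.

Lemma rigid_J22 : rigid (J22 k).
Proof.
apply: rigidP J22_JorN (open_nonvanishing (@P22_covariant k 5)) _ _.
  by move=> d cd; apply: nonvanishing_orbit (@P22_covariant k 5) cd (J22_P22 char3).
by move=> d dJ; apply: orbit_J22.
Qed.

Lemma rigid_J40 : rigid (J40 k).
Proof.
have J : JorN k 5 (J40 k) by rewrite J40_fam3; apply: fam3_JorN.
apply: (rigidP J (openI (open_nonvanishing (@P40_covariant k 5))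
                        (open_nonvanishing (@P40'_covariant k 5)))).
  move=> d cd; split.
    exact: nonvanishing_orbit (@P40_covariant k 5) cd (@J40_P40 k).
  exact: nonvanishing_orbit (@P40'_covariant k 5) cd (J40_P40' char2).
by move=> d dJ [P P']; apply: orbit_J40.
Qed.

Lemma rigid_J21 : rigid (J21 k).
Proof.
have J : JorN k 5 (J21 k) by rewrite J21_fam1; apply: fam1_JorN.
apply: (rigidP J (openI (openI (open_nonvanishing (@P21_covariant k 5))
                               (open_nonvanishing (@P21_gram_covariant k 5)))
                        (openI (open_nonvanishing (@P21_disc_covariant k 5))
                               (open_nonvanishing (@P21_res_covariant k 5))))).
  move=> d cd; split; split.
  - exact: nonvanishing_orbit (@P21_covariant k 5) cd (@J21_P21 k).
  - exact: nonvanishing_orbit (@P21_gram_covariant k 5) cd (@J21_P21_gram k).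
  - exact: nonvanishing_orbit (@P21_disc_covariant k 5) cd (@J21_P21_disc k).
  exact: nonvanishing_orbit (@P21_res_covariant k 5) cd (J21_P21_res char2).
by move=> d dJ [[P1 P2] [P3 P4]]; apply: orbit_J21.
Qed.

Lemma closure_rigid c0 c d : rigid c0 -> gl_orbit d c ->
    (forall t, JorN k 5 (line d c0 t)) ->
  closure (gl_orbit c0) c.
Proof.
move=> [_ oc] [g ug ->] H.
apply: (@closure_segment_open k _ (JorN k 5) (gl_orbit c0) _ (gl_act g c0) oc).
  by exists g.
by move=> t; rewrite -/(line _ _ _) line_act //; apply: JorN_act.
Qed.

Lemma line_fam1 (q p q' p' : nat -> nat -> k) (m m' : nat -> k) t :
  line (fam1 q p m) (fam1 q' p' m') t =
  fam1 (fun i j => q i j + t * (q' i j - q i j)) (fun i j => p i j + t * (p' i j - p i j))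
    (fun i => m i + t * (m' i - m i)).
Proof.
rewrite line_table; apply: table_ext => i j _ _ _.
case: ifP => _; first by rewrite !vecE; congr vec; ring.
case: ifP => _; first by rewrite !vecE; congr vec; ring.
by rewrite subr0 scaler0 addr0.
Qed.

Lemma line_fam3 (a b p a' b' p' : nat -> nat -> k) (r s r' s' : nat -> k) t :
  line (fam3 a b p r s) (fam3 a' b' p' r' s') t =
  fam3 (fun i j => a i j + t * (a' i j - a i j)) (fun i j => b i j + t * (b' i j - b i j))
    (fun i j => p i j + t * (p' i j - p i j)) (fun i => r i + t * (r' i - r i))
    (fun i => s i + t * (s' i - s i)).
Proof.
rewrite line_table; apply: table_ext => i j _ _ _.
case: ifP => _; first by rewrite !vecE; congr vec; ring.
case: ifP => _; first by rewrite !vecE; congr vec; ring.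
by rewrite subr0 scaler0 addr0.
Qed.

Lemma fam1_closure q p m c : gl_orbit (fam1 q p m) c -> closure (gl_orbit (J21 k)) c.
Proof.
move=> o; apply: (closure_rigid rigid_J21 o) => t.
by rewrite J21_fam1 line_fam1; apply: fam1_JorN.
Qed.

Lemma fam3_closure a b p r s c : gl_orbit (fam3 a b p r s) c ->
  closure (gl_orbit (J40 k)) c.
Proof.
move=> o; apply: (closure_rigid rigid_J40 o) => t.
by rewrite J40_fam3 line_fam3; apply: fam3_JorN.
Qed.

(** [J22] differs from [fam4 0 0 1 0 0] by exchanging n2 and n3, up to isomorphism of the tables;
    the line therefore ends at the latter, so as to stay in the family. *)
Lemma fam4_closure (al be ga si ta : k) c : gl_orbit (fam4 al be ga si ta) c ->
  closure (gl_orbit (J22 k)) c.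
Proof.
move=> [g ug ->]; have o := J22_fam4 char3; have [_ oc] := rigid_J22.
apply: (@closure_segment_open k _ (JorN k 5) _ _ (gl_act g (fam4 0 0 1 0 0)) oc).
  by apply: orbit_trans o _; exists g.
move=> t; rewrite -/(line _ _ _) line_act //; apply: JorN_act => //.
rewrite [line _ _ _](_ : _ = fam4 (al + t * (0 - al)) (be + t * (0 - be))
  (ga + t * (1 - ga)) (si + t * (0 - si)) (ta + t * (0 - ta))); first exact: fam4_JorN.
rewrite line_table; apply: table_ext => i j i0 ij j5.
case: j j5 ij => [|[|[|[|[|[|//]]]]]]; case: i i0 => [|[|[|[|[|[|//]]]]]] //= _ _ _;
  rewrite ?nnE -?vec0 ?vecE; congr vec; ring.
Qed.

Lemma orbit_JorN c : JorN k 5 c -> gl_orbit c `<=` JorN k 5.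
Proof. by move=> cJ d cd; apply: JorN_orbit cd cJ. Qed.

Lemma N27_JorN : N27 k `<=` JorN k 5.
Proof. by move=> c [p _ o]; apply: JorN_orbit o (J27_JorN _ _). Qed.

Lemma JorN_components c : JorN k 5 c ->
  [\/ closure (gl_orbit (eps1 k)) c, closure (gl_orbit (J21 k)) c,
      closure (gl_orbit (J22 k)) c | closure (gl_orbit (J40 k)) c \/ closure (N27 k) c].
Proof.
move=> cJ; have [nil|nil] := pselect (nonvanishing (@P_eps1 k 5) c).
  by constructor 1; apply: subset_closure; apply: orbit_eps1.
have [[q [p [m o]]]|[a [b [p [m [r o]]]]]|[a [b [p [r [s o]]]]]|
      [al [be [ga [si [ta o]]]]]] := classification char2 char3 cJ nil.
- by constructor 2; apply: fam1_closure o.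
- by constructor 4; right; apply: (closure_N27_orbit o); apply: fam2_closure.
- by constructor 4; left; apply: fam3_closure o.
by constructor 3; apply: fam4_closure o.
Qed.

(** The vanishing set of a covariant is closed, so it contains the closure of [B] but not [c]. *)
Lemma closure_not_sub A B (P : structures k 5 -> (nat -> 'cV[k]_5) -> (nat -> 'rV[k]_5) -> k) c :
    covariant P -> A c -> nonvanishing P c -> (forall d, B d -> ~ nonvanishing P d) ->
  ~ (closure A `<=` closure B).
Proof.
move=> PC Ac Pc BP AB.
have : closure B c by apply/AB/subset_closure.
by move=> /(closure_sub (closed_vanishing PC) BP).
Qed.

(** [JorN] is a cone: scaling the product preserves both defining conditions. It is thus a union of
    irreducible lines through the zero structure. *)
Lemma connected_JorN : connected (JorN k 5).
Proof.
pose z : structures k 5 := fam1 (fun _ _ => 0) (fun _ _ => 0) (fun=> 0).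
have z0 : z = [ffun=> 0].
  apply/ffunP => t; rewrite !ffunE; case: ifP => _; rewrite ?vec0 ?mxE //.
  by case: ifP => _; rewrite ?vec0 mxE.
have zE i : acoord z i = 0 by rewrite z0 /acoord ffunE.
pose S c : set (structures k 5) := range (line c z).
have amul_line c x y t : amul (line c z t) x y = (1 - t) *: amul c x y.
  apply/colP => l; rewrite !mxE mulr_sumr; apply: eq_bigr => i _.
  rewrite mulr_sumr; apply: eq_bigr => j _.
  rewrite [acoord (line c z t) _]/acoord ffunE zE; ring.
have SJ c : JorN k 5 c -> S c `<=` JorN k 5.
  move=> [[cC cJ] cN] _ [t _ <-].
  have lC : commutative_structure (line c z t).
    by move=> x y; rewrite !amul_line cC.
  split.
    split=> // x y; rewrite !amul_line !(amulZl, amulZr) cJ.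
    by rewrite !scalerA.
  apply/(nilpotentP lC)/rpower_eq0 => x s.
  have /(nilpotentP cC)/rpower_eq0 H := cN.
  suff -> : foldl (amul (line c z t)) x s = (1 - t) ^+ size s *: foldl (amul c) x s.
    by rewrite H scaler0.
  case: s => s /= _; elim/last_ind: s => [|s y IHs]; first by rewrite scale1r.
  rewrite -cats1 !foldl_cat /= IHs amul_line amulZl scalerA size_cat addn1.
  by rewrite exprS.
have -> : JorN k 5 = \bigcup_(c in JorN k 5) S c.
  apply/seteqP; split=> [c cJ|c [d dJ]]; last exact: SJ.
  by exists c => //; exists 0 => //; rewrite /line segment0.
apply: bigcup_connected.
  by exists z => c _; exists 1 => //; rewrite /line segment1.
move=> c _; apply: irreducible_connected; apply: irreducible_joined.
  by exists c; exists 0 => //; rewrite /line segment0.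
move=> _ _ [s _ <-] [t _ <-]; exists 1, (fun x => line c z (s + x * (t - s))); split.
- by rewrite !hornerC !oner_neq0.
- move=> i; have := @regular_horner k 1 ((acoord c i)%:P +
    (s%:P + 'X * (t - s)%:P) * (acoord z i - acoord c i)%:P).
  by congr regular; apply/funext => x; rewrite !hornerE [RHS]ffunE.
- by rewrite mul0r addr0.
- by rewrite mul1r addrC subrK.
by move=> x _; exists (s + x * (t - s)).
Qed.

End Components.

Theorem theorem15 (k : closedFieldType)
    (char2 : 2%N \notin [pchar k]) (char3 : 3%N \notin [pchar k]) :
  [/\ closed (JorN k 5),
      connected (JorN k 5),
      infinite_set [set O | exists2 c, JorN k 5 c & O = gl_orbit c],
      [/\ rigid (eps1 k), rigid (J21 k), rigid (J22 k) & rigid (J40 k)] &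
      let components :=
        [:: closure (gl_orbit (eps1 k)); closure (gl_orbit (J21 k));
            closure (gl_orbit (J22 k)); closure (gl_orbit (J40 k));
            closure (N27 k)] in
      uniq components /\
      irreducible_components (JorN k 5) = [set C | C \in components]].
Proof.
have two : (2 : k) != 0.
  by apply: contra char2 => /eqP E; rewrite inE /= E eqxx.
have three : (3 : k) != 0.
  by apply: contra char3 => /eqP E; rewrite inE /= E eqxx.
split; [exact: closed_JorN|exact: connected_JorN|exact: infinite_orbits| |].
  by split; [apply: rigid_eps1|apply: rigid_J21|apply: rigid_J22|apply: rigid_J40].
move=> components.
pose O i := nth set0 [:: gl_orbit (eps1 k); gl_orbit (J21 k); gl_orbit (J22 k);
  gl_orbit (J40 k); N27 k] i.
have cE : components = [seq closure (O i) | i <- iota 0 5] by [].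
have N27base : N27 k (J27 1 (-1)).
  exists (1, -1); last exact: orbit_refl.
  rewrite /= mul1r eq_sym -subr_eq0 opprK (_ : 1 + 1 = 2) //; ring.
have N27P P : covariant P -> (forall a b p m r u ph, P (fam2 a b p m r) u ph = 0) ->
    forall d : structures k 5, N27 k d -> ~ nonvanishing P d.
  by move=> PC H d [[e f] _]; rewrite J27_fam2; apply: vanishing_orbit.
(* Each orbit has one covariant that is nonzero on it and zero on the other four members. [N27] uses
   the associator against the associative [eps1], and [P27] against the other three. *)
have nsub i j : (i < 5)%N -> (j < 5)%N -> i != j -> ~ (closure (O i) `<=` closure (O j)).
  case: i => [|[|[|[|[|//]]]]] _.
  - case: j => [|[|[|[|[|//]]]]] // _ _;
      apply: (closure_not_sub (@P_eps1_covariant k 5) (orbit_refl _) (@eps1_P_eps1 k)).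
    + by rewrite /O /= J21_fam1 => d;
      apply: vanishing_orbit (@P_eps1_covariant k 5) (fam1_P_eps1 _ _ _).
    + rewrite /O /= (orbit_eq (J22_fam4 three)) => d.
      by apply: vanishing_orbit (@P_eps1_covariant k 5) (fam4_P_eps1 _ _ _ _ _).
    + by rewrite /O /= J40_fam3 => d;
      apply: vanishing_orbit (@P_eps1_covariant k 5) (fam3_P_eps1 _ _ _ _ _).
    exact: N27P (@P_eps1_covariant k 5) (@fam2_P_eps1 k).
  - case: j => [|[|[|[|[|//]]]]] // _ _;
      apply: (closure_not_sub (@P21_covariant k 5) (orbit_refl _) (@J21_P21 k)).
    + by move=> d; apply: vanishing_orbit (@P21_covariant k 5) (@eps1_P21 k).
    + rewrite /O /= (orbit_eq (J22_fam4 three)) => d.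
      by apply: vanishing_orbit (@P21_covariant k 5) (fam4_P21 _ _ _ _ _).
    + by rewrite /O /= J40_fam3 => d;
      apply: vanishing_orbit (@P21_covariant k 5) (fam3_P21 _ _ _ _ _).
    exact: N27P (@P21_covariant k 5) (@fam2_P21 k).
  - case: j => [|[|[|[|[|//]]]]] // _ _;
      apply: (closure_not_sub (@P22_covariant k 5) (orbit_refl _) (J22_P22 three)).
    + by move=> d; apply: vanishing_orbit (@P22_covariant k 5) (@eps1_P22 k).
    + by rewrite /O /= J21_fam1 => d;
      apply: vanishing_orbit (@P22_covariant k 5) (fam1_P22 _ _ _).
    + by rewrite /O /= J40_fam3 => d;
      apply: vanishing_orbit (@P22_covariant k 5) (fam3_P22 _ _ _ _ _).
    exact: N27P (@P22_covariant k 5) (@fam2_P22 k).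
  - case: j => [|[|[|[|[|//]]]]] // _ _;
      apply: (closure_not_sub (@P40_covariant k 5) (orbit_refl _) (@J40_P40 k)).
    + by move=> d; apply: vanishing_orbit (@P40_covariant k 5) (@eps1_P40 k).
    + by rewrite /O /= J21_fam1 => d;
      apply: vanishing_orbit (@P40_covariant k 5) (fam1_P40 _ _ _).
    + rewrite /O /= (orbit_eq (J22_fam4 three)) => d.
      by apply: vanishing_orbit (@P40_covariant k 5) (fam4_P40 _ _ _ _ _).
    exact: N27P (@P40_covariant k 5) (@fam2_P40 k).
  case: j => [|[|[|[|[|//]]]]] // _ _.
  - apply: (closure_not_sub (@P_assoc_covariant k 5) N27base (@J27_P_assoc k)) => d.
    exact: vanishing_orbit (@P_assoc_covariant k 5) (@eps1_P_assoc k).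
  - apply: (closure_not_sub (@P27_covariant k 5) N27base (J27_P27 two)).
    by rewrite /O /= J21_fam1 => d; apply: vanishing_orbit (@P27_covariant k 5) (fam1_P27 _ _ _).
  - apply: (closure_not_sub (@P27_covariant k 5) N27base (J27_P27 two)).
    rewrite /O /= (orbit_eq (J22_fam4 three)) => d.
    by apply: vanishing_orbit (@P27_covariant k 5) (fam4_P27 _ _ _ _ _).
  apply: (closure_not_sub (@P27_covariant k 5) N27base (J27_P27 two)).
  by rewrite /O /= J40_fam3 => d; apply: vanishing_orbit (@P27_covariant k 5) (fam3_P27 _ _ _ _ _).
have sub_eq i j : (i < 5)%N -> (j < 5)%N -> closure (O i) `<=` closure (O j) -> i = j.
  move=> i5 j5 sij; apply/eqP; apply: contraT => ij.
  by case: (nsub i j i5 j5 ij).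
split.
  rewrite cE map_inj_in_uniq ?iota_uniq // => i j; rewrite !mem_iota /= => i5 j5 E.
  by apply: sub_eq => //; rewrite E.
have cP C : C \in components -> exists2 i, (i < 5)%N & C = closure (O i).
  by rewrite cE => /mapP[i]; rewrite mem_iota /= => i5 ->; exists i.
apply: irreducible_componentsE.
- move=> C /cP[i i5 ->]; split; first exact: closed_closure.
  apply: irreducible_closure.
  by case: i i5 => [|[|[|[|[|//]]]]] _; rewrite /O /=;
    first [exact: irreducible_orbit|exact: irreducible_N27].
- apply/seteqP; split=> c.
    move=> /(JorN_components two three) [H|H|H|[H|H]]; eexists; try exact: H;
    by rewrite /= !inE eqxx ?orbT.
  move=> [C /cP[i i5 ->]]; apply: closure_sub c; first exact: closed_JorN.
  case: i i5 => [|[|[|[|[|//]]]]] _; rewrite /O /=; last exact: N27_JorN.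
  - by apply: orbit_JorN; apply: eps1_JorN.
  - by apply: orbit_JorN; rewrite J21_fam1; apply: fam1_JorN.
  - by apply: orbit_JorN; apply: J22_JorN.
  by apply: orbit_JorN; rewrite J40_fam3; apply: fam3_JorN.
move=> C E /cP[i i5 ->] /cP[j j5 ->] /(sub_eq _ _ i5 j5) -> //.
Qed.
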